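(* There is a polynomial-time vanishing regret algorithm for the online learning version of the Generalized Knapsack Problem.
   Context: Generalized Knapsack Problem (GKP): given items $i=1,\dots,n$ with non-negative weights $w_i$ and non-negative profits $p_i$, a capacity $B\in\mathbb{R}_+$ and a constant $c\in\mathbb{R}_+$, find $A\subseteq[n]$ maximizing $\mathrm{profit}(A)=\sum_{i\in A}p_i-c\max\{0,\sum_{i\in A}w_i-B\}$. In the online version, the weights $w_i$ and $c$ are fixed, and in each round $t=1,\dots,T$ the algorithm (possibly randomized) chooses a set $A^t$, after which the profits $p^t$ and capacity $B^t$ of that round are revealed and the algorithm gains $\mathrm{profit}$ of $A^t$ under $(p^t,B^t)$. The regret is the (expected) difference between the total profit of the best fixed set in hindsight and the algorithm's total profit. A polynomial-time vanishing regret algorithm computes each decision in time polynomial in the instance size $n$ and $t$, and has expected regret at most $p(n)T^c$ for some polynomial $p$ and constant $0\le c<1$.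
   Formalization: Profits are assumed at most 1 and c times each weight at most 1; without such a normalization no regret bound p(n)T^c can hold, since scaling profits and c scales the regret. Time is counted in unit-cost real-number operations. *)

(* Defs.v *)
From Stdlib Require Import Reals Lra Lia List ZArith.
Import ListNotations.
Open Scope R_scope.

Definition rsum (n : nat) (f : nat -> R) : R :=
  fold_right Rplus 0 (map f (seq 0 n)).

Definition gkp_profit (n : nat) (w : nat -> R) (c : R)
  (p : nat -> R) (B : R) (A : nat -> bool) : R :=
  rsum n (fun i => if A i then p i else 0)
  - c * Rmax 0 (rsum n (fun i => if A i then w i else 0) - B).

(* Model of computation: a randomized two-sorted register machine       *)
(* (BSS / real-RAM style, unit cost): real registers with + - * / and   *)
(* comparisons, integer constants only, natural-number index registers  *)
(* with + and truncated -, indirect addressing, and fair coin flips.    *)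

Inductive instr : Type :=
| RConst  (k : nat) (z : Z)
| RAdd    (k i j : nat)
| RSub    (k i j : nat)
| RMul    (k i j : nat)
| RDiv    (k i j : nat)              (* r[k] := r[i] / r[j]  (0 if r[j]=0)*)
| RLoadI  (k a : nat)
| RStoreI (a k : nat)
| NConst  (a m : nat)
| NAdd    (a b d : nat)
| NSub    (a b d : nat)              (* x[a] := x[b] - x[d] (truncated)   *)
| NLoadI  (a b : nat)
| NStoreI (a b : nat)
| JRlt    (i j l : nat)
| JReq    (i j l : nat)
| JNlt    (a b l : nat)
| Jmp     (l : nat)
| Coin    (k : nat)
| Halt.

Definition program := list instr.

Record mstate : Type := MState {
  pc : nat;
  rr : nat -> R;
  xr : nat -> nat;
  ncoins : nat
}.

Definition updR (f : nat -> R) (k : nat) (v : R) : nat -> R :=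
  fun j => if Nat.eqb j k then v else f j.
Definition updN (f : nat -> nat) (k : nat) (v : nat) : nat -> nat :=
  fun j => if Nat.eqb j k then v else f j.

Definition safe_div (a b : R) : R :=
  if Req_EM_T b 0 then 0 else a / b.

(* One step; [None] means the machine has halted (Halt or pc out of range). *)
Definition step (P : program) (coins : list bool) (s : mstate) : option mstate :=
  let r := rr s in let x := xr s in let nx := S (pc s) in
  match nth_error P (pc s) with
  | None => None
  | Some Halt => None
  | Some (RConst k z) => Some (MState nx (updR r k (IZR z)) x (ncoins s))
  | Some (RAdd k i j) => Some (MState nx (updR r k (r i + r j)) x (ncoins s))
  | Some (RSub k i j) => Some (MState nx (updR r k (r i - r j)) x (ncoins s))
  | Some (RMul k i j) => Some (MState nx (updR r k (r i * r j)) x (ncoins s))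
  | Some (RDiv k i j) => Some (MState nx (updR r k (safe_div (r i) (r j))) x (ncoins s))
  | Some (RLoadI k a) => Some (MState nx (updR r k (r (x a))) x (ncoins s))
  | Some (RStoreI a k) => Some (MState nx (updR r (x a) (r k)) x (ncoins s))
  | Some (NConst a m) => Some (MState nx r (updN x a m) (ncoins s))
  | Some (NAdd a b d) => Some (MState nx r (updN x a (x b + x d)%nat) (ncoins s))
  | Some (NSub a b d) => Some (MState nx r (updN x a (x b - x d)%nat) (ncoins s))
  | Some (NLoadI a b) => Some (MState nx r (updN x a (x (x b))) (ncoins s))
  | Some (NStoreI a b) => Some (MState nx r (updN x (x a) (x b)) (ncoins s))
  | Some (JRlt i j l) =>
      Some (MState (if Rlt_dec (r i) (r j) then l else nx) r x (ncoins s))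
  | Some (JReq i j l) =>
      Some (MState (if Req_EM_T (r i) (r j) then l else nx) r x (ncoins s))
  | Some (JNlt a b l) =>
      Some (MState (if Nat.ltb (x a) (x b) then l else nx) r x (ncoins s))
  | Some (Jmp l) => Some (MState l r x (ncoins s))
  | Some (Coin k) =>
      Some (MState nx (updR r k (if nth (ncoins s) coins false then 1 else 0))
                   x (S (ncoins s)))
  end.

(* [run P coins fuel s] = Some final state if P halts from s within
   [fuel] steps (each executed instruction, including the final Halt,
   costs one unit), None otherwise. *)
Fixpoint run (P : program) (coins : list bool) (fuel : nat) (s : mstate)
  : option mstate :=
  match fuel with
  | O => None
  | S f => match step P coins s with
           | None => Some s
           | Some s' => run P coins f s'
           end
  end.

(* Rounds are numbered 0,1,...,T-1 (round s is round s+1 of the paper).  *)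
(* Data of round s: profits p s : nat -> R and capacity B s : R.         *)
(* Input of the algorithm before round s: n, s, the weights w, the       *)
(* constant c and the revealed history (p 0, B 0), ..., (p (s-1), B (s-1)).*)
(* Encoding: x[0] = n, x[1] = s, other index registers 0;                *)
(*   r[i] = w i (i < n), r[n] = c,                                       *)
(*   r[(n+1) + q*(n+1) + i] = p q i (i < n), r[(n+1)+q*(n+1)+n] = B q    *)
(*   for q < s; all other real registers 0.                              *)
(* Output: the set A = { i < n | r[i] <> 0 } in the halting state.      *)

Definition init_state (n : nat) (w : nat -> R) (c : R)
  (p : nat -> nat -> R) (B : nat -> R) (s : nat) : mstate :=
  MState 0
    (fun j =>
       if Nat.ltb j n then w j
       else if Nat.eqb j n then c
       else let j' := (j - S n)%nat in
            let q := (j' / S n)%nat in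
            let i := (j' mod S n)%nat in
            if Nat.ltb q s then (if Nat.ltb i n then p q i else B q) else 0)
    (fun a => if Nat.eqb a 0 then n else if Nat.eqb a 1 then s else O)
    0.

Definition output_set (o : option mstate) : nat -> bool :=
  fun i => match o with
           | Some st => if Req_EM_T (rr st i) 0 then false else true
           | None => false
           end.

Fixpoint all_coins (L : nat) : list (list bool) :=
  match L with
  | O => [[]]
  | S L' => map (cons true) (all_coins L') ++ map (cons false) (all_coins L')
  end.

Definition time_bound (k n s : nat) : nat := ((n + s + 2) ^ k)%nat.

Definition alg_set (P : program) (k n : nat) (w : nat -> R) (c : R)
  (p : nat -> nat -> R) (B : nat -> R) (s : nat) (coins : list bool)
  : nat -> bool :=
  output_set (run P coins (time_bound k n s) (init_state n w c p B s)).

(* Expected profit of P in round s (fresh uniform coins each round;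
   under the time bound at most time_bound k n s coins can be read). *)
Definition alg_exp_profit (P : program) (k n : nat) (w : nat -> R) (c : R)
  (p : nat -> nat -> R) (B : nat -> R) (s : nat) : R :=
  let L := time_bound k n s in
  fold_right Rplus 0
    (map (fun coins => gkp_profit n w c (p s) (B s)
                         (alg_set P k n w c p B s coins))
         (all_coins L))
  / (2 ^ L).

Definition gkp_valid (n : nat) (w : nat -> R) (c : R)
  (p : nat -> nat -> R) (B : nat -> R) : Prop :=
  0 <= c /\
  (forall i, (i < n)%nat -> 0 <= w i /\ c * w i <= 1) /\
  (forall s i, (i < n)%nat -> 0 <= p s i <= 1) /\
  (forall s, 0 <= B s).

Definition poly_time (P : program) (k : nat) : Prop :=
  forall n w c p B s (coins : list bool),
    gkp_valid n w c p B ->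
    run P coins (time_bound k n s) (init_state n w c p B s) <> None.

Definition regret_vs (P : program) (k n : nat) (w : nat -> R) (c : R)
  (p : nat -> nat -> R) (B : nat -> R) (T : nat) (A : nat -> bool) : R :=
  rsum T (fun s => gkp_profit n w c (p s) (B s) A)
  - rsum T (fun s => alg_exp_profit P k n w c p B s).

(* Main.v *)
(** Hedge over all 2^n sets, with multiplicative weights that factor.  Rounding
    the weights c w_i down to multiples k_i / m of 1/m changes every profit by
    at most n/m, and makes the penalty a function of the integer
    W = sum of the k_i.  With 1 + eta p_i and 1 - eta max(0, W/m - c B) in
    place of exponentials, the weight of a set is (prod_(i in A) a_i) phi(W),
    so the normalising sums Z are computed by dynamic programming over W, and a
    set is drawn item by item, item i being taken with probability
    a_i Z(i+1, W + k_i) / Z(i, W); s fair coins approximate each of these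
    probabilities to 2^-s.
    The horizon is unknown, so the algorithm restarts at the rounds
    (4^j - 1) / 3, with m = 2^j and eta = 1 / (4 (n+1) m) during the j-th
    epoch; the regret is O(n^2 2^j) per epoch, hence O(n^2 sqrt T). *)

(* The machine has field operations, comparisons and coins only, so exact exponential weights are
   out of reach. The surrogate factors differ from exp (eta * profit) at second order, O(eta^2 n^2)
   per round, which is what the analysis of Hedge loses anyway. Validity gives c w_i <= 1, hence
   profits in [-n, n], and the choice of eta keeps eta * |profit| <= 1/4, the range where these
   expansions are used. An epoch has m^2 rounds, which balances its losses: log (2^n) / eta is O(n^2
   m), the second-order terms add O(eta n^2 m^2) = O(n m), and rounding costs n/m in each of m^2
   rounds. In round s one has m <= s + 1, so a table with n m + 1 columns stays polynomial. A draw
   with s coins per item costs at most 2 n^2 2^-s in round s, which is summable over all rounds, and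
   it reads n s coins in total. The data sequence is oblivious and every round draws afresh from the
   revealed history, so the regret is a plain sum of expectations, one per round. The program has to
   be a concrete instruction list; it is written in a structured language whose compiler is proved
   correct, step counts included. *)
From Stdlib Require Import Reals Lra Lia List ZArith Bool.
Require Import Defs.
Import ListNotations.
Open Scope R_scope.

(** * A structured language and its compiler *)

(** [mstate] without [pc]: structured commands transform memory, and addresses of code appear only
    in [compile]. *)
Record mem : Type := Mem { mr : nat -> R; mx : nat -> nat; mc : nat }.

Definition at_pc (l : nat) (m : mem) : mstate := MState l (mr m) (mx m) (mc m).

Inductive test : Type := TRlt (i j : nat) | TNlt (a b : nat).

(* [For a b c] runs [c] with counter [a] going from [x[b]] down to [1].
   The compiled code needs [x[2] = 0] and [x[3] = 1]. *)
Inductive cmd : Type :=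
| Skip
| Prim (i : instr)
| Seq (c1 c2 : cmd)
| If (t : test) (c1 c2 : cmd)
| For (a b : nat) (c : cmd).

Definition eval_test (t : test) (r : nat -> R) (x : nat -> nat) : bool :=
  match t with
  | TRlt i j => if Rlt_dec (r i) (r j) then true else false
  | TNlt a b => Nat.ltb (x a) (x b)
  end.

(** Running a one-instruction program inherits the meaning of each instruction from [step]. *)
Definition prim (coins : list bool) (i : instr) (m : mem) : mem :=
  match step [i] coins (at_pc 0 m) with
  | Some s => Mem (rr s) (xr s) (ncoins s)
  | None => m
  end.

Definition is_prim (i : instr) : bool :=
  match i with
  | JRlt _ _ _ | JReq _ _ _ | JNlt _ _ _ | Jmp _ | Halt => false
  | _ => true
  end.

(** The iteration count of a loop is read on entry, which makes [sem] total. Register 2 holds 0, so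
    [NAdd a b 2] is a copy; register 3 holds 1, so [NSub a a 3] is a decrement. *)
Fixpoint sem (coins : list bool) (c : cmd) (m : mem) : mem :=
  match c with
  | Skip => m
  | Prim i => prim coins i m
  | Seq c1 c2 => sem coins c2 (sem coins c1 m)
  | If t c1 c2 => if eval_test t (mr m) (mx m) then sem coins c1 m else sem coins c2 m
  | For a b c =>
      Nat.iter (mx m b)
        (fun m => prim coins (NSub a a 3) (sem coins c m))
        (prim coins (NAdd a b 2) m)
  end.

Definition jump (t : test) (l : nat) : instr :=
  match t with TRlt i j => JRlt i j l | TNlt a b => JNlt a b l end.

Fixpoint csize (c : cmd) : nat :=
  match c with
  | Skip => 0
  | Prim _ => 1
  | Seq c1 c2 => csize c1 + csize c2
  | If _ c1 c2 => 2 + csize c2 + csize c1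
  | For _ _ c => 5 + csize c
  end.

(** Jumps are taken when the test succeeds, so the else branch [c2] comes first and [c1] is the jump
    target. In a loop, [l + 1] tests 0 < x[a], [l + 2] leaves, and the body starts at [l + 3]. *)
Fixpoint compile (l : nat) (c : cmd) : list instr :=
  match c with
  | Skip => []
  | Prim i => [i]
  | Seq c1 c2 => compile l c1 ++ compile (l + csize c1) c2
  | If t c1 c2 =>
      jump t (l + csize c2 + 2) :: compile (l + 1) c2
      ++ Jmp (l + csize c2 + 2 + csize c1) :: compile (l + csize c2 + 2) c1
  | For a b c =>
      NAdd a b 2 :: JNlt 2 a (l + 3) :: Jmp (l + 5 + csize c)
      :: compile (l + 3) c ++ [NSub a a 3; Jmp (l + 1)]
  end.

(** Leaving costs 2: the failed test and the exit jump. An iteration adds 3 to its body: test,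
    decrement and back jump. *)
Fixpoint loop_cost (f : mem -> mem) (g : mem -> nat) (k : nat) (m : mem) : nat :=
  match k with
  | O => 2
  | S k => 3 + g m + loop_cost f g k (f m)
  end.

Fixpoint cost (coins : list bool) (c : cmd) (m : mem) : nat :=
  match c with
  | Skip => 0
  | Prim _ => 1
  | Seq c1 c2 => cost coins c1 m + cost coins c2 (sem coins c1 m)
  | If t c1 c2 =>
      if eval_test t (mr m) (mx m) then 1 + cost coins c1 m
      else 2 + cost coins c2 m
  | For a b c =>
      1 + loop_cost (fun m => prim coins (NSub a a 3) (sem coins c m))
            (cost coins c) (mx m b) (prim coins (NAdd a b 2) m)
  end.

(** The target of [NStoreI] is not known statically, so it counts as writing every index
    register. *)
Definition iwrites (a : nat) (i : instr) : bool :=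
  match i with
  | NConst b _ | NAdd b _ _ | NSub b _ _ | NLoadI b _ => Nat.eqb a b
  | NStoreI _ _ => true
  | _ => false
  end.

Fixpoint writes (a : nat) (c : cmd) : bool :=
  match c with
  | Skip => false
  | Prim i => iwrites a i
  | Seq c1 c2 | If _ c1 c2 => writes a c1 || writes a c2
  | For b _ c => Nat.eqb a b || writes a c
  end.

(** Guarantees that the constants in registers 2 and 3 survive and that no loop body touches its own
    counter, so that compiled loops run exactly as often as [sem] iterates. *)
Fixpoint wf (c : cmd) : bool :=
  match c with
  | Skip => true
  | Prim i => is_prim i && negb (iwrites 2 i) && negb (iwrites 3 i)
  | Seq c1 c2 | If _ c1 c2 => wf c1 && wf c2
  | For a _ c =>
      wf c && negb (writes a c) && negb (Nat.eqb a 2) && negb (Nat.eqb a 3)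
  end.

Lemma prim_nowrite (coins : list bool) (i : instr) (a : nat) (m : mem) :
  iwrites a i = false -> mx (prim coins i m) a = mx m a.
Proof.
  destruct i; cbn; intros H; try reflexivity; try discriminate;
    unfold updN; rewrite H; reflexivity.
Qed.

Lemma iter_inv {X : Type} (f : X -> X) (I : nat -> X -> Prop) (k : nat) (x : X) :
  I 0%nat x ->
  (forall j y, (j < k)%nat -> I j y -> I (S j) (f y)) ->
  I k (Nat.iter k f x).
Proof.
  intros H0 HS.
  assert (G : forall j, (j <= k)%nat -> I j (Nat.iter j f x)).
  { induction j as [|j IH]; intros Hj; [exact H0|].
    apply HS; [lia|]. apply IH; lia. }
  apply G; lia.
Qed.

Lemma sem_nowrite (coins : list bool) (c : cmd) (a : nat) (m : mem) :
  writes a c = false -> mx (sem coins c m) a = mx m a.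
Proof.
  revert m; induction c as [|i|c1 IH1 c2 IH2|t c1 IH1 c2 IH2|b d c IH];
    intros m H; cbn [writes] in H.
  - reflexivity.
  - apply prim_nowrite; exact H.
  - apply orb_false_iff in H as [H1 H2]; cbn; rewrite IH2, IH1; auto.
  - apply orb_false_iff in H as [H1 H2]; cbn.
    destruct (eval_test _ _ _); auto.
  - apply orb_false_iff in H as [H1 H2]; cbn [sem].
    apply (iter_inv _ (fun _ y => mx y a = mx m a)).
    + apply prim_nowrite; exact H1.
    + intros j y _ E. rewrite prim_nowrite, IH; auto.
Qed.

Lemma wf_writes (c : cmd) : wf c = true -> writes 2 c = false /\ writes 3 c = false.
Proof.
  induction c as [|i|c1 IH1 c2 IH2|t c1 IH1 c2 IH2|b d c IH]; cbn [wf writes]; intros H.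
  - auto.
  - apply andb_prop in H as [H H3]; apply andb_prop in H as [H H2].
    apply negb_true_iff in H2; apply negb_true_iff in H3; auto.
  - apply andb_prop in H as [H1 H2].
    destruct (IH1 H1) as [-> ->], (IH2 H2) as [-> ->]; auto.
  - apply andb_prop in H as [H1 H2].
    destruct (IH1 H1) as [-> ->], (IH2 H2) as [-> ->]; auto.
  - apply andb_prop in H as [H H3]; apply andb_prop in H as [H H2];
      apply andb_prop in H as [H H1].
    destruct (IH H) as [-> ->].
    apply negb_true_iff in H2; apply negb_true_iff in H3.
    rewrite (Nat.eqb_sym 2 b), (Nat.eqb_sym 3 b), H2, H3; auto.
Qed.

(** * Correctness of the compiled code, with exact step counts *)

Lemma csize_compile (c : cmd) : forall l, length (compile l c) = csize c.
Proof.
  induction c; intros l; cbn; rewrite ?length_app; cbn;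
    rewrite ?length_app, ?IHc1, ?IHc2, ?IHc; cbn; try lia.
Qed.

(** [run] returns halted states only; this relation describes partial executions, which can be
    concatenated. *)
Inductive reach (P : program) (coins : list bool) : nat -> mstate -> mstate -> Prop :=
| reach0 s : reach P coins 0 s s
| reachS k s s' s'' :
    step P coins s = Some s' -> reach P coins k s' s'' -> reach P coins (S k) s s''.

Lemma reach_trans (P : program) (coins : list bool) (k1 k2 : nat) (s1 s2 s3 : mstate) :
  reach P coins k1 s1 s2 -> reach P coins k2 s2 s3 -> reach P coins (k1 + k2) s1 s3.
Proof. induction 1; cbn; [auto|]. intros; econstructor; eauto. Qed.

(** The inequality is strict because [run] spends one unit of fuel on noticing that the machine has
    halted. *)
Lemma reach_run (P : program) (coins : list bool) (k fuel : nat) (s s' : mstate) :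
  reach P coins k s s' -> step P coins s' = None -> (k < fuel)%nat ->
  run P coins fuel s = Some s'.
Proof.
  intros H; revert fuel; induction H; intros fuel HN Hf; destruct fuel; try lia; cbn.
  - rewrite HN; reflexivity.
  - rewrite H. apply IHreach; [exact HN | lia].
Qed.

Definition code_at (P : program) (l : nat) (L : list instr) : Prop :=
  forall j, (j < length L)%nat -> nth_error P (l + j) = nth_error L j.

Lemma code_at_app (P : program) (l : nat) (L1 L2 : list instr) :
  code_at P l (L1 ++ L2) -> code_at P l L1 /\ code_at P (l + length L1) L2.
Proof.
  intros H; split; intros j Hj.
  - rewrite H by (rewrite length_app; lia). apply nth_error_app1; lia.
  - rewrite <- Nat.add_assoc, H by (rewrite length_app; lia).
    rewrite nth_error_app2 by lia. f_equal; lia.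
Qed.

Lemma code_at_cons (P : program) (l : nat) (i : instr) (L : list instr) :
  code_at P l (i :: L) -> nth_error P l = Some i /\ code_at P (l + 1) L.
Proof.
  intros H; change (i :: L) with ([i] ++ L) in H; apply code_at_app in H as [H1 H2].
  split; [|exact H2]. specialize (H1 0%nat); rewrite Nat.add_0_r in H1.
  apply H1; cbn; lia.
Qed.

Lemma step_prim (P : program) (coins : list bool) (l : nat) (i : instr) (m : mem) :
  nth_error P l = Some i -> is_prim i = true ->
  step P coins (at_pc l m) = Some (at_pc (S l) (prim coins i m)).
Proof.
  intros H Hp; destruct i; try discriminate Hp;
    unfold step, at_pc; cbn [pc]; rewrite H; reflexivity.
Qed.

Lemma step_jump (P : program) (coins : list bool) (l l' : nat) (t : test) (m : mem) :
  nth_error P l = Some (jump t l') ->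
  step P coins (at_pc l m)
  = Some (at_pc (if eval_test t (mr m) (mx m) then l' else S l) m).
Proof.
  intros H; destruct t; cbn [jump] in H; unfold step, at_pc; cbn [pc rr xr ncoins];
    rewrite H; cbn [eval_test].
  - destruct (Rlt_dec _ _); reflexivity.
  - reflexivity.
Qed.

Lemma step_jmp (P : program) (coins : list bool) (l l' : nat) (m : mem) :
  nth_error P l = Some (Jmp l') -> step P coins (at_pc l m) = Some (at_pc l' m).
Proof. intros H; unfold step, at_pc; cbn [pc]; rewrite H; reflexivity. Qed.

Lemma compile_correct (P : program) (coins : list bool) (c : cmd) :
  forall l m,
  wf c = true -> code_at P l (compile l c) -> mx m 2 = 0%nat -> mx m 3 = 1%nat ->
  reach P coins (cost coins c m) (at_pc l m) (at_pc (l + csize c) (sem coins c m)).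
Proof.
  induction c as [|i|c1 IH1 c2 IH2|t c1 IH1 c2 IH2|a b c IH]; intros l m W C H2 H3.
  - cbn. rewrite Nat.add_0_r. constructor.
  - cbn in *. apply code_at_cons in C as [C _].
    apply andb_prop in W as [W _]; apply andb_prop in W as [W _].
    rewrite Nat.add_1_r. econstructor; [apply step_prim; eassumption | constructor].
  - cbn [wf compile cost sem csize] in *. apply andb_prop in W as [W1 W2].
    apply code_at_app in C as [C1 C2]; rewrite csize_compile in C2.
    destruct (wf_writes _ W1) as [N2 N3].
    eapply reach_trans; [apply IH1; assumption|].
    rewrite Nat.add_assoc. apply IH2; try assumption; rewrite sem_nowrite; auto.
  - cbn [wf compile cost sem csize] in *. apply andb_prop in W as [W1 W2].
    apply code_at_cons in C as [C0 C]; apply code_at_app in C as [C2 C];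
      rewrite csize_compile in C; apply code_at_cons in C as [C3 C1].
    destruct (eval_test t (mr m) (mx m)) eqn:E.
    + eapply reachS; [rewrite (step_jump _ _ _ _ _ _ C0), E; reflexivity|].
      replace (l + (2 + csize c2 + csize c1))%nat
        with (l + csize c2 + 2 + csize c1)%nat by lia.
      apply IH1; try assumption.
      replace (l + csize c2 + 2)%nat with (l + 1 + csize c2 + 1)%nat at 1 by lia.
      exact C1.
    + eapply reachS; [rewrite (step_jump _ _ _ _ _ _ C0), E; reflexivity|].
      replace (S (cost coins c2 m)) with (cost coins c2 m + 1)%nat by lia.
      eapply reach_trans.
      { replace (S l) with (l + 1)%nat by lia. apply IH2; assumption. }
      eapply reachS; [apply step_jmp; exact C3|].
      replace (l + (2 + csize c2 + csize c1))%nat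
        with (l + csize c2 + 2 + csize c1)%nat by lia.
      constructor.
  - cbn [wf compile cost sem csize] in *.
    apply andb_prop in W as [W Wa3]; apply andb_prop in W as [W Wa2];
      apply andb_prop in W as [W Wa].
    apply negb_true_iff in Wa, Wa2, Wa3.
    apply code_at_cons in C as [C0 C]; apply code_at_cons in C as [C1 C];
      apply code_at_cons in C as [C2 C].
    replace (l + 1 + 1 + 1)%nat with (l + 3)%nat in C by lia.
    apply code_at_app in C as [Cb C]; rewrite csize_compile in C.
    apply code_at_cons in C as [C3 C]; apply code_at_cons in C as [C4 _].
    eapply reachS; [apply step_prim; [exact C0 | reflexivity]|].
    destruct (wf_writes _ W) as [N2 N3].
    set (m0 := prim coins (NAdd a b 2) m).
    assert (X2 : mx m0 2 = 0%nat).
    { unfold m0; rewrite prim_nowrite; [exact H2 | cbn [iwrites]; rewrite Nat.eqb_sym; exact Wa2]. }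
    assert (X3 : mx m0 3 = 1%nat).
    { unfold m0; rewrite prim_nowrite; [exact H3 | cbn [iwrites]; rewrite Nat.eqb_sym; exact Wa3]. }
    assert (Xa : mx m0 a = mx m b).
    { unfold m0; cbn; unfold updN; rewrite Nat.eqb_refl, H2; lia. }
    (* From here on, induction on the number of remaining iterations, which is the current value of
       the counter. *)
    clearbody m0. revert m0 X2 X3 Xa. generalize (mx m b) as k.
    induction k as [|k IHk]; intros m0 X2 X3 Xa.
    + cbn [loop_cost Nat.iter nat_rect].
      eapply reachS.
      { replace (S l) with (l + 1)%nat by lia.
        rewrite (step_jump _ _ _ (l+3) (TNlt 2 a) m0 C1). cbn [eval_test].
        rewrite X2, Xa. reflexivity. }
      eapply reachS.
      { apply step_jmp. replace (S (l + 1)) with (l + 1 + 1)%nat by lia. exact C2. }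
      replace (l + (5 + csize c))%nat with (l + 5 + csize c)%nat by lia. constructor.
    + rewrite Nat.iter_succ_r. cbn [loop_cost].
      eapply reachS.
      { replace (S l) with (l + 1)%nat by lia.
        rewrite (step_jump _ _ _ (l+3) (TNlt 2 a) m0 C1). cbn [eval_test].
        rewrite X2, Xa. reflexivity. }
      cbn [Nat.add]. rewrite !plus_n_Sm.
      eapply reach_trans; [apply IH; assumption|].
      eapply reachS; [apply step_prim; [exact C3 | reflexivity]|].
      eapply reachS.
      { apply step_jmp. rewrite <- Nat.add_1_r. exact C4. }
      replace (l + 1)%nat with (S l) by lia.
      apply IHk.
      * rewrite prim_nowrite, sem_nowrite; auto. cbn [iwrites]; rewrite Nat.eqb_sym; exact Wa2.
      * rewrite prim_nowrite, sem_nowrite; auto. cbn [iwrites]; rewrite Nat.eqb_sym; exact Wa3.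
      * cbn; unfold updN. rewrite Nat.eqb_refl, !sem_nowrite, X3, Xa by auto. lia.
Qed.

(** * A syntactic bound on the running time *)

Fixpoint sources (c : cmd) : list nat :=
  match c with
  | Skip | Prim _ => []
  | Seq c1 c2 | If _ c1 c2 => sources c1 ++ sources c2
  | For _ b c => b :: sources c
  end.

Fixpoint cost_bound (N : nat) (c : cmd) : nat :=
  match c with
  | Skip => 0
  | Prim _ => 1
  | Seq c1 c2 => cost_bound N c1 + cost_bound N c2
  | If _ c1 c2 => 2 + cost_bound N c1 + cost_bound N c2
  | For _ _ c => 3 + N * (3 + cost_bound N c)
  end.

(** Registers that supply iteration counts and are never written keep their entry values, so one
    bound [N] at the start controls all loops, nested ones included. The result is a polynomial in
    [N] whose degree is the nesting depth. *)
Lemma cost_le_bound (coins : list bool) (N : nat) (c : cmd) :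
  forall m,
  (forall b, In b (sources c) -> writes b c = false /\ (mx m b <= N)%nat) ->
  (cost coins c m <= cost_bound N c)%nat.
Proof.
  induction c as [|i|c1 IH1 c2 IH2|t c1 IH1 c2 IH2|a b c IH]; intros m H;
    cbn [cost cost_bound sources writes] in *.
  - lia.
  - lia.
  - apply Nat.add_le_mono.
    + apply IH1. intros d Hd. destruct (H d) as [Hw Hx]; [apply in_or_app; auto|].
      apply orb_false_iff in Hw as [Hw1 Hw2]; auto.
    + apply IH2. intros d Hd. destruct (H d) as [Hw Hx]; [apply in_or_app; auto|].
      apply orb_false_iff in Hw as [Hw1 Hw2]. rewrite sem_nowrite; auto.
  - assert (cost coins c1 m <= cost_bound N c1)%nat.
    { apply IH1. intros d Hd. destruct (H d) as [Hw Hx]; [apply in_or_app; auto|].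
      apply orb_false_iff in Hw as [Hw1 Hw2]; auto. }
    assert (cost coins c2 m <= cost_bound N c2)%nat.
    { apply IH2. intros d Hd. destruct (H d) as [Hw Hx]; [apply in_or_app; auto|].
      apply orb_false_iff in Hw as [Hw1 Hw2]; auto. }
    destruct (eval_test _ _ _); lia.
  - set (m0 := prim coins (NAdd a b 2) m).
    assert (H0 : forall d, In d (sources c) ->
      Nat.eqb d a = false /\ writes d c = false /\ (mx m0 d <= N)%nat).
    { intros d Hd. destruct (H d) as [Hw Hx]; [right; exact Hd|].
      apply orb_false_iff in Hw as [Hw1 Hw2]; repeat split; auto.
      unfold m0. rewrite prim_nowrite; auto. }
    assert (Hb : (mx m b <= N)%nat) by (apply H; left; reflexivity).
    clearbody m0. clear H.
    enough (G : forall k m0, (forall d, In d (sources c) ->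
      Nat.eqb d a = false /\ writes d c = false /\ (mx m0 d <= N)%nat) ->
      (loop_cost (fun m => prim coins (NSub a a 3) (sem coins c m)) (cost coins c) k m0
        <= 2 + k * (3 + cost_bound N c))%nat).
    { specialize (G (mx m b) m0 H0). nia. }
    clear m0 H0. intros k; induction k as [|k IHk]; intros m0 H0; cbn [loop_cost].
    + lia.
    + assert (cost coins c m0 <= cost_bound N c)%nat.
      { apply IH. intros d Hd. destruct (H0 d Hd) as (_ & ? & ?); auto. }
      assert (loop_cost (fun m => prim coins (NSub a a 3) (sem coins c m)) (cost coins c) k
        (prim coins (NSub a a 3) (sem coins c m0)) <= 2 + k * (3 + cost_bound N c))%nat.
      { apply IHk. intros d Hd. destruct (H0 d Hd) as (? & ? & ?); repeat split; auto.
        rewrite prim_nowrite, sem_nowrite; auto. }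
      lia.
Qed.

(** * Programs with arrays *)

(* Abstract view of the memory: sixteen scratch real registers and four
   disjoint arrays, array [t] being interleaved at addresses [16 + 4 j + t].
   Index registers 2, 3 hold 0, 1 and registers 4, 5 serve address computations. *)
Record ast : Type := Ast
  { sr : nat -> R; ar : nat -> nat -> R; ax : nat -> nat; ac : nat }.

Inductive ainstr : Type :=
| AI (i : instr)
| ALd (t k a : nat)
| ASt (t a k : nat).

Inductive acmd : Type :=
| ASkip
| APrim (i : ainstr)
| ASeq (c1 c2 : acmd)
| AIf (t : test) (c1 c2 : acmd)
| AFor (a b : nat) (c : acmd).

Definition upd_arr (f : nat -> nat -> R) (t j : nat) (v : R) : nat -> nat -> R :=
  fun t' => if Nat.eqb t' t then updR (f t) j v else f t'.

Definition aprim (coins : list bool) (i : ainstr) (S : ast) : ast :=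
  match i with
  | AI i => let m := prim coins i (Mem (sr S) (ax S) (ac S)) in
            Ast (mr m) (ar S) (mx m) (mc m)
  | ALd t k a => Ast (updR (sr S) k (ar S t (ax S a))) (ar S) (ax S) (ac S)
  | ASt t a k => Ast (sr S) (upd_arr (ar S) t (ax S a) (sr S k)) (ax S) (ac S)
  end.

Definition set_ax (a v : nat) (S : ast) : ast :=
  Ast (sr S) (ar S) (updN (ax S) a v) (ac S).

Fixpoint asem (coins : list bool) (c : acmd) (S : ast) : ast :=
  match c with
  | ASkip => S
  | APrim i => aprim coins i S
  | ASeq c1 c2 => asem coins c2 (asem coins c1 S)
  | AIf t c1 c2 => if eval_test t (sr S) (ax S) then asem coins c1 S else asem coins c2 S
  | AFor a b c =>
      Nat.iter (ax S b)
        (fun S => let S' := asem coins c S in set_ax a (ax S' a - 1) S')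
        (set_ax a (ax S b) S)
  end.

(** Index registers cannot multiply: two doublings produce the factor 4 of the interleaving. *)
Definition addr (t a : nat) : cmd :=
  Seq (Prim (NAdd 4 a a)) (Seq (Prim (NAdd 4 4 4))
    (Seq (Prim (NConst 5 (16 + t))) (Prim (NAdd 4 4 5)))).

Definition tr_prim (i : ainstr) : cmd :=
  match i with
  | AI i => Prim i
  | ALd t k a => Seq (addr t a) (Prim (RLoadI k 4))
  | ASt t a k => Seq (addr t a) (Prim (RStoreI 4 k))
  end.

Fixpoint tr (c : acmd) : cmd :=
  match c with
  | ASkip => Skip
  | APrim i => tr_prim i
  | ASeq c1 c2 => Seq (tr c1) (tr c2)
  | AIf t c1 c2 => If t (tr c1) (tr c2)
  | AFor a b c => For a b (tr c)
  end.

Definition okr (k : nat) : bool := Nat.ltb k 16.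
(** Registers 0 to 5 hold n, s, the constants 0 and 1, and the address scratch, so an abstract
    program may not assign them. *)
Definition okw (a : nat) : bool := Nat.ltb 5 a.
Definition okx (a : nat) : bool := negb (Nat.eqb a 4) && negb (Nat.eqb a 5).

Definition ok_prim (i : ainstr) : bool :=
  match i with
  | AI (RConst k _) | AI (Coin k) => okr k
  | AI (RAdd k i j) | AI (RSub k i j) | AI (RMul k i j) | AI (RDiv k i j) =>
      okr k && okr i && okr j
  | AI (NConst a _) => okw a
  | AI (NAdd a b d) | AI (NSub a b d) => okw a && okx b && okx d
  | AI _ => false
  | ALd t k a => Nat.ltb t 4 && okr k && okx a
  | ASt t a k => Nat.ltb t 4 && okr k && okx a
  end.

Definition ok_test (t : test) : bool :=
  match t with TRlt i j => okr i && okr j | TNlt a b => okx a && okx b end.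

Fixpoint aok (c : acmd) : bool :=
  match c with
  | ASkip => true
  | APrim i => ok_prim i
  | ASeq c1 c2 => aok c1 && aok c2
  | AIf t c1 c2 => ok_test t && aok c1 && aok c2
  | AFor a b c => okw a && okx b && aok c
  end.

(** Registers 4 and 5 are left unconstrained, since every array access overwrites them. *)
Record view (m : mem) (S : ast) : Prop := View
  { view_sr : forall k, (k < 16)%nat -> mr m k = sr S k;
    view_ar : forall t j, (t < 4)%nat -> mr m (16 + 4 * j + t) = ar S t j;
    view_ax : forall a, okx a = true -> mx m a = ax S a;
    view_ac : mc m = ac S;
    view_0 : mx m 2 = 0%nat;
    view_1 : mx m 3 = 1%nat }.

Lemma updR_same (f : nat -> R) (k : nat) (v : R) : updR f k v k = v.
Proof. unfold updR. rewrite Nat.eqb_refl. reflexivity. Qed.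

Lemma updR_other (f : nat -> R) (k j : nat) (v : R) : j <> k -> updR f k v j = f j.
Proof. intros H; unfold updR. apply Nat.eqb_neq in H; rewrite H; reflexivity. Qed.

Lemma updN_same (f : nat -> nat) (k v : nat) : updN f k v k = v.
Proof. unfold updN. rewrite Nat.eqb_refl. reflexivity. Qed.

Lemma updN_other (f : nat -> nat) (k j v : nat) : j <> k -> updN f k v j = f j.
Proof. intros H; unfold updN. apply Nat.eqb_neq in H; rewrite H; reflexivity. Qed.

Lemma view_updR (r : nat -> R) (x : nat -> nat) (nc nc' k : nat) (v : R) (S : ast) :
  view (Mem r x nc) S -> (k < 16)%nat ->
  view (Mem (updR r k v) x nc') (Ast (updR (sr S) k v) (ar S) (ax S) nc').
Proof.
  intros [V1 V2 V3 V4 V5 V6] Hk; cbn [mr mx mc] in *; split; cbn [mr mx mc sr ar ax ac]; auto.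
  - intros j Hj; unfold updR; destruct (Nat.eqb j k); auto.
  - intros t j Ht. rewrite updR_other by lia. auto.
Qed.

Lemma view_updN (r : nat -> R) (x : nat -> nat) (nc a v : nat) (S : ast) :
  view (Mem r x nc) S -> okw a = true ->
  view (Mem r (updN x a v) nc) (Ast (sr S) (ar S) (updN (ax S) a v) (ac S)).
Proof.
  intros [V1 V2 V3 V4 V5 V6] Hk; cbn [mr mx mc] in *; apply Nat.ltb_lt in Hk;
    split; cbn [mr mx mc sr ar ax ac]; auto.
  - intros j Hj; unfold updN; destruct (Nat.eqb j a); auto.
  - rewrite updN_other by lia; auto.
  - rewrite updN_other by lia; auto.
Qed.

Lemma view_tmp (r : nat -> R) (x : nat -> nat) (nc a v : nat) (S : ast) :
  view (Mem r x nc) S -> okx a = false -> view (Mem r (updN x a v) nc) S.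
Proof.
  intros [V1 V2 V3 V4 V5 V6] Ha; cbn [mr mx mc] in *.
  assert (a = 4 \/ a = 5)%nat as Ha'.
  { unfold okx in Ha. destruct (Nat.eqb_spec a 4), (Nat.eqb_spec a 5); auto; discriminate Ha. }
  split; cbn [mr mx mc]; auto.
  - intros b Hb. rewrite updN_other; [auto|]. intros ->; congruence.
  - rewrite updN_other by lia; auto.
  - rewrite updN_other by lia; auto.
Qed.

Lemma addr_spec (coins : list bool) (t a : nat) (m : mem) (S : ast) :
  view m S -> okx a = true ->
  view (sem coins (addr t a) m) S
  /\ mx (sem coins (addr t a) m) 4 = (16 + 4 * ax S a + t)%nat.
Proof.
  intros V Ha. pose proof (view_ax _ _ V a Ha) as E. destruct m as [r x nc]; cbn [mx] in E.
  unfold addr; cbn [sem prim step at_pc nth_error mr mx mc rr xr ncoins pc].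
  split.
  - do 4 (apply view_tmp; [|reflexivity]). exact V.
  - cbn [mx]. rewrite !updN_same, (updN_other _ 5 4) by lia. rewrite !updN_same. lia.
Qed.

Lemma tr_prim_spec (coins : list bool) (i : ainstr) (m : mem) (S : ast) :
  ok_prim i = true -> view m S -> view (sem coins (tr_prim i) m) (aprim coins i S).
Proof.
  intros H V. destruct i as [i|t k a|t a k].
  - pose proof (view_ac _ _ V) as Ec.
    pose proof (view_sr _ _ V) as Er. pose proof (view_ax _ _ V) as Ex.
    destruct m as [r x nc]; cbn [mr mx mc] in *; subst nc.
    destruct i; cbn [ok_prim] in H; try discriminate H;
      repeat match goal with
      | H : _ && _ = true |- _ => apply andb_prop in H as [? ?]
      | H : okr _ = true |- _ => unfold okr in H; apply Nat.ltb_lt in H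
      end;
      cbn [tr_prim sem aprim prim step at_pc nth_error mr mx mc rr xr ncoins pc];
      rewrite <- ?Er, <- ?Ex by assumption;
      first [ eapply view_updR; eassumption | eapply view_updN; eassumption ].
  - cbn [ok_prim] in H. apply andb_prop in H as [H Ha]; apply andb_prop in H as [Ht Hk].
    apply Nat.ltb_lt in Ht; unfold okr in Hk; apply Nat.ltb_lt in Hk.
    destruct (addr_spec coins t a m S V Ha) as [V' E].
    cbn [tr_prim sem]. destruct (sem coins (addr t a) m) as [r x nc]; cbn [mx] in E.
    cbn [aprim prim step at_pc nth_error mr mx mc rr xr ncoins pc].
    rewrite E. pose proof (view_ar _ _ V' t (ax S a) Ht) as F; cbn [mr] in F; rewrite F.
    pose proof (view_ac _ _ V') as Ec; cbn [mc] in Ec; subst nc.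
    eapply view_updR; eassumption.
  - cbn [ok_prim] in H. apply andb_prop in H as [H Ha]; apply andb_prop in H as [Ht Hk].
    apply Nat.ltb_lt in Ht; unfold okr in Hk; apply Nat.ltb_lt in Hk.
    destruct (addr_spec coins t a m S V Ha) as [V' E].
    cbn [tr_prim sem]. destruct (sem coins (addr t a) m) as [r x nc]; cbn [mx] in E.
    cbn [aprim prim step at_pc nth_error mr mx mc rr xr ncoins pc].
    rewrite E. destruct V' as [V1 V2 V3 V4 V5 V6]; cbn [mr mx mc] in *.
    rewrite <- (V1 k Hk).
    split; cbn [mr mx mc sr ar ax ac]; auto.
    + intros j Hj. rewrite updR_other by lia. auto.
    (* Two addresses 16 + 4 j + t with t < 4 agree only if both j and t agree, so a store changes a
       single abstract cell. *)
    + intros t' j Ht'. unfold upd_arr, updR.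
      destruct (Nat.eqb_spec t' t) as [->|Hn].
      * destruct (Nat.eqb_spec j (ax S a)) as [->|Hn].
        -- rewrite Nat.eqb_refl; reflexivity.
        -- destruct (Nat.eqb_spec (16 + 4 * j + t) (16 + 4 * ax S a + t)); [lia|]; auto.
      * destruct (Nat.eqb_spec (16 + 4 * j + t') (16 + 4 * ax S a + t)); [lia|]; auto.
Qed.

Lemma tr_spec (coins : list bool) (c : acmd) :
  forall m S, aok c = true -> view m S -> view (sem coins (tr c) m) (asem coins c S).
Proof.
  induction c as [|i|c1 IH1 c2 IH2|t c1 IH1 c2 IH2|a b c IH]; intros m S H V;
    cbn [aok] in H; cbn [tr sem asem].
  - exact V.
  - apply tr_prim_spec; assumption.
  - apply andb_prop in H as [H1 H2]; auto.
  - apply andb_prop in H as [H H2]; apply andb_prop in H as [Ht H1].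
    assert (E : eval_test t (mr m) (mx m) = eval_test t (sr S) (ax S)).
    { destruct t; cbn [ok_test] in Ht; apply andb_prop in Ht as [Hi Hj]; cbn [eval_test].
      - unfold okr in *; apply Nat.ltb_lt in Hi, Hj.
        rewrite !(view_sr _ _ V) by assumption; reflexivity.
      - rewrite !(view_ax _ _ V) by assumption; reflexivity. }
    rewrite E. destruct (eval_test t (sr S) (ax S)); auto.
  - apply andb_prop in H as [H Hc]; apply andb_prop in H as [Ha Hb].
    rewrite (view_ax _ _ V b Hb).
    assert (V0 : view (prim coins (NAdd a b 2) m) (set_ax a (ax S b) S)).
    { destruct m as [r x nc].
      cbn [prim step at_pc nth_error mr mx mc rr xr ncoins pc].
      pose proof (view_0 _ _ V) as Z; pose proof (view_ax _ _ V b Hb) as E; cbn [mx] in Z, E.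
      rewrite Z, E, Nat.add_0_r. apply view_updN; assumption. }
    revert V0. generalize (prim coins (NAdd a b 2) m) as m0, (set_ax a (ax S b) S) as S0.
    generalize (ax S b) as k. clear m S V.
    induction k as [|k IHk]; intros m S V.
    + exact V.
    + rewrite !Nat.iter_succ_r. apply IHk. specialize (IH m S Hc V).
      destruct (sem coins (tr c) m) as [r x nc].
      cbn [prim step at_pc nth_error mr mx mc rr xr ncoins pc].
      pose proof (view_1 _ _ IH) as Z. cbn [mx] in Z. rewrite Z.
      assert (Ea : x a = ax (asem coins c S) a).
      { apply (view_ax _ _ IH). unfold okw in Ha; apply Nat.ltb_lt in Ha. unfold okx.
        destruct (Nat.eqb_spec a 4), (Nat.eqb_spec a 5); try lia; reflexivity. }
      rewrite Ea. apply view_updN; assumption.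
Qed.

(** * Frame conditions and the loop rule *)

Definition rwrites (k : nat) (i : ainstr) : bool :=
  match i with
  | AI (RConst j _) | AI (Coin j) | AI (RAdd j _ _) | AI (RSub j _ _)
  | AI (RMul j _ _) | AI (RDiv j _ _) | AI (RLoadI j _) | ALd _ j _ => Nat.eqb k j
  | AI (RStoreI _ _) => true
  | _ => false
  end.
Definition xwrites (a : nat) (i : ainstr) : bool :=
  match i with AI i => iwrites a i | _ => false end.
Definition awrites (t : nat) (i : ainstr) : bool :=
  match i with ASt t' _ _ => Nat.eqb t t' | _ => false end.
Definition cwrites (i : ainstr) : bool :=
  match i with AI (Coin _) => true | _ => false end.

(** One check serves all frame lemmas: [wi] marks the instructions and [wx] the loop counters that
    could change the observed component. On concrete programs it is decided by computation. *)
Fixpoint free (wi : ainstr -> bool) (wx : nat -> bool) (c : acmd) : bool :=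
  match c with
  | ASkip => true
  | APrim i => negb (wi i)
  | ASeq c1 c2 | AIf _ c1 c2 => free wi wx c1 && free wi wx c2
  | AFor a _ c => negb (wx a) && free wi wx c
  end.

Lemma free_frame {X : Type} (coins : list bool) (wi : ainstr -> bool) (wx : nat -> bool)
    (proj : ast -> X) :
  (forall i S, wi i = false -> proj (aprim coins i S) = proj S) ->
  (forall a v S, wx a = false -> proj (set_ax a v S) = proj S) ->
  forall c S, free wi wx c = true -> proj (asem coins c S) = proj S.
Proof.
  intros Hi Hx c; induction c as [|i|c1 IH1 c2 IH2|t c1 IH1 c2 IH2|a b c IH];
    intros S H; cbn [free] in H; cbn [asem].
  - reflexivity.
  - apply Hi, negb_true_iff, H.
  - apply andb_prop in H as [H1 H2]. rewrite IH2, IH1; auto.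
  - apply andb_prop in H as [H1 H2]. destruct (eval_test _ _ _); auto.
  - apply andb_prop in H as [H1 H2]. apply negb_true_iff in H1.
    apply (iter_inv _ (fun _ y => proj y = proj S)); [auto|].
    intros j y _ E. cbv zeta. rewrite Hx, IH; auto.
Qed.

Lemma frame_sr (coins : list bool) (k : nat) (c : acmd) (S : ast) :
  free (rwrites k) (fun _ => false) c = true -> sr (asem coins c S) k = sr S k.
Proof.
  apply (free_frame coins _ _ (fun S => sr S k)); [|reflexivity].
  intros [i|t j a|t a j] S0; [destruct i| |]; cbn; intros H; try discriminate H;
    try reflexivity; unfold updR; rewrite H; reflexivity.
Qed.

Lemma frame_ax (coins : list bool) (a : nat) (c : acmd) (S : ast) :
  free (xwrites a) (Nat.eqb a) c = true -> ax (asem coins c S) a = ax S a.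
Proof.
  apply (free_frame coins _ _ (fun S => ax S a)).
  - intros [i|t j b|t b j] S0; cbn [xwrites]; intros H; try reflexivity.
    exact (prim_nowrite coins i a _ H).
  - intros b v S0 H. cbn. unfold updN; rewrite H; reflexivity.
Qed.

Lemma frame_ar (coins : list bool) (t : nat) (c : acmd) (S : ast) :
  free (awrites t) (fun _ => false) c = true -> ar (asem coins c S) t = ar S t.
Proof.
  apply (free_frame coins _ _ (fun S => ar S t)); [|reflexivity].
  intros [i|t' j b|t' b j] S0; cbn; intros H; try reflexivity.
  unfold upd_arr; rewrite H; reflexivity.
Qed.

Lemma frame_ac (coins : list bool) (c : acmd) (S : ast) :
  free cwrites (fun _ => false) c = true -> ac (asem coins c S) = ac S.
Proof.
  apply (free_frame coins _ _ ac); [|reflexivity].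
  intros [i|t' j b|t' b j] S0; [destruct i| |]; cbn; intros H;
    try discriminate H; reflexivity.
Qed.

(** The invariant must ignore the counter; in exchange the body is entered with a counter known to
    be [ax S b - j], and all upkeep of the counter stays inside this rule. *)
Lemma for_inv (coins : list bool) (a b : nat) (c : acmd) (S : ast)
    (I : nat -> ast -> Prop) :
  free (xwrites a) (Nat.eqb a) c = true ->
  (forall j v S', I j S' -> I j (set_ax a v S')) ->
  I 0%nat S ->
  (forall j S', (j < ax S b)%nat -> ax S' a = (ax S b - j)%nat -> I j S' ->
     I (1 + j)%nat (asem coins c S')) ->
  I (ax S b) (asem coins (AFor a b c) S).
Proof.
  intros F Hst H0 HS. cbn [asem].
  apply (iter_inv _ (fun j S' => ax S' a = (ax S b - j)%nat /\ I j S')).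
  - split; [|apply Hst, H0]. cbn. rewrite updN_same. lia.
  - intros j y Hj [E Hy]. cbv zeta. rewrite (frame_ax coins a c y F), E.
    split; [cbn; rewrite updN_same; lia|]. apply Hst, HS; assumption.
Qed.

(** * Finite sums and products *)

Definition sumL {X : Type} (F : X -> R) (l : list X) : R := fold_right Rplus 0 (map F l).

Lemma sumL_cons {X : Type} (F : X -> R) (x : X) (l : list X) :
  sumL F (x :: l) = F x + sumL F l.
Proof. reflexivity. Qed.

Lemma sumL_app {X : Type} (F : X -> R) (l1 l2 : list X) :
  sumL F (l1 ++ l2) = sumL F l1 + sumL F l2.
Proof. induction l1 as [|x l IH]; cbn [app]; rewrite ?sumL_cons, ?IH; unfold sumL; cbn; lra. Qed.

Lemma sumL_map {X Y : Type} (F : Y -> R) (h : X -> Y) (l : list X) :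
  sumL F (map h l) = sumL (fun x => F (h x)) l.
Proof. unfold sumL. rewrite map_map. reflexivity. Qed.

Lemma sumL_ext {X : Type} (F G : X -> R) (l : list X) :
  (forall x, In x l -> F x = G x) -> sumL F l = sumL G l.
Proof. intros H. unfold sumL. f_equal. apply map_ext_in, H. Qed.

Lemma sumL_le {X : Type} (F G : X -> R) (l : list X) :
  (forall x, In x l -> F x <= G x) -> sumL F l <= sumL G l.
Proof.
  induction l as [|x l IH]; intros H; [right; reflexivity|].
  rewrite !sumL_cons. apply Rplus_le_compat; [apply H; left; auto|].
  apply IH; intros; apply H; right; auto.
Qed.

Lemma sumL_lin {X : Type} (a b : R) (F G : X -> R) (l : list X) :
  sumL (fun x => a * F x + b * G x) l = a * sumL F l + b * sumL G l.
Proof.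
  induction l as [|x l IH]; [unfold sumL; cbn; lra|]. rewrite !sumL_cons, IH. lra.
Qed.

Lemma sumL_const {X : Type} (a : R) (l : list X) : sumL (fun _ => a) l = INR (length l) * a.
Proof.
  induction l as [|x l IH]; [unfold sumL; cbn; lra|].
  rewrite sumL_cons, IH. cbn [length]. rewrite S_INR. lra.
Qed.

Lemma sumL_ge_mem {X : Type} (F : X -> R) (x : X) (l : list X) :
  (forall y, In y l -> 0 <= F y) -> In x l -> F x <= sumL F l.
Proof.
  induction l as [|y l IH]; intros H [].
  - subst y. rewrite sumL_cons. enough (0 <= sumL F l) by lra.
    replace 0 with (sumL (fun _ : X => 0) l) by (rewrite sumL_const; lra).
    apply sumL_le; intros; apply H; right; auto.
  - rewrite sumL_cons. assert (F x <= sumL F l) by (apply IH; auto; intros; apply H; right; auto).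
    specialize (H y (or_introl eq_refl)). lra.
Qed.

Lemma sumL_pos {X : Type} (F : X -> R) (x : X) (l : list X) :
  (forall y, In y l -> 0 < F y) -> In x l -> 0 < sumL F l.
Proof.
  intros H Hx. apply Rlt_le_trans with (F x); [auto|].
  apply sumL_ge_mem; auto. intros; apply Rlt_le; auto.
Qed.

Lemma rsum_S (n : nat) (f : nat -> R) : rsum (S n) f = rsum n f + f n.
Proof.
  unfold rsum. rewrite seq_S, map_app.
  rewrite fold_right_app. cbn [map fold_right].
  generalize (map f (seq 0 n)); intros l. rewrite Nat.add_0_l.
  induction l as [|x l IH]; cbn [fold_right]; [lra|]. rewrite IH; lra.
Qed.

Lemma rsum_ext (n : nat) (f g : nat -> R) :
  (forall i, (i < n)%nat -> f i = g i) -> rsum n f = rsum n g.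
Proof.
  induction n as [|n IH]; intros H; [reflexivity|].
  rewrite !rsum_S, IH, H; auto.
Qed.

Lemma rsum_le (n : nat) (f g : nat -> R) :
  (forall i, (i < n)%nat -> f i <= g i) -> rsum n f <= rsum n g.
Proof.
  induction n as [|n IH]; intros H; [right; reflexivity|].
  rewrite !rsum_S. apply Rplus_le_compat; auto.
Qed.

Lemma rsum_lin (n : nat) (a b : R) (f g : nat -> R) :
  rsum n (fun i => a * f i + b * g i) = a * rsum n f + b * rsum n g.
Proof.
  induction n as [|n IH]; [unfold rsum; cbn; lra|]. rewrite !rsum_S, IH. lra.
Qed.

Lemma rsum_const (n : nat) (a : R) : rsum n (fun _ => a) = INR n * a.
Proof.
  induction n as [|n IH]; [unfold rsum; cbn; lra|]. rewrite rsum_S, IH, S_INR. lra.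
Qed.

Lemma rsum_add (n m : nat) (f : nat -> R) :
  rsum (n + m) f = rsum n f + rsum m (fun i => f (n + i)%nat).
Proof.
  induction m as [|m IH]; [unfold rsum at 3; cbn; rewrite Nat.add_0_r; lra|].
  rewrite Nat.add_succ_r, !rsum_S, IH. lra.
Qed.

Lemma rsum_geom (n : nat) : rsum n (fun i => / 2 ^ i) <= 2.
Proof.
  enough (rsum n (fun i => / 2 ^ i) = 2 - 2 * / 2 ^ n) as ->.
  { assert (0 < / 2 ^ n) by (apply Rinv_0_lt_compat, pow_lt; lra). lra. }
  induction n as [|n IH]; [unfold rsum; cbn; lra|].
  rewrite rsum_S, IH. cbn [pow]. rewrite Rinv_mult. lra.
Qed.

Fixpoint rprod (n : nat) (f : nat -> R) : R :=
  match n with O => 1 | S n => rprod n f * f n end.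

Lemma rprod_pos (n : nat) (f : nat -> R) : (forall q, (q < n)%nat -> 0 < f q) -> 0 < rprod n f.
Proof.
  induction n as [|n IH]; intros H; cbn [rprod]; [lra|]. apply Rmult_lt_0_compat; auto.
Qed.

(** * Elementary inequalities for the exponential *)

(** With y = x / (1+x), the inverse of 1 - y <= exp (-y) reads exp y <= 1 + x. It remains that x - 2
    x^2 <= y, which amounts to 0 <= x^2 (1 + 2 x). *)
Lemma exp_lower (x : R) : - (1/2) <= x -> exp (x - 2 * x ^ 2) <= 1 + x.
Proof.
  intros H.
  assert (H1 : 0 < 1 + x) by lra.
  assert (Hz : 1 - x / (1 + x) <= exp (- (x / (1 + x)))).
  { pose proof (exp_ineq1_le (- (x / (1 + x)))). lra. }
  replace (1 - x / (1 + x)) with (/ (1 + x)) in Hz by (field; lra).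
  rewrite exp_Ropp in Hz.
  apply Rinv_le_contravar in Hz; [|apply Rinv_0_lt_compat, H1].
  rewrite !Rinv_inv in Hz.
  eapply Rle_trans; [|exact Hz].
  assert (L : x - 2 * x ^ 2 <= x / (1 + x)).
  { apply Rmult_le_reg_r with (1 + x); [exact H1|].
    replace (x / (1 + x) * (1 + x)) with x by (field; lra).
    assert (0 <= x ^ 2) by (apply pow2_ge_0). nra. }
  destruct L as [L|L]; [left; apply exp_increasing, L | rewrite L; right; reflexivity].
Qed.

(** Inverting 1 - x <= exp (-x) gives exp x <= 1 / (1-x), and (1 + x + 2 x^2) (1 - x) = 1 + x^2 (1 -
    2 x). *)
Lemma exp_upper (x : R) : x <= 1/2 -> exp x <= 1 + x + 2 * x ^ 2.
Proof.
  intros H.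
  assert (Hz : 1 - x <= exp (- x)) by (pose proof (exp_ineq1_le (- x)); lra).
  rewrite exp_Ropp in Hz.
  apply Rinv_le_contravar in Hz; [|lra]. rewrite Rinv_inv in Hz.
  eapply Rle_trans; [exact Hz|].
  apply Rmult_le_reg_r with (1 - x); [lra|].
  rewrite Rinv_l by lra. assert (0 <= x ^ 2) by (apply pow2_ge_0). nra.
Qed.

Lemma exp_le (x y : R) : x <= y -> exp x <= exp y.
Proof. intros [L| ->]; [left; apply exp_increasing, L | right; reflexivity]. Qed.

(** * Multiplicative weights *)

(* [u q x] is a multiplicative surrogate of [exp (eta * f q x)]. *)
Lemma hedge {X : Type} (l : list X) (u f : nat -> X -> R) (eta e1 e2 lsize : R) (t : nat) (x0 : X) :
  let wt q x := rprod q (fun q => u q x) in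
  (forall q x, (q < t)%nat -> In x l ->
     exp (eta * f q x - e1) <= u q x <= 1 + eta * f q x + e2) ->
  In x0 l -> INR (length l) <= exp lsize ->
  eta * rsum t (fun q => f q x0
      - sumL (fun x => wt q x * f q x) l / sumL (wt q) l)
    <= lsize + INR t * (e1 + e2).
Proof.
  intros wt Hu Hx0 Hl.
  assert (Wpos : forall q x, (q <= t)%nat -> In x l -> 0 < wt q x).
  { intros q x Hq Hx. apply rprod_pos. intros q' Hq'.
    destruct (Hu q' x) as [H _]; [lia|exact Hx|].
    eapply Rlt_le_trans; [apply exp_pos | exact H]. }
  assert (Zpos : forall q, (q <= t)%nat -> 0 < sumL (wt q) l).
  { intros q Hq. apply sumL_pos with x0; auto. }
  set (E q := sumL (fun x => wt q x * f q x) l / sumL (wt q) l).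
  (* Potential argument: a round multiplies the total weight by at most 1 + eta E + e2 <= exp (eta E
     + e2), where E is the mean of [f] under the current weights. The initial total is the number of
     elements, at most exp lsize. *)
  assert (Up : forall q, (q <= t)%nat ->
    sumL (wt q) l <= exp (lsize + eta * rsum q E + INR q * e2)).
  { induction q as [|q IH]; intros Hq.
    - unfold rsum, wt; cbn [seq map fold_right rprod].
      rewrite sumL_const. cbn [INR].
      replace (lsize + eta * 0 + 0 * e2) with lsize by ring. lra.
    - assert (S1 : sumL (wt (S q)) l <= sumL (wt q) l * (1 + (eta * E q + e2))).
      { replace (sumL (wt q) l * (1 + (eta * E q + e2)))
          with (sumL (fun x => (1 + e2) * wt q x + eta * (wt q x * f q x)) l).
        - apply sumL_le. intros x Hx. unfold wt at 1; cbn [rprod]. fold (wt q x).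
          destruct (Hu q x) as [_ H]; [lia|exact Hx|].
          assert (0 < wt q x) by (apply Wpos; [lia|exact Hx]). nra.
        - rewrite sumL_lin. unfold E. field.
          apply Rgt_not_eq, Zpos; lia. }
      assert (S2 : 1 + (eta * E q + e2) <= exp (eta * E q + e2)) by apply exp_ineq1_le.
      assert (P : 0 < sumL (wt q) l) by (apply Zpos; lia).
      rewrite rsum_S, S_INR.
      replace (lsize + eta * (rsum q E + E q) + (INR q + 1) * e2)
        with ((lsize + eta * rsum q E + INR q * e2) + (eta * E q + e2)) by ring.
      rewrite exp_plus.
      eapply Rle_trans; [exact S1|].
      eapply Rle_trans; [apply Rmult_le_compat_l; [lra|exact S2]|].
      apply Rmult_le_compat_r; [left; apply exp_pos|]. apply IH; lia. }
  (* The weight of [x0] alone grows with its own cumulative value; being a part of the total, it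
     yields the comparison after taking logarithms. *)
  assert (Lo : forall q, (q <= t)%nat ->
    exp (eta * rsum q (fun q => f q x0) - INR q * e1) <= wt q x0).
  { induction q as [|q IH]; intros Hq.
    - unfold rsum, wt; cbn [seq map fold_right rprod INR].
      replace (eta * 0 - 0 * e1) with 0 by ring. rewrite exp_0; lra.
    - rewrite rsum_S, S_INR.
      replace (eta * (rsum q (fun q => f q x0) + f q x0) - (INR q + 1) * e1)
        with ((eta * rsum q (fun q => f q x0) - INR q * e1) + (eta * f q x0 - e1)) by ring.
      rewrite exp_plus. unfold wt; cbn [rprod]; fold (wt q x0).
      apply Rmult_le_compat; try (left; apply exp_pos); [apply IH; lia|].
      apply Hu; [lia|exact Hx0]. }
  assert (M : wt t x0 <= sumL (wt t) l).
  { apply sumL_ge_mem; [|exact Hx0]. intros; left; apply Wpos; auto. }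
  assert (C : exp (eta * rsum t (fun q => f q x0) - INR t * e1)
              <= exp (lsize + eta * rsum t E + INR t * e2)).
  { eapply Rle_trans; [apply Lo; lia|]. eapply Rle_trans; [exact M|]. apply Up; lia. }
  assert (C' : eta * rsum t (fun q => f q x0) - INR t * e1
               <= lsize + eta * rsum t E + INR t * e2).
  { destruct C as [C|C]; [left; apply exp_lt_inv, C | right; apply exp_inv, C]. }
  change (eta * rsum t (fun q => f q x0 - E q) <= lsize + INR t * (e1 + e2)).
  replace (rsum t (fun q => f q x0 - E q))
    with (1 * rsum t (fun q => f q x0) + (-1) * rsum t E).
  2: { rewrite <- rsum_lin. apply rsum_ext; intros; ring. }
  lra.
Qed.

(** * Averages over coin sequences *)

Definition avg (L : nat) (F : list bool -> R) : R := sumL F (all_coins L) / 2 ^ L.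

Lemma avg_S (L : nat) (F : list bool -> R) :
  avg (S L) F = (avg L (fun l => F (true :: l)) + avg L (fun l => F (false :: l))) / 2.
Proof.
  unfold avg. cbn [all_coins pow]. rewrite sumL_app, !sumL_map. field.
  apply pow_nonzero; lra.
Qed.

Lemma all_coins_length (L : nat) : length (all_coins L) = (2 ^ L)%nat.
Proof.
  induction L as [|L IH]; [reflexivity|].
  cbn [all_coins Nat.pow]. rewrite length_app, !length_map, IH. lia.
Qed.

Lemma in_all_coins (L : nat) (l : list bool) : In l (all_coins L) <-> length l = L.
Proof.
  revert l; induction L as [|L IH]; intros l; cbn [all_coins].
  - destruct l; cbn; split; intros H; auto; try discriminate.
    destruct H as [H|[]]; discriminate.
  - rewrite in_app_iff, !in_map_iff. split.
    + intros [(y & <- & H)|(y & <- & H)]; cbn; f_equal; apply IH, H.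
    + destruct l as [|b l]; intros H; [discriminate|]. injection H as H.
      apply IH in H. destruct b; [left|right]; exists l; auto.
Qed.

Lemma avg_const (L : nat) (a : R) : avg L (fun _ => a) = a.
Proof.
  unfold avg. rewrite sumL_const, all_coins_length, pow_INR. cbn.
  replace (1 + 1) with 2 by ring. field. apply pow_nonzero; lra.
Qed.

(* Comparison of [q] with the random binary fraction [0.c1 c2 ... cb]. *)
Fixpoint flip (b : nat) (q : R) (cs : list bool) : bool :=
  match b with
  | O => if Rlt_dec 0 q then true else false
  | S b => flip b (q + q - (if hd false cs then 1 else 0)) (tl cs)
  end.

Fixpoint flip_prob (b : nat) (q : R) : R :=
  match b with
  | O => if Rlt_dec 0 q then 1 else 0
  | S b => (flip_prob b (q + q - 1) + flip_prob b (q + q - 0)) / 2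
  end.

(** The first b coins decide the flip and the rest are still uniform and independent of it. [H]
    receives the outcome and the unread coins, which allows consecutive flips to be analysed one at
    a time. *)
Lemma avg_flip (b L : nat) (q : R) (H : bool -> list bool -> R) :
  avg (b + L) (fun cs => H (flip b q cs) (skipn b cs))
  = flip_prob b q * avg L (H true) + (1 - flip_prob b q) * avg L (H false).
Proof.
  revert q; induction b as [|b IH]; intros q.
  - cbn [Nat.add flip flip_prob skipn]. destruct (Rlt_dec 0 q).
    + change (fun cs => H true cs) with (H true). ring.
    + change (fun cs => H false cs) with (H false). ring.
  - cbn [Nat.add]. rewrite avg_S. cbn [flip flip_prob hd tl skipn].
    rewrite !IH. field.
Qed.

Lemma flip_prob_bound (b : nat) (q : R) : 0 <= flip_prob b q <= 1.
Proof.
  revert q; induction b as [|b IH]; intros q; cbn [flip_prob].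
  - destruct (Rlt_dec 0 q); lra.
  - pose proof (IH (q + q - 1)); pose proof (IH (q + q - 0)); lra.
Qed.

Lemma flip_prob_0 (b : nat) (q : R) : q <= 0 -> flip_prob b q = 0.
Proof.
  revert q; induction b as [|b IH]; intros q H; cbn [flip_prob].
  - destruct (Rlt_dec 0 q); lra.
  - rewrite !IH by lra. lra.
Qed.

Lemma flip_prob_1 (b : nat) (q : R) : 1 <= q -> flip_prob b q = 1.
Proof.
  revert q; induction b as [|b IH]; intros q H; cbn [flip_prob].
  - destruct (Rlt_dec 0 q); lra.
  - rewrite !IH by lra. lra.
Qed.

(** After one coin one of the two branches is already decided: 2q - 1 <= 0 gives probability 0, or
    2q >= 1 gives probability 1. The error of the other branch is halved. *)
Lemma flip_prob_approx (b : nat) (q : R) :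
  0 <= q <= 1 -> Rabs (flip_prob b q - q) <= / 2 ^ b.
Proof.
  revert q; induction b as [|b IH]; intros q Hq; cbn [flip_prob pow].
  - rewrite Rinv_1. apply Rabs_le. destruct (Rlt_dec 0 q); lra.
  - rewrite Rinv_mult. destruct (Rle_dec q (1/2)) as [H|H].
    + rewrite (flip_prob_0 b (q + q - 1)) by lra.
      replace ((0 + flip_prob b (q + q - 0)) / 2 - q)
        with (/ 2 * (flip_prob b (q + q - 0) - (q + q - 0))) by field.
      rewrite Rabs_mult, (Rabs_pos_eq (/ 2)) by lra.
      apply Rmult_le_compat_l; [lra|]. apply IH; lra.
    + rewrite (flip_prob_1 b (q + q - 0)) by lra.
      replace ((flip_prob b (q + q - 1) + 1) / 2 - q)
        with (/ 2 * (flip_prob b (q + q - 1) - (q + q - 1))) by field.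
      rewrite Rabs_mult, (Rabs_pos_eq (/ 2)) by lra.
      apply Rmult_le_compat_l; [lra|]. apply IH; lra.
Qed.

(** * Sampling from the dynamic programming table *)

(* A set of items [i, i+1, ...] is a list of membership bits. *)
Fixpoint item_prod (a : nat -> R) (i : nat) (l : list bool) : R :=
  match l with
  | [] => 1
  | b :: l => (if b then a i else 1) * item_prod a (S i) l
  end.

Fixpoint item_sum (h : nat -> R) (i : nat) (l : list bool) : R :=
  match l with
  | [] => 0
  | b :: l => (if b then h i else 0) + item_sum h (S i) l
  end.

Fixpoint item_weight (k : nat -> nat) (i : nat) (l : list bool) : nat :=
  match l with
  | [] => 0
  | b :: l => (if b then k i else 0) + item_weight k (S i) l
  end%nat.

(** The normalising sum Z(i, W), with d the number of items left and W the integer weight taken so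
    far. [phi] is applied only when all items are decided. *)
Fixpoint dp (a : nat -> R) (k : nat -> nat) (phi : nat -> R) (d i W : nat) : R :=
  match d with
  | O => phi W
  | S d => dp a k phi d (S i) W + dp a k phi d (S i) (W + k i) * a i
  end.

Definition set_weight (a : nat -> R) (k : nat -> nat) (phi : nat -> R) (i W : nat)
    (l : list bool) : R :=
  item_prod a i l * phi (W + item_weight k i l)%nat.

Lemma dp_sum (a : nat -> R) (k : nat -> nat) (phi : nat -> R) (d i W : nat) :
  dp a k phi d i W = sumL (set_weight a k phi i W) (all_coins d).
Proof.
  revert i W; induction d as [|d IH]; intros i W; cbn [dp all_coins].
  - unfold sumL, set_weight; cbn. rewrite Nat.add_0_r; lra.
  - rewrite sumL_app, !sumL_map, !IH.
    rewrite (sumL_ext (fun x => set_weight a k phi i W (true :: x))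
               (fun x => a i * set_weight a k phi (S i) (W + k i) x + 0 * 0)).
    2: { intros l _. unfold set_weight. cbn [item_prod item_weight].
         rewrite Nat.add_assoc. ring. }
    rewrite sumL_lin.
    rewrite (sumL_ext (fun x => set_weight a k phi i W (false :: x))
               (set_weight a k phi (S i) W)).
    2: { intros l _. unfold set_weight. cbn [item_prod item_weight Nat.add]. ring. }
    ring.
Qed.

(** Conditional probability of taking item i, given the integer weight W of the items chosen before
    it. *)
Definition dp_ratio (a : nat -> R) (k : nat -> nat) (phi : nat -> R) (d i W : nat) : R :=
  dp a k phi d (S i) (W + k i) * a i
  / (dp a k phi d (S i) W + dp a k phi d (S i) (W + k i) * a i).

Fixpoint sample (a : nat -> R) (k : nat -> nat) (phi : nat -> R) (b d i W : nat)
    (cs : list bool) : list bool :=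
  match d with
  | O => []
  | S d =>
      if flip b (dp_ratio a k phi d i W) cs
      then true :: sample a k phi b d (S i) (W + k i) (skipn b cs)
      else false :: sample a k phi b d (S i) W (skipn b cs)
  end.

(** The bound W <= i m is preserved when an item with k_i <= m is taken, so [phi] is only evaluated
    up to N m, where it is positive. *)
Lemma dp_pos (a : nat -> R) (k : nat -> nat) (phi : nat -> R) (N m : nat) :
  (forall i, (i < N)%nat -> 0 < a i /\ (k i <= m)%nat) ->
  (forall W, (W <= N * m)%nat -> 0 < phi W) ->
  forall d i W, (d + i <= N)%nat -> (W <= i * m)%nat -> 0 < dp a k phi d i W.
Proof.
  intros Ha Hphi d; induction d as [|d IH]; intros i W Hi HW; cbn [dp].
  - apply Hphi. nia.
  - destruct (Ha i) as [Hai Hki]; [lia|].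
    apply Rplus_lt_0_compat; [|apply Rmult_lt_0_compat; [|exact Hai]];
      apply IH; cbn [Nat.mul]; lia.
Qed.

(** With exact probabilities the chain rule would reproduce the normalised weights. Each of the d
    flips is off by at most 2^-b, and this shifts weight between two conditional means that lie in
    [-M, M], hence by at most 2 M 2^-b. *)
Lemma sample_expectation (a : nat -> R) (k : nat -> nat) (phi : nat -> R) (N m b : nat) (M : R) :
  (forall i, (i < N)%nat -> 0 < a i /\ (k i <= m)%nat) ->
  (forall W, (W <= N * m)%nat -> 0 < phi W) ->
  forall d i W L (G : list bool -> R),
  (d + i <= N)%nat -> (W <= i * m)%nat -> (d * b <= L)%nat ->
  (forall l, length l = d -> Rabs (G l) <= M) ->
  Rabs (avg L (fun cs => G (sample a k phi b d i W cs))
    - sumL (fun l => set_weight a k phi i W l * G l) (all_coins d) / dp a k phi d i W)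
  <= INR d * (2 * M * / 2 ^ b).
Proof.
  intros Ha Hphi d; induction d as [|d IH]; intros i W L G Hi HW HL HG.
  - cbn [sample]. rewrite avg_const. unfold sumL, set_weight; cbn.
    assert (0 < phi W) by (apply Hphi; nia).
    rewrite Nat.add_0_r.
    replace (G [] - (1 * phi W * G [] + 0) / phi W) with 0 by (field; lra).
    rewrite Rabs_R0. lra.
  - destruct (Ha i) as [Hai Hki]; [lia|].
    assert (P0 : 0 < dp a k phi d (S i) W) by (apply (dp_pos a k phi N m); auto; cbn; lia).
    assert (P1 : 0 < dp a k phi d (S i) (W + k i) * a i).
    { apply Rmult_lt_0_compat; [|exact Hai]. apply (dp_pos a k phi N m); auto; cbn; lia. }
    replace L with (b + (L - b))%nat by (cbn in HL; lia).
    set (q := dp_ratio a k phi d i W).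
    pose (H (x : bool) cs := if x then G (true :: sample a k phi b d (S i) (W + k i) cs)
                    else G (false :: sample a k phi b d (S i) W cs)).
    replace (avg (b + (L - b)) (fun cs => G (sample a k phi b (S d) i W cs)))
      with (avg (b + (L - b)) (fun cs => H (flip b q cs) (skipn b cs))).
    2: { unfold avg; f_equal; apply sumL_ext. intros cs _. unfold H. cbn [sample]. fold q.
         destruct (flip b q cs); reflexivity. }
    rewrite avg_flip. set (P := flip_prob b q).
    assert (HM : 0 <= M).
    { specialize (HG (repeat true (S d)) (repeat_length _ _)).
      eapply Rle_trans; [apply Rabs_pos | exact HG]. }
    assert (Hq : 0 <= q <= 1).
    { unfold q, dp_ratio. set (x := dp _ _ _ _ _ W) in *. set (y := _ * a i) in *.
      split; [apply Rlt_le, Rdiv_lt_0_compat; lra|].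
      apply Rmult_le_reg_r with (x + y); [lra|]. unfold Rdiv.
      rewrite Rmult_assoc, Rinv_l; lra. }
    pose proof (flip_prob_approx b q Hq) as HP. fold P in HP.
    pose proof (flip_prob_bound b q) as HP'. fold P in HP'.
    assert (E1 := IH (S i) (W + k i)%nat (L - b)%nat (fun l => G (true :: l))).
    assert (E0 := IH (S i) W (L - b)%nat (fun l => G (false :: l))).
    specialize (E1 ltac:(lia) ltac:(cbn; lia) ltac:(cbn in HL; lia)
                  ltac:(intros l Hl; apply HG; cbn; lia)).
    specialize (E0 ltac:(lia) ltac:(cbn; lia) ltac:(cbn in HL; lia)
                  ltac:(intros l Hl; apply HG; cbn; lia)).
    change (avg (L - b) (H true)) with
      (avg (L - b) (fun cs => G (true :: sample a k phi b d (S i) (W + k i) cs))).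
    change (avg (L - b) (H false)) with
      (avg (L - b) (fun cs => G (false :: sample a k phi b d (S i) W cs))).
    cbn beta in E1, E0.
    set (A1 := avg (L - b) (fun cs => G (true :: _))) in *.
    set (A0 := avg (L - b) (fun cs => G (false :: _))) in *.
    set (X1 := sumL _ _ / _) in E1. set (X0 := sumL _ _ / _) in E0.
    (* A conditional mean of G under non-negative weights stays within the bound of G. *)
    assert (B : forall c W', (W' <= S i * m)%nat ->
       Rabs (sumL (fun l => set_weight a k phi (S i) W' l * G (c :: l)) (all_coins d)
          / dp a k phi d (S i) W') <= M).
    { intros c W' HW'.
      assert (Pd : 0 < dp a k phi d (S i) W') by (apply (dp_pos a k phi N m); auto; lia).
      assert (Pw : forall l, In l (all_coins d) -> 0 <= set_weight a k phi (S i) W' l).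
      { intros l Hl. apply in_all_coins in Hl.
        assert (forall l j W'', (length l + j <= N)%nat -> (W'' <= j * m)%nat ->
          0 <= set_weight a k phi j W'' l) as Q.
        { clear - Ha Hphi. induction l as [|c l IHl]; intros j W'' Hj HW''.
          - unfold set_weight; cbn. rewrite Nat.add_0_r.
            assert (0 < phi W'') by (apply Hphi; cbn in *; nia). lra.
          - cbn [length] in Hj. destruct (Ha j) as [Haj Hkj]; [lia|].
            unfold set_weight in *. cbn [item_prod item_weight]. destruct c.
            + rewrite Nat.add_assoc, Rmult_assoc. apply Rmult_le_pos; [lra|].
              apply IHl; cbn [Nat.mul]; lia.
            + rewrite Nat.add_0_l, Rmult_1_l. apply IHl; cbn [Nat.mul]; lia. }
        apply Q; [rewrite Hl|]; lia. }
      assert (Ub : forall l, In l (all_coins d) -> - M <= G (c :: l) <= M).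
      { intros l Hl. apply in_all_coins in Hl.
        specialize (HG (c :: l) ltac:(cbn; lia)). revert HG; unfold Rabs.
        destruct (Rcase_abs _); intros; lra. }
      assert (Q1 : sumL (fun l => set_weight a k phi (S i) W' l * G (c :: l)) (all_coins d)
                   <= M * dp a k phi d (S i) W').
      { rewrite dp_sum. replace (M * sumL _ _)
          with (sumL (fun l => M * set_weight a k phi (S i) W' l + 0 * 0) (all_coins d))
          by (rewrite sumL_lin; ring).
        apply sumL_le. intros l Hl. specialize (Pw l Hl); specialize (Ub l Hl). nra. }
      assert (Q2 : - M * dp a k phi d (S i) W' <=
                   sumL (fun l => set_weight a k phi (S i) W' l * G (c :: l)) (all_coins d)).
      { rewrite dp_sum. replace (- M * sumL _ _)
          with (sumL (fun l => - M * set_weight a k phi (S i) W' l + 0 * 0) (all_coins d))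
          by (rewrite sumL_lin; ring).
        apply sumL_le. intros l Hl. specialize (Pw l Hl); specialize (Ub l Hl). nra. }
      apply Rabs_le. split.
      - apply Rmult_le_reg_r with (dp a k phi d (S i) W'); [exact Pd|].
        unfold Rdiv; rewrite Rmult_assoc, Rinv_l; lra.
      - apply Rmult_le_reg_r with (dp a k phi d (S i) W'); [exact Pd|].
        unfold Rdiv; rewrite Rmult_assoc, Rinv_l; lra. }
    assert (B1 : Rabs X1 <= M) by (apply B; cbn; lia).
    assert (B0 : Rabs X0 <= M) by (apply B; cbn; lia).
    (* The exact mean is the mixture of the two conditional means with probability q, by definition
       of [dp_ratio]. *)
    assert (Ex : sumL (fun l => set_weight a k phi i W l * G l) (all_coins (S d))
                 / dp a k phi (S d) i W = q * X1 + (1 - q) * X0).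
    { cbn [all_coins]. rewrite sumL_app, !sumL_map.
      rewrite (sumL_ext (fun x => set_weight a k phi i W (true :: x) * G (true :: x))
        (fun x => a i * (set_weight a k phi (S i) (W + k i) x * G (true :: x)) + 0 * 0)).
      2: { intros l _. unfold set_weight. cbn [item_prod item_weight].
           rewrite Nat.add_assoc. ring. }
      rewrite sumL_lin.
      rewrite (sumL_ext (fun x => set_weight a k phi i W (false :: x) * G (false :: x))
                 (fun x => set_weight a k phi (S i) W x * G (false :: x))).
      2: { intros l _. unfold set_weight. cbn [item_prod item_weight Nat.add]. ring. }
      unfold q, dp_ratio, X1, X0. cbn [dp].
      set (D1 := dp a k phi d (S i) (W + k i)) in *. set (D0 := dp a k phi d (S i) W) in *.
      assert (D1 <> 0) by (intros E; rewrite E in P1; lra).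
      field. split; [lra|split]; lra. }
    rewrite Ex. clear - E1 E0 B1 B0 HP HP' HM Hq. rewrite S_INR.
    set (e := / 2 ^ b) in *. set (D := INR d * (2 * M * e)) in *.
    (* The first two terms carry the errors of the remaining draws, averaged with weights P and 1 -
       P; the last is the error of this flip. *)
    replace (P * A1 + (1 - P) * A0 - (q * X1 + (1 - q) * X0))
      with (P * (A1 - X1) + (1 - P) * (A0 - X0) + (P - q) * (X1 - X0)) by ring.
    replace ((INR d + 1) * (2 * M * e)) with (D + 2 * M * e) by (unfold D; ring).
    assert (T1 : Rabs (P * (A1 - X1)) <= P * D).
    { rewrite Rabs_mult, (Rabs_pos_eq P) by lra. apply Rmult_le_compat_l; lra. }
    assert (T2 : Rabs ((1 - P) * (A0 - X0)) <= (1 - P) * D).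
    { rewrite Rabs_mult, (Rabs_pos_eq (1 - P)) by lra. apply Rmult_le_compat_l; lra. }
    assert (T3 : Rabs ((P - q) * (X1 - X0)) <= e * (2 * M)).
    { rewrite Rabs_mult. apply Rmult_le_compat; try apply Rabs_pos; [exact HP|].
      eapply Rle_trans; [apply Rabs_triang|]. rewrite Rabs_Ropp. lra. }
    pose proof (Rabs_triang (P * (A1 - X1) + (1 - P) * (A0 - X0)) ((P - q) * (X1 - X0))).
    pose proof (Rabs_triang (P * (A1 - X1)) ((1 - P) * (A0 - X0))).
    lra.
Qed.

(** * Regret within an epoch *)

Definition nfloor (x : R) : nat := Z.to_nat (Int_part x).

Lemma nfloor_spec (x : R) : 0 <= x -> INR (nfloor x) <= x < INR (nfloor x) + 1.
Proof.
  intros H. destruct (base_Int_part x) as [H1 H2].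
  assert (0 <= Int_part x)%Z.
  { apply le_IZR. destruct (Z_lt_le_dec (Int_part x) 0) as [L|L]; [|apply IZR_le, L].
    assert (Int_part x <= -1)%Z as L' by lia. apply IZR_le in L'. lra. }
  unfold nfloor. rewrite INR_IZR_INZ, Z2Nat.id by assumption. lra.
Qed.

Lemma nfloor_unique (x : R) (k : nat) : INR k <= x < INR k + 1 -> nfloor x = k.
Proof.
  intros H. assert (0 <= x) by (pose proof (pos_INR k); lra).
  pose proof (nfloor_spec x H0).
  apply Nat.le_antisymm; apply Nat.lt_succ_r; apply INR_lt; rewrite S_INR; lra.
Qed.

Lemma item_sum_le (g h : nat -> R) (l : list bool) : forall j,
  (forall i, (j <= i < j + length l)%nat -> g i <= h i) -> item_sum g j l <= item_sum h j l.
Proof.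
  induction l as [|b l IH]; intros j H; cbn [item_sum length] in *; [lra|].
  apply Rplus_le_compat; [destruct b; [apply H; lia | lra]|].
  apply IH. intros i Hi; apply H; lia.
Qed.

Lemma item_sum_lin (a b : R) (g h : nat -> R) (l : list bool) : forall j,
  item_sum (fun i => a * g i + b * h i) j l = a * item_sum g j l + b * item_sum h j l.
Proof.
  induction l as [|c l IH]; intros j; cbn [item_sum]; [lra|]. rewrite IH. destruct c; lra.
Qed.

Lemma item_sum_const (a : R) (l : list bool) : 0 <= a -> forall j,
  0 <= item_sum (fun _ => a) j l <= INR (length l) * a.
Proof.
  intros Ha; induction l as [|c l IH]; intros j; cbn [item_sum length]; [cbn; lra|].
  rewrite S_INR. specialize (IH (S j)). destruct c; lra.
Qed.

Lemma item_weight_sum (k : nat -> nat) (l : list bool) : forall j,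
  INR (item_weight k j l) = item_sum (fun i => INR (k i)) j l.
Proof.
  induction l as [|c l IH]; intros j; cbn [item_weight item_sum]; [reflexivity|].
  rewrite plus_INR, IH. destruct c; reflexivity.
Qed.

Lemma rsum_item_sum (h : nat -> R) (l : list bool) :
  rsum (length l) (fun i => if nth i l false then h i else 0) = item_sum h 0 l.
Proof.
  assert (G : forall j, fold_right Rplus 0
     (map (fun i => if nth (i - j) l false then h i else 0) (seq j (length l)))
     = item_sum h j l).
  { induction l as [|b l IH]; intros j; [reflexivity|].
    cbn [length seq map fold_right item_sum]. rewrite Nat.sub_diag. cbn [nth].
    f_equal. rewrite <- IH. f_equal. apply map_ext_in. intros i Hi.
    apply in_seq in Hi. replace (i - j)%nat with (S (i - S j)) by lia. reflexivity. }
  rewrite <- G. unfold rsum. f_equal. apply map_ext. intros i.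
  rewrite Nat.sub_0_r. reflexivity.
Qed.

Lemma item_prod_upper (eta : R) (p : nat -> R) (l : list bool) : forall j,
  0 <= eta -> (forall i, (j <= i < j + length l)%nat -> 0 <= p i) ->
  0 <= item_prod (fun i => p i * eta + 1) j l <= exp (eta * item_sum p j l).
Proof.
  induction l as [|b l IH]; intros j He Hp; cbn [item_prod item_sum length] in *.
  - rewrite Rmult_0_r, exp_0; lra.
  - destruct (IH (S j) He) as [H0 H1]; [intros; apply Hp; lia|].
    assert (0 <= p j) by (apply Hp; lia).
    rewrite Rmult_plus_distr_l, exp_plus.
    split.
    + apply Rmult_le_pos; [destruct b; nra | exact H0].
    + apply Rmult_le_compat; try assumption; destruct b; try nra.
      * pose proof (exp_ineq1_le (eta * p j)); lra.
      * rewrite Rmult_0_r, exp_0; lra.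
Qed.

(** [exp_lower] item by item. Items outside the set are charged 2 eta^2 as well, which makes the
    loss depend on the length alone. *)
Lemma item_prod_lower (eta : R) (p : nat -> R) (l : list bool) : forall j,
  0 <= eta -> (forall i, (j <= i < j + length l)%nat -> 0 <= p i <= 1) ->
  exp (eta * item_sum p j l - 2 * eta ^ 2 * INR (length l))
  <= item_prod (fun i => p i * eta + 1) j l.
Proof.
  induction l as [|b l IH]; intros j He Hp; cbn [item_prod item_sum length] in *.
  - cbn [INR]. rewrite !Rmult_0_r, Rminus_0_r, exp_0; lra.
  - assert (H1 := IH (S j) He ltac:(intros; apply Hp; lia)).
    assert (0 <= p j <= 1) by (apply Hp; lia).
    rewrite S_INR.
    replace (eta * ((if b then p j else 0) + item_sum p (S j) l)
             - 2 * eta ^ 2 * (INR (length l) + 1))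
      with ((eta * (if b then p j else 0) - 2 * eta ^ 2)
            + (eta * item_sum p (S j) l - 2 * eta ^ 2 * INR (length l))) by ring.
    rewrite exp_plus.
    apply Rmult_le_compat; try (left; apply exp_pos); [|exact H1].
    destruct b.
    + replace (p j * eta + 1) with (1 + eta * p j) by ring.
      eapply Rle_trans; [|apply exp_lower; nra].
      apply exp_le. assert (0 <= eta ^ 2) by apply pow2_ge_0.
      assert (p j ^ 2 <= 1) by nra. nra.
    + assert (0 <= eta ^ 2) by apply pow2_ge_0.
      apply Rle_trans with (exp 0); [apply exp_le; lra | rewrite exp_0; lra].
Qed.

(** * The weights used in a round *)

(** The learning rate eta: the factor 4 (n+1) gives eta (n+1) <= 1/4, and 1/m is tuned to epochs of
    m^2 rounds. *)
Definition rate (n m : nat) : R := / (4 * (INR n + 1) * INR m).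

Definition rounded (w : nat -> R) (c : R) (m i : nat) : nat := nfloor (w i * c * INR m).

(** Here e is the first round of the epoch and q the offset within it; multiplicands are ordered as
    the program computes them. *)
Definition profit_factor (n m : nat) (p : nat -> nat -> R) (e q i : nat) : R :=
  p (e + q)%nat i * rate n m + 1.

Definition penalty_factor (n m : nat) (c : R) (B : nat -> R) (e q W : nat) : R :=
  let x := INR W * / INR m - B (e + q)%nat * c in
  if Rlt_dec 0 x then 1 - x * rate n m else 1.

Definition item_factor (n m : nat) (p : nat -> nat -> R) (e h i : nat) : R :=
  rprod h (fun q => profit_factor n m p e q i).

Definition weight_factor (n m : nat) (c : R) (B : nat -> R) (e h W : nat) : R :=
  rprod h (fun q => penalty_factor n m c B e q W).

Definition drawn_set (n m : nat) (w : nat -> R) (c : R) (p : nat -> nat -> R)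
    (B : nat -> R) (e h b : nat) (cs : list bool) : list bool :=
  sample (item_factor n m p e h) (rounded w c m) (weight_factor n m c B e h) b n 0 0 cs.

Definition list_profit (n : nat) (w : nat -> R) (c : R) (p : nat -> R) (B : R)
    (l : list bool) : R :=
  gkp_profit n w c p B (fun i => nth i l false).

(** Only the weights are rounded; the scaled capacity B c stays exact, since it need not be an index
    of the table. *)
Definition rounded_profit (w : nat -> R) (c : R) (m : nat) (p : nat -> R) (B : R)
    (l : list bool) : R :=
  item_sum p 0 l - Rmax 0 (INR (item_weight (rounded w c m) 0 l) * / INR m - B * c).

Lemma rate_bounds (n m : nat) : (1 <= m)%nat ->
  0 < rate n m /\ rate n m * (INR n + 1) <= 1 / 4 /\ rate n m * (4 * (INR n + 1) * INR m) = 1.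
Proof.
  intros Hm. assert (1 <= INR m) by (apply (le_INR 1); exact Hm).
  pose proof (pos_INR n). unfold rate.
  assert (0 < 4 * (INR n + 1) * INR m) by (apply Rmult_lt_0_compat; lra).
  assert (R1 : / (4 * (INR n + 1) * INR m) * (4 * (INR n + 1) * INR m) = 1)
    by (apply Rinv_l; lra).
  assert (0 < / (4 * (INR n + 1) * INR m)) by (apply Rinv_0_lt_compat; lra).
  set (r := / _) in *. repeat split; auto. nra.
Qed.

Lemma rounded_spec (n : nat) (w : nat -> R) (c : R) (p : nat -> nat -> R) (B : nat -> R)
    (m i : nat) :
  gkp_valid n w c p B -> (1 <= m)%nat -> (i < n)%nat ->
  (rounded w c m i <= m)%nat
  /\ INR (rounded w c m i) * / INR m <= c * w i <= INR (rounded w c m i) * / INR m + / INR m.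
Proof.
  intros (Hc & Hw & _ & _) Hm Hi. destruct (Hw i Hi) as [Hw0 Hw1].
  assert (1 <= INR m) by (apply (le_INR 1); exact Hm).
  assert (0 <= c * w i) by nra.
  assert (S := nfloor_spec (w i * c * INR m) ltac:(nra)). fold (rounded w c m i) in S.
  set (k := rounded w c m i) in *. split.
  - apply INR_le. nra.
  - assert (0 < / INR m) by (apply Rinv_0_lt_compat; lra).
    assert (E : c * w i = (w i * c * INR m) * / INR m) by (field; lra).
    split; rewrite E; [|rewrite <- (Rmult_1_l (/ INR m)) at 3; rewrite <- Rmult_plus_distr_r];
      apply Rmult_le_compat_r; lra.
Qed.

(** Since c >= 0 it can be moved inside the maximum, where the normalisation c w_i <= 1 becomes
    applicable. *)
Lemma list_profit_item_sum (n : nat) (w : nat -> R) (c : R) (p : nat -> R) (B : R)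
    (l : list bool) :
  0 <= c -> length l = n ->
  list_profit n w c p B l
  = item_sum p 0 l - Rmax 0 (item_sum (fun i => c * w i) 0 l - B * c).
Proof.
  intros Hc Hl. unfold list_profit, gkp_profit. rewrite <- Hl, !rsum_item_sum.
  f_equal. rewrite <- RmaxRmult by exact Hc. rewrite Rmult_0_r. f_equal.
  rewrite Rmult_minus_distr_l.
  replace (item_sum (fun i => c * w i) 0 l)
    with (item_sum (fun i => c * w i + 0 * w i) 0 l).
  - rewrite item_sum_lin. ring.
  - apply Rle_antisym; apply item_sum_le; intros; lra.
Qed.

Lemma item_weight_le (k : nat -> nat) (m : nat) (l : list bool) : forall j,
  (forall i, (j <= i < j + length l)%nat -> (k i <= m)%nat) ->
  (item_weight k j l <= length l * m)%nat.
Proof.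
  induction l as [|b l IH]; intros j H; cbn [item_weight length Nat.mul] in *; [lia|].
  assert (k j <= m)%nat by (apply H; lia).
  specialize (IH (S j) ltac:(intros; apply H; lia)). destruct b; lia.
Qed.

(** Rounding down can only lower the penalty. Each item loses at most 1/m, and x -> max(0, x) is
    monotone and 1-Lipschitz. *)
Lemma profit_rounding (n : nat) (w : nat -> R) (c : R) (p : nat -> nat -> R) (B : nat -> R)
    (m s : nat) (l : list bool) :
  gkp_valid n w c p B -> (1 <= m)%nat -> length l = n ->
  let f := rounded_profit w c m (p s) (B s) l in
  list_profit n w c (p s) (B s) l <= f <= list_profit n w c (p s) (B s) l + INR n * / INR m.
Proof.
  intros V Hm Hl f. pose proof V as (Hc & Hw & Hp & HB).
  assert (1 <= INR m) by (apply (le_INR 1); exact Hm).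
  assert (0 < / INR m) by (apply Rinv_0_lt_compat; lra).
  assert (Rd : forall i, (0 <= i < 0 + length l)%nat ->
    / INR m * INR (rounded w c m i) + 0 * 0 <= c * w i
    <= 1 * (/ INR m * INR (rounded w c m i) + 0 * 0) + 1 * / INR m).
  { intros i Hi. destruct (rounded_spec n w c p B m i V Hm) as [_ R]; [lia|]. lra. }
  assert (E : INR (item_weight (rounded w c m) 0 l) * / INR m
    = item_sum (fun i => / INR m * INR (rounded w c m i) + 0 * 0) 0 l).
  { rewrite item_weight_sum, (item_sum_lin (/ INR m) 0 _ (fun _ => 0)). ring. }
  assert (L1 : item_sum (fun i => / INR m * INR (rounded w c m i) + 0 * 0) 0 l
     <= item_sum (fun i => c * w i) 0 l) by (apply item_sum_le; intros; apply Rd; auto).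
  assert (L2 : item_sum (fun i => c * w i) 0 l <=
     item_sum (fun i => / INR m * INR (rounded w c m i) + 0 * 0) 0 l + INR n * / INR m).
  { eapply Rle_trans; [apply item_sum_le; intros; apply Rd; eassumption|].
    rewrite item_sum_lin. pose proof (item_sum_const (/ INR m) l ltac:(lra) 0) as Q.
    rewrite Hl in Q. lra. }
  rewrite list_profit_item_sum by assumption.
  unfold f, rounded_profit. rewrite E.
  set (x := item_sum (fun i => / INR m * _ + 0 * 0) 0 l) in *.
  set (y := item_sum (fun i => c * w i) 0 l) in *.
  assert (0 <= INR n * / INR m) by (apply Rmult_le_pos; [apply pos_INR | lra]).
  unfold Rmax; repeat destruct (Rle_dec _ _); lra.
Qed.

Lemma penalty_bounds (n : nat) (w : nat -> R) (c : R) (p : nat -> nat -> R) (B : nat -> R)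
    (m s W : nat) :
  gkp_valid n w c p B -> (1 <= m)%nat -> (W <= n * m)%nat ->
  0 <= Rmax 0 (INR W * / INR m - B s * c) <= INR n.
Proof.
  intros (Hc & _ & _ & HB) Hm HW.
  assert (1 <= INR m) by (apply (le_INR 1); exact Hm).
  assert (0 < / INR m) by (apply Rinv_0_lt_compat; lra).
  assert (INR W * / INR m <= INR n).
  { apply le_INR in HW. rewrite mult_INR in HW.
    apply Rmult_le_reg_r with (INR m); [lra|].
    rewrite Rmult_assoc, Rinv_l by lra. lra. }
  assert (0 <= B s * c) by (apply Rmult_le_pos; auto).
  pose proof (pos_INR n).
  unfold Rmax; destruct (Rle_dec _ _); lra.
Qed.

Lemma item_sum_01 (p : nat -> R) (l : list bool) :
  (forall i, (i < length l)%nat -> 0 <= p i <= 1) -> 0 <= item_sum p 0 l <= INR (length l).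
Proof.
  intros H. split.
  - apply Rle_trans with (item_sum (fun _ => 0) 0 l); [apply item_sum_const; lra|].
    apply item_sum_le; intros; apply H; lia.
  - apply Rle_trans with (item_sum (fun _ => 1) 0 l).
    + apply item_sum_le; intros; apply H; lia.
    + pose proof (item_sum_const 1 l ltac:(lra) 0). lra.
Qed.

Lemma list_profit_bound (n : nat) (w : nat -> R) (c : R) (p : nat -> nat -> R) (B : nat -> R)
    (s : nat) (l : list bool) :
  gkp_valid n w c p B -> length l = n -> Rabs (list_profit n w c (p s) (B s) l) <= INR n.
Proof.
  intros (Hc & Hw & Hp & HB) Hl. rewrite list_profit_item_sum by assumption.
  assert (P1 : 0 <= item_sum (p s) 0 l <= INR n).
  { rewrite <- Hl. apply item_sum_01. intros; apply Hp; lia. }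
  assert (P2 : 0 <= item_sum (fun i => c * w i) 0 l <= INR n).
  { rewrite <- Hl. apply item_sum_01. intros i Hi.
    destruct (Hw i) as [H1 H2]; [lia|]. split; [apply Rmult_le_pos|]; assumption. }
  assert (0 <= B s * c) by (apply Rmult_le_pos; auto).
  apply Rabs_le. unfold Rmax; destruct (Rle_dec _ _); lra.
Qed.

Lemma item_prod_mult (a b : nat -> R) (l : list bool) : forall j,
  item_prod (fun i => a i * b i) j l = item_prod a j l * item_prod b j l.
Proof.
  induction l as [|c l IH]; intros j; cbn [item_prod]; [ring|]. rewrite IH. destruct c; ring.
Qed.

Lemma item_prod_one (l : list bool) : forall j, item_prod (fun _ => 1) j l = 1.
Proof.
  induction l as [|c l IH]; intros j; cbn [item_prod]; [ring|]. rewrite IH. destruct c; ring.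
Qed.

(** Exchanging the products over items and over rounds identifies the weight used by the dynamic
    program with the round-by-round weight that [hedge] analyses. *)
Lemma set_weight_rprod (n m : nat) (p : nat -> nat -> R) (c : R) (B : nat -> R)
    (k : nat -> nat) (e h : nat) (l : list bool) :
  set_weight (item_factor n m p e h) k (weight_factor n m c B e h) 0 0 l
  = rprod h (fun q => item_prod (profit_factor n m p e q) 0 l
                      * penalty_factor n m c B e q (item_weight k 0 l)).
Proof.
  unfold set_weight. cbn [Nat.add].
  induction h as [|h IH].
  - cbn. unfold item_factor; cbn. rewrite item_prod_one. unfold weight_factor; cbn. ring.
  - cbn [rprod]. rewrite <- IH. unfold weight_factor; cbn [rprod].
    change (item_factor n m p e (S h))
      with (fun i => item_factor n m p e h i * profit_factor n m p e h i).
    rewrite item_prod_mult. change (fun i => item_factor n m p e h i) with (item_factor n m p e h).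
    change (fun i => profit_factor n m p e h i) with (profit_factor n m p e h). ring.
Qed.

(** The hypothesis of [hedge]. From below, the items lose 2 eta^2 n and the penalty 2 eta^2 g^2 with
    g <= n, together at most 4 eta^2 n^2. From above, the product is first collapsed into exp (eta
    f), which avoids cross terms, and then expanded by [exp_upper]. *)
Lemma factor_bounds (n : nat) (w : nat -> R) (c : R) (p : nat -> nat -> R) (B : nat -> R)
    (m e q : nat) (l : list bool) :
  gkp_valid n w c p B -> (1 <= n)%nat -> (1 <= m)%nat -> length l = n ->
  let eta := rate n m in
  let f := rounded_profit w c m (p (e + q)%nat) (B (e + q)%nat) l in
  exp (eta * f - 4 * eta ^ 2 * INR n ^ 2)
  <= item_prod (profit_factor n m p e q) 0 l
     * penalty_factor n m c B e q (item_weight (rounded w c m) 0 l)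
  <= 1 + eta * f + 2 * eta ^ 2 * INR n ^ 2.
Proof.
  intros V Hn Hm Hl eta f. pose proof V as (Hc & Hw & Hp & HB).
  destruct (rate_bounds n m Hm) as (Re0 & Re1 & _). fold eta in Re0, Re1.
  assert (N1 : 1 <= INR n) by (apply (le_INR 1); exact Hn).
  set (W := item_weight (rounded w c m) 0 l).
  assert (HW : (W <= n * m)%nat).
  { unfold W. rewrite <- Hl. apply item_weight_le. intros i Hi.
    eapply rounded_spec; eauto. lia. }
  assert (G := penalty_bounds n w c p B m (e + q) W V Hm HW).
  set (g := Rmax 0 (INR W * / INR m - B (e + q)%nat * c)) in *.
  assert (Eg : penalty_factor n m c B e q W = 1 - g * eta).
  { unfold penalty_factor, g, Rmax. fold eta.
    set (x := INR W * / INR m - B (e + q)%nat * c).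
    destruct (Rlt_dec 0 x), (Rle_dec 0 x); try lra.
    replace x with 0 by lra. ring. }
  rewrite Eg.
  assert (S01 : 0 <= item_sum (p (e + q)%nat) 0 l <= INR n).
  { rewrite <- Hl. apply item_sum_01. intros; apply Hp; lia. }
  assert (Ef : f = item_sum (p (e + q)%nat) 0 l - g) by reflexivity.
  clearbody f. set (S := item_sum (p (e + q)%nat) 0 l) in *.
  assert (U := item_prod_upper eta (p (e + q)%nat) l 0 ltac:(lra)
                 ltac:(intros i Hi; apply Hp; lia)).
  assert (L := item_prod_lower eta (p (e + q)%nat) l 0 ltac:(lra)
                 ltac:(intros i Hi; apply Hp; lia)).
  fold S in U, L. rewrite Hl in L.
  change (fun i => p (e + q)%nat i * eta + 1) with (profit_factor n m p e q) in U, L.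
  set (I := item_prod (profit_factor n m p e q) 0 l) in *.
  assert (E2 : 0 <= eta ^ 2) by apply pow2_ge_0.
  assert (gE : 0 <= g * eta <= 1 / 4) by nra.
  split.
  - replace (eta * f - 4 * eta ^ 2 * INR n ^ 2)
      with ((eta * S - 2 * eta ^ 2 * INR n ^ 2) + (- (g * eta) - 2 * eta ^ 2 * INR n ^ 2))
      by (rewrite Ef; ring).
    rewrite exp_plus. apply Rmult_le_compat; try (left; apply exp_pos).
    + eapply Rle_trans; [|exact L]. apply exp_le.
      assert (INR n <= INR n ^ 2) by nra. nra.
    + replace (1 - g * eta) with (1 + - (g * eta)) by ring.
      eapply Rle_trans; [|apply exp_lower; lra]. apply exp_le.
      assert (g ^ 2 <= INR n ^ 2) by nra.
      replace ((- (g * eta)) ^ 2) with (eta ^ 2 * g ^ 2) by ring. nra.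
  - apply Rle_trans with (exp (eta * f)).
    + rewrite Ef. replace (eta * (S - g)) with (eta * S + - (g * eta)) by ring.
      rewrite exp_plus. apply Rmult_le_compat; try apply U; [lra|].
      pose proof (exp_ineq1_le (- (g * eta))); lra.
    + eapply Rle_trans; [apply exp_upper; rewrite Ef; nra|].
      assert (f ^ 2 <= INR n ^ 2) by (rewrite Ef; nra).
      replace ((eta * f) ^ 2) with (eta ^ 2 * f ^ 2) by ring. nra.
Qed.

(** Of the constant 11, Hedge accounts for 10 and rounding for 1: at most m^2 rounds lose n/m each.
    The last sum is the sampling error. *)
Lemma epoch_regret (n : nat) (w : nat -> R) (c : R) (p : nat -> nat -> R) (B : nat -> R)
    (m e t : nat) (L : nat -> nat) (l0 : list bool) :
  gkp_valid n w c p B -> (1 <= n)%nat -> (1 <= m)%nat -> (t <= m * m)%nat ->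
  (forall s, (n * s <= L s)%nat) -> length l0 = n ->
  rsum t (fun q => list_profit n w c (p (e + q)%nat) (B (e + q)%nat) l0
    - avg (L (e + q)%nat) (fun cs => list_profit n w c (p (e + q)%nat) (B (e + q)%nat)
                          (drawn_set n m w c p B e q (e + q) cs)))
  <= 11 * INR n ^ 2 * INR m + 2 * INR n ^ 2 * rsum t (fun q => / 2 ^ (e + q)).
Proof.
  intros V Hn Hm Ht HL Hl0.
  destruct (rate_bounds n m Hm) as (Re0 & Re1 & Re2).
  assert (N1 : 1 <= INR n) by (apply (le_INR 1); exact Hn).
  assert (M1 : 1 <= INR m) by (apply (le_INR 1); exact Hm).
  set (eta := rate n m) in *.
  set (k := rounded w c m).
  set (u q l := item_prod (profit_factor n m p e q) 0 l
                * penalty_factor n m c B e q (item_weight k 0 l)).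
  set (f q l := rounded_profit w c m (p (e + q)%nat) (B (e + q)%nat) l).
  set (g q l := list_profit n w c (p (e + q)%nat) (B (e + q)%nat) l).
  set (wt q l := rprod q (fun q => u q l)).
  set (E F q := sumL (fun l => wt q l * F q l) (all_coins n) / sumL (wt q) (all_coins n)).
  assert (Hu : forall q l, length l = n ->
    exp (eta * f q l - 4 * eta ^ 2 * INR n ^ 2) <= u q l
    <= 1 + eta * f q l + 2 * eta ^ 2 * INR n ^ 2)
    by (intros q l Hl; apply factor_bounds; assumption).
  assert (Hh : eta * rsum t (fun q => f q l0 - E f q)
            <= INR n + INR t * (4 * eta ^ 2 * INR n ^ 2 + 2 * eta ^ 2 * INR n ^ 2)).
  { apply (hedge (all_coins n) u f).
    - intros q l _ Hl. apply Hu, in_all_coins, Hl.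
    - apply in_all_coins, Hl0.
    (* There are 2^n <= e^n sets, whence [lsize] = n. *)
    - rewrite all_coins_length, pow_INR.
      apply Rle_trans with (exp 1 ^ n).
      + apply pow_incr. cbn. pose proof (exp_ineq1_le 1). lra.
      + right. clear. induction n as [|n IH]; [cbn; rewrite exp_0; reflexivity|].
        rewrite S_INR, exp_plus, <- IH. cbn; ring. }
  assert (Wpos : forall q l, In l (all_coins n) -> 0 < wt q l).
  { intros q l Hl. apply rprod_pos. intros q' _. apply in_all_coins in Hl.
    eapply Rlt_le_trans; [apply exp_pos|]. apply Hu, Hl. }
  assert (Zpos : forall q, 0 < sumL (wt q) (all_coins n)).
  { intros q. apply sumL_pos with l0; [apply Wpos | apply in_all_coins, Hl0]. }
  (* Rounding never lowers a profit, so the comparator loses nothing and the n/m is paid only on the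
     side of the algorithm. *)
  assert (Hround : forall q, E g q >= E f q - INR n * / INR m).
  { intros q. apply Rle_ge. unfold E.
    apply Rmult_le_reg_r with (sumL (wt q) (all_coins n)); [apply Zpos|].
    unfold Rdiv. rewrite Rmult_minus_distr_r, !Rmult_assoc, Rinv_l, !Rmult_1_r
      by (apply Rgt_not_eq, Zpos).
    replace (sumL (fun l => wt q l * f q l) (all_coins n)
             - INR n * (/ INR m * sumL (wt q) (all_coins n)))
      with (sumL (fun l => 1 * (wt q l * f q l) + (- (INR n * / INR m)) * wt q l) (all_coins n))
      by (rewrite sumL_lin; ring).
    apply sumL_le. intros l Hl. pose proof (Wpos q l Hl). apply in_all_coins in Hl.
    pose proof (profit_rounding n w c p B m (e + q) l V Hm Hl) as R. cbv zeta in R.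
    fold (f q l) in R. fold (g q l) in R. nra. }
  assert (Hsample : forall q,
    avg (L (e + q)%nat) (fun cs => g q (drawn_set n m w c p B e q (e + q) cs))
    >= E g q - 2 * INR n ^ 2 * / 2 ^ (e + q)).
  { intros q.
    pose proof (sample_expectation (item_factor n m p e q) k (weight_factor n m c B e q)
      n m (e + q) (INR n)) as SE.
    assert (Sa : forall i, (i < n)%nat -> 0 < item_factor n m p e q i /\ (k i <= m)%nat).
    { intros i Hi. split; [|apply (rounded_spec n w c p B); auto].
      apply rprod_pos. intros q' _. unfold profit_factor. fold eta.
      destruct V as (_ & _ & Hp & _). specialize (Hp (e + q')%nat i Hi). nra. }
    assert (Sp : forall W, (W <= n * m)%nat -> 0 < weight_factor n m c B e q W).
    { intros W HW. apply rprod_pos. intros q' _. unfold penalty_factor. fold eta.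
      pose proof (penalty_bounds n w c p B m (e + q') W V Hm HW) as G.
      destruct (Rlt_dec _ _); [|lra]. rewrite Rmax_right in G by lra. nra. }
    specialize (SE Sa Sp n 0%nat 0%nat (L (e + q)%nat) (g q) ltac:(lia) ltac:(lia)
      (HL _) (fun l Hl => list_profit_bound n w c p B (e + q) l V Hl)).
    fold (drawn_set n m w c p B e q (e + q)) in SE.
    rewrite dp_sum in SE.
    rewrite (sumL_ext (set_weight _ _ _ 0 0) (wt q)) in SE
      by (intros; apply set_weight_rprod).
    rewrite (sumL_ext _ (fun l => wt q l * g q l)) in SE
      by (intros; f_equal; apply set_weight_rprod).
    fold (E g q) in SE.
    replace (2 * INR n ^ 2 * / 2 ^ (e + q)) with (INR n * (2 * INR n * / 2 ^ (e + q))) by ring.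
    set (d := INR n * _) in *.
    change (fun cs => g q (drawn_set n m w c p B e q (e + q) cs)) with
      (fun cs => g q (sample (item_factor n m p e q) k (weight_factor n m c B e q) (e + q) n 0 0 cs)).
    revert SE. unfold Rabs. destruct (Rcase_abs _); intros; lra. }
  apply Rle_trans with (rsum t (fun q => 1 * (f q l0 - E f q)
      + 1 * (1 * (INR n * / INR m) + 2 * INR n ^ 2 * / 2 ^ (e + q)))).
  { apply rsum_le. intros q _. specialize (Hround q); specialize (Hsample q).
    pose proof (profit_rounding n w c p B m (e + q) l0 V Hm Hl0) as [R _].
    fold (f q l0) in R. fold (g q l0) in R. fold (g q l0).
    change (fun cs => list_profit n w c (p (e + q)%nat) (B (e + q)%nat)
              (drawn_set n m w c p B e q (e + q) cs))
      with (fun cs => g q (drawn_set n m w c p B e q (e + q) cs)).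
    lra. }
  rewrite rsum_lin, rsum_lin, rsum_const.
  set (R := rsum t (fun q => f q l0 - E f q)) in *.
  assert (HR : R <= 10 * INR n ^ 2 * INR m).
  { apply Rmult_le_reg_l with eta; [exact Re0|].
    eapply Rle_trans; [exact Hh|].
    assert (T2 : INR t <= INR m ^ 2).
    { apply le_INR in Ht. rewrite mult_INR in Ht. nra. }
    (* Since eta m (n+1) = 1/4, the right side equals 2 n^2 / (n+1), and n >= 1. *)
    assert (A1 : INR n <= 8 * (eta * INR m) * INR n ^ 2).
    { assert (eta * INR m * (INR n + 1) = / 4) by lra.
      assert (0 < eta * INR m) by nra. nra. }
    assert (A2 : INR t * (4 * eta ^ 2 * INR n ^ 2 + 2 * eta ^ 2 * INR n ^ 2)
                 <= 2 * (eta * INR m) * INR n ^ 2).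
    { replace (INR t * (4 * eta ^ 2 * INR n ^ 2 + 2 * eta ^ 2 * INR n ^ 2))
        with (INR t * (6 * eta ^ 2 * INR n ^ 2)) by ring.
      apply Rle_trans with (INR m ^ 2 * (6 * eta ^ 2 * INR n ^ 2)).
      - apply Rmult_le_compat_r; [|exact T2].
        assert (0 <= eta ^ 2) by apply pow2_ge_0. assert (0 <= INR n ^ 2) by apply pow2_ge_0. nra.
      - replace (INR m ^ 2 * (6 * eta ^ 2 * INR n ^ 2))
          with (6 * (eta * INR m) * (eta * INR m) * INR n ^ 2) by ring.
        assert (0 < eta * INR m) by nra.
        assert (eta * INR m <= / 8) by nra.
        apply Rmult_le_compat_r; [apply pow2_ge_0|]. nra. }
    nra. }
  assert (HT : INR t * (INR n * / INR m) <= INR n * INR m).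
  { apply le_INR in Ht. rewrite mult_INR in Ht.
    replace (INR n * INR m) with ((INR m * INR m) * (INR n * / INR m)) by (field; lra).
    apply Rmult_le_compat_r; [|exact Ht].
    apply Rmult_le_pos; [lra|]. left; apply Rinv_0_lt_compat; lra. }
  assert (INR n * INR m <= INR n ^ 2 * INR m) by (apply Rmult_le_compat_r; nra).
  lra.
Qed.

(** * The algorithm *)

(* [xE], [xL], [xM] are the start and length of the current epoch and m; [xH] the
   number of its past rounds; [xHB] the address of their data in array 0; [xR] and
   [xStr] the address and length of a row of the table in array 1; [xI] an item i,
   with k_i in [xK] and a_i in [rA]. Array 2 receives the drawn set. *)
Notation xE := 6%nat. Notation xL := 7%nat. Notation xM := 8%nat.
Notation xT := 9%nat. Notation xH := 10%nat. Notation xN1 := 11%nat.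
Notation xStr := 12%nat. Notation xHB := 13%nat. Notation xW := 14%nat.
Notation xP := 15%nat. Notation xR := 16%nat. Notation xR2 := 17%nat.
Notation xI := 18%nat. Notation xK := 19%nat. Notation c1 := 20%nat. Notation c2 := 21%nat.
Notation rA := 0%nat. Notation rB := 1%nat. Notation rD := 2%nat.
Notation rP := 3%nat. Notation rW := 4%nat. Notation rQ := 5%nat.
Notation rX := 6%nat. Notation rOne := 7%nat. Notation rM := 8%nat.
Notation rN1 := 9%nat. Notation rEta := 10%nat. Notation rInvM := 11%nat.
Notation rC := 12%nat. Notation rZero := 13%nat.

Definition seqs (l : list acmd) : acmd := fold_right ASeq ASkip l.
Definition ins (i : instr) : acmd := APrim (AI i).
Definition ld (t k a : nat) : acmd := APrim (ALd t k a).
Definition st (t a k : nat) : acmd := APrim (ASt t a k).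

(** Advances while the next epoch starts no later than s. The s iterations suffice because epoch j
    starts at j or later; once the epoch is found, the remaining ones do nothing. *)
Definition epoch_loop : acmd :=
  AFor c1 1 (seqs [ins (NAdd xT xE xL);
    AIf (TNlt 1 xT) ASkip
      (seqs [ins (NAdd xE xT 2); ins (NAdd xM xM xM);
             ins (NAdd xL xL xL); ins (NAdd xL xL xL)])]).

Definition find_epoch : acmd :=
  seqs [ins (NConst xE 0); ins (NConst xL 1); ins (NConst xM 1); epoch_loop].

(** Products of index registers are computed by counted addition. [real_m_loop] and [real_n_loop]
    use the same device to carry integers over to real registers. *)
Definition stride_loop : acmd := AFor c1 0 (ins (NAdd xStr xStr xM)).
Definition history_loop : acmd := AFor c1 xE (ins (NAdd xHB xHB xN1)).
Definition real_m_loop : acmd := AFor c1 xM (ins (RAdd rM rM rOne)).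
Definition real_n_loop : acmd := AFor c1 0 (ins (RAdd rN1 rN1 rOne)).

Definition constants : acmd :=
  seqs [ins (NSub xH 1 xE); ins (NAdd xN1 0 3);
    ins (NConst xStr 1); stride_loop;
    ins (NAdd xHB xN1 2); history_loop;
    ins (RConst rOne 1); ins (RConst rZero 0);
    ins (RConst rM 0); real_m_loop; ins (RConst rN1 1); real_n_loop;
    ins (RConst rB 4); ins (RMul rB rB rN1); ins (RMul rB rB rM);
    ins (RDiv rEta rOne rB); ins (RDiv rInvM rOne rM); ld 0 rC 0].

Definition penalty_loop : acmd :=
  AFor c2 xH (seqs [ld 0 rB xP; ins (RMul rB rB rC); ins (RSub rB rW rB);
    AIf (TRlt rZero rB)
      (seqs [ins (RMul rB rB rEta); ins (RSub rB rOne rB); ins (RMul rP rP rB)]) ASkip;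
    ins (NAdd xP xP xN1)]).

Definition base_row_loop : acmd :=
  AFor c1 xStr (seqs [ins (RConst rP 1); ins (NAdd xP xHB 0); penalty_loop;
    st 1 xW rP; ins (NAdd xW xW 3); ins (RAdd rW rW rInvM)]).

Definition base_row : acmd :=
  seqs [ins (NConst xW 0); ins (RConst rW 0); base_row_loop].

Definition factor_loop : acmd :=
  AFor c2 xH (seqs [ld 0 rB xP; ins (RMul rB rB rEta); ins (RAdd rB rB rOne);
    ins (RMul rA rA rB); ins (NAdd xP xP xN1)]).

(** A floor by repeated subtraction of 1; m rounds suffice since c w_i m <= m. *)
Definition floor_loop : acmd :=
  AFor c2 xM (AIf (TRlt rX rOne) ASkip
    (seqs [ins (RSub rX rX rOne); ins (NAdd xK xK 3)])).

Definition item : acmd :=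
  seqs [ins (RConst rA 1); ins (NAdd xP xHB xI); factor_loop;
    ld 0 rX xI; ins (RMul rX rX rC); ins (RMul rX rX rM); ins (NConst xK 0); floor_loop].

(** When W + k_i > n m the read runs past the end of the row. Such columns receive meaningless
    values, but the columns that are consulted later do not depend on them. *)
Definition row_loop : acmd :=
  AFor c2 xStr (seqs [ins (NAdd xP xR xW); ld 1 rB xP; ins (NAdd xP xP xK); ld 1 rD xP;
    ins (RMul rD rD rA); ins (RAdd rB rB rD); ins (NAdd xP xR2 xW); st 1 xP rB;
    ins (NAdd xW xW 3)]).

Definition rows_body : acmd :=
  seqs [ins (NSub xI c1 3); item; ins (NAdd xR2 xR xStr); ins (NConst xW 0);
    row_loop; ins (NAdd xR xR2 2)].

Definition rows_loop : acmd := AFor c1 0 rows_body.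

Definition coin_loop : acmd :=
  AFor c2 1 (seqs [ins (RAdd rQ rQ rQ); ins (Coin rD); ins (RSub rQ rQ rD)]).

(** Items are drawn in increasing order while [xR] descends through the rows, since the sums over
    the items after i are one row below the current one. *)
Definition draw_body : acmd :=
  seqs [ins (NSub xI 0 c1); item; ins (NSub xR2 xR xStr);
    ins (NAdd xP xR2 xW); ld 1 rB xP; ins (NAdd xP xP xK); ld 1 rD xP;
    ins (RMul rD rD rA); ins (RAdd rB rB rD); ins (RDiv rQ rD rB); coin_loop;
    AIf (TRlt rZero rQ) (seqs [st 2 xI rOne; ins (NAdd xW xW xK)]) (st 2 xI rZero);
    ins (NAdd xR xR2 2)].

Definition draw_loop : acmd := AFor c1 0 draw_body.

Definition main_phase : acmd :=
  seqs [base_row; ins (NConst xR 0); rows_loop; ins (NConst xW 0); draw_loop].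

(** * Correctness of the program, phase by phase *)

Ltac exec :=
  cbn [seqs fold_right ins ld st asem aprim prim step at_pc nth_error set_ax
       sr ar ax ac mr mx mc rr xr ncoins pc eval_test updR updN upd_arr Nat.eqb].

(** The standard library has / 0 = 0, so the guarded division agrees with the ordinary one. *)
Lemma safe_div_eq (a b : R) : safe_div a b = a / b.
Proof.
  unfold safe_div. destruct (Req_EM_T b 0) as [->|]; [|reflexivity].
  unfold Rdiv. rewrite Rinv_0. ring.
Qed.

Fixpoint epoch_start (j : nat) : nat :=
  match j with O => 0 | S j => epoch_start j + 4 ^ j end%nat.

(** The first bound limits the search for the epoch to s steps; the second gives m <= s + 1, which
    keeps the table polynomial. *)
Lemma epoch_start_ge (j : nat) : (j <= epoch_start j /\ 2 ^ j <= epoch_start j + 1)%nat.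
Proof.
  induction j as [|j IH]; cbn [epoch_start]; [cbn; lia|].
  assert (2 ^ j <= 4 ^ j)%nat by (apply Nat.pow_le_mono_l; lia).
  assert (1 <= 2 ^ j)%nat by (clear; induction j; cbn; lia).
  rewrite Nat.pow_succ_r'. lia.
Qed.

Lemma find_epoch_spec (coins : list bool) (S : ast) :
  ax S 2 = 0%nat -> ax S 3 = 1%nat ->
  exists j, (epoch_start j <= ax S 1 < epoch_start (1 + j))%nat /\
    ax (asem coins find_epoch S) xE = epoch_start j /\
    ax (asem coins find_epoch S) xM = (2 ^ j)%nat.
Proof.
  intros H2 H3. unfold find_epoch. exec.
  match goal with |- context[asem coins epoch_loop ?T] => set (S1 := T) end.
  set (s := ax S 1).
  (* The final disjunction says that either the epoch has been reached or every iteration so far has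
     advanced; in the second case j = s at the end, and epoch s + 1 starts after round s. *)
  assert (G : (fun i S' => ax S' 1 = s /\ ax S' 2 = 0%nat /\
    exists j, ax S' xE = epoch_start j /\ ax S' xL = (4 ^ j)%nat /\ ax S' xM = (2 ^ j)%nat
      /\ (epoch_start j <= s)%nat /\ ((s < epoch_start (1 + j))%nat \/ j = i))
     (ax S1 1) (asem coins epoch_loop S1)).
  { unfold epoch_loop. apply for_inv; [reflexivity|intros i v S' H; exact H| |].
    - exec. split; [reflexivity|]. split; [exact H2|]. exists 0%nat. cbn; repeat split; auto. lia.
    - intros i S' Hi Hc (Hs & Z & j & E & L & M & Hle & Hj).
      change (ax S1 1) with s in *. exec. rewrite Hs, E, L, M, Z.
      cbn [epoch_start Nat.add] in *.
      destruct (Nat.ltb_spec s (epoch_start j + 4 ^ j)) as [Hlt|Hge].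
      + exec. repeat split; auto. exists j. repeat split; auto.
      + exec. repeat split; auto. exists (1 + j)%nat.
        change (1 + j)%nat with (Datatypes.S j). cbn [epoch_start].
        rewrite ?E, ?L, ?M, ?Z, !Nat.pow_succ_r'. repeat split; try lia. }
  change (ax S1 1) with s in G. cbv beta in G. destruct G as (_ & _ & j & E & L & M & Hle & Hj). exists j.
  repeat split; auto. destruct Hj as [Hj|Hj]; [exact Hj|]. subst j.
  pose proof (epoch_start_ge s). cbn [epoch_start Nat.add].
  assert (1 <= 4 ^ s)%nat by (clear; induction s; cbn; lia). lia.
Qed.

Record input (n : nat) (w : nat -> R) (c : R) (p : nat -> nat -> R) (B : nat -> R) (s : nat)
    (a : nat -> R) : Prop := Input
  { input_w : forall i, (i < n)%nat -> a i = w i;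
    input_c : a n = c;
    input_p : forall q i, (q < s)%nat -> (i < n)%nat -> a (n + 1 + q * (n + 1) + i)%nat = p q i;
    input_B : forall q, (q < s)%nat -> a (n + 1 + q * (n + 1) + n)%nat = B q }.

(** What [constants] establishes and every later phase preserves. *)
Record env (n : nat) (w : nat -> R) (c : R) (p : nat -> nat -> R) (B : nat -> R) (s e m : nat)
    (S : ast) : Prop := Env
  { env_n : ax S 0 = n; env_s : ax S 1 = s; env_0 : ax S 2 = 0%nat; env_1 : ax S 3 = 1%nat;
    env_m : ax S xM = m; env_h : ax S xH = (s - e)%nat;
    env_n1 : ax S xN1 = (n + 1)%nat; env_str : ax S xStr = (n * m + 1)%nat;
    env_hb : ax S xHB = (n + 1 + e * (n + 1))%nat;
    env_one : sr S rOne = 1; env_zero : sr S rZero = 0; env_rm : sr S rM = INR m;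
    env_eta : sr S rEta = rate n m; env_invm : sr S rInvM = / INR m; env_c : sr S rC = c;
    env_input : input n w c p B s (ar S 0) }.

Definition env_free (c : acmd) : bool :=
  forallb (fun a => free (xwrites a) (Nat.eqb a) c) [0;1;2;3;xM;xH;xN1;xStr;xHB]%nat
  && forallb (fun k => free (rwrites k) (fun _ => false) c)
       [rOne;rZero;rM;rEta;rInvM;rC]%nat
  && free (awrites 0) (fun _ => false) c.

Lemma env_frame (coins : list bool) (n : nat) (w : nat -> R) (c : R) (p : nat -> nat -> R)
    (B : nat -> R) (s e m : nat) (S : ast) (cm : acmd) :
  env n w c p B s e m S -> env_free cm = true -> env n w c p B s e m (asem coins cm S).
Proof.
  intros [] H. unfold env_free in H. apply andb_prop in H as [H H3].
  apply andb_prop in H as [H1 H2].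
  rewrite forallb_forall in H1, H2.
  split.
  1-9: rewrite frame_ax; [assumption | apply H1; cbn; tauto].
  1-6: rewrite frame_sr; [assumption | apply H2; cbn; tauto].
  rewrite frame_ar; assumption.
Qed.

(** The index registers mentioned by [env] are all at most 13. *)
Lemma env_set_ax (n : nat) (w : nat -> R) (c : R) (p : nat -> nat -> R)
    (B : nat -> R) (s e m a v : nat) (S : ast) :
  env n w c p B s e m S -> (13 < a)%nat -> env n w c p B s e m (set_ax a v S).
Proof.
  intros [] H. split; cbn [set_ax ax sr ar]; rewrite ?updN_other by lia; assumption.
Qed.

Lemma count_loop_ax (coins : list bool) (a b t d : nat) (S : ast) :
  Nat.eqb a t = false -> Nat.eqb a d = false -> Nat.eqb d t = false ->
  ax (asem coins (AFor a b (ins (NAdd t t d))) S) t = (ax S t + ax S b * ax S d)%nat.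
Proof.
  intros H1 H2 H3. apply Nat.eqb_neq in H1, H2, H3.
  enough (G : (fun j S' => ax S' d = ax S d /\ ax S' t = (ax S t + j * ax S d)%nat)
    (ax S b) (asem coins (AFor a b (ins (NAdd t t d))) S)) by apply G.
  apply for_inv.
  - cbn. destruct (Nat.eqb_spec a t); [lia | reflexivity].
  - intros j v S' H. cbn [set_ax ax]. rewrite !updN_other by lia. exact H.
  - lia.
  - intros j S' Hj Hc [E1 E2].
    cbn [ins asem aprim prim step at_pc nth_error set_ax ax mx rr xr ncoins sr ar ac mr mc pc].
    rewrite updN_same, updN_other by lia. rewrite E1, E2. lia.
Qed.

Lemma count_loop_sr (coins : list bool) (a b t d : nat) (S : ast) :
  Nat.eqb d t = false -> sr S d = 1 ->
  sr (asem coins (AFor a b (ins (RAdd t t d))) S) t = sr S t + INR (ax S b).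
Proof.
  intros H1 H2. apply Nat.eqb_neq in H1.
  enough (G : (fun j S' => sr S' d = 1 /\ sr S' t = sr S t + INR j)
    (ax S b) (asem coins (AFor a b (ins (RAdd t t d))) S)) by apply G.
  apply for_inv.
  - reflexivity.
  - intros j v S' H. exact H.
  - cbn [INR]. split; [assumption | ring].
  - intros j S' Hj Hc [E1 E2].
    cbn [ins asem aprim prim step at_pc nth_error set_ax ax mx rr xr ncoins sr ar ac mr mc pc].
    rewrite updR_same, updR_other by lia. rewrite E1, E2.
    change (1 + j)%nat with (Datatypes.S j). rewrite S_INR. split; [reflexivity | ring].
Qed.

Lemma constants_spec (coins : list bool) (n : nat) (w : nat -> R) (c : R) (p : nat -> nat -> R)
    (B : nat -> R) (s e m : nat) (S : ast) :
  ax S 0 = n -> ax S 1 = s -> ax S 2 = 0%nat -> ax S 3 = 1%nat -> ax S xE = e -> ax S xM = m ->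
  input n w c p B s (ar S 0) ->
  env n w c p B s e m (asem coins constants S).
Proof.
  intros H0 H1 H2 H3 HE HM HI. unfold constants.
  exec.
  match goal with |- context[asem coins stride_loop ?T] => set (S1 := T) end.
  assert (E1 : ax (asem coins stride_loop S1) xStr = (n * m + 1)%nat).
  { unfold stride_loop. rewrite count_loop_ax by reflexivity. cbn. lia. }
  match goal with |- context[asem coins history_loop ?T] => set (S2 := T) end.
  assert (E2 : ax (asem coins history_loop S2) xHB = (n + 1 + e * (n + 1))%nat).
  { unfold history_loop. rewrite count_loop_ax by reflexivity. unfold S2.
    cbn [ax updN Nat.eqb].
    rewrite !(frame_ax coins _ stride_loop) by reflexivity. cbn. lia. }
  match goal with |- context[asem coins real_m_loop ?T] => set (S3 := T) end.
  assert (E3 : sr (asem coins real_m_loop S3) rM = INR m).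
  { unfold real_m_loop. rewrite count_loop_sr by reflexivity. unfold S3.
    cbn [ax updN sr updR Nat.eqb].
    rewrite (frame_ax coins _ history_loop) by reflexivity. unfold S2. cbn [ax updN Nat.eqb].
    rewrite !(frame_ax coins _ stride_loop) by reflexivity. cbn. rewrite HM. ring. }
  match goal with |- context[asem coins real_n_loop ?T] => set (S4 := T) end.
  assert (F4 : forall a, In a [0;1;2;3;xM;xH;xN1;xStr;xHB]%nat ->
            ax (asem coins real_n_loop S4) a = ax S3 a).
  { intros a Ha. cbn in Ha.
    assert (A : forall a, In a [0;1;2;3;xM;xH;xN1;xStr;xHB]%nat ->
       ax (asem coins real_n_loop S4) a = ax (asem coins real_m_loop S3) a).
    { intros b Hb. rewrite frame_ax; [reflexivity|].
      cbn in Hb; repeat destruct Hb as [<-|Hb]; try contradiction; reflexivity. }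
    rewrite A by exact Ha. apply frame_ax.
    repeat destruct Ha as [<-|Ha]; try contradiction; reflexivity. }
  assert (F3 : forall a, In a [0;1;2;3;xM;xH;xN1;xStr]%nat -> ax S3 a = ax S2 a).
  { intros a Ha. apply (frame_ax coins a history_loop).
    cbn in Ha; repeat destruct Ha as [<-|Ha]; try contradiction; reflexivity. }
  assert (F2 : forall a, In a [0;1;2;3;xM;xH;xN1]%nat -> ax S2 a = ax S1 a).
  { intros a Ha. transitivity (ax (asem coins stride_loop S1) a); [|apply frame_ax];
      cbn in Ha; repeat destruct Ha as [<-|Ha]; try contradiction; reflexivity. }
  assert (R4 : sr (asem coins real_n_loop S4) rN1 = INR n + 1).
  { unfold real_n_loop. rewrite count_loop_sr.
    - unfold S4. cbn [sr ax updR Nat.eqb]. rewrite frame_ax by reflexivity.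
      rewrite F3, F2 by (cbn; tauto). cbn. rewrite H0. ring.
    - reflexivity.
    - unfold S4. cbn [sr updR Nat.eqb]. rewrite frame_sr by reflexivity. reflexivity. }
  assert (R4m : sr (asem coins real_n_loop S4) rM = INR m).
  { rewrite frame_sr by reflexivity. unfold S4. cbn [sr updR Nat.eqb]. exact E3. }
  assert (R41 : sr (asem coins real_n_loop S4) rOne = 1).
  { rewrite frame_sr by reflexivity. unfold S4. cbn [sr updR Nat.eqb].
    rewrite frame_sr by reflexivity. reflexivity. }
  assert (R40 : sr (asem coins real_n_loop S4) rZero = 0).
  { rewrite frame_sr by reflexivity. unfold S4. cbn [sr updR Nat.eqb].
    rewrite frame_sr by reflexivity. reflexivity. }
  assert (A4 : ar (asem coins real_n_loop S4) 0 = ar S 0).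
  { rewrite frame_ar by reflexivity. unfold S4. cbn [ar].
    rewrite frame_ar by reflexivity. unfold S3. cbn [ar].
    rewrite frame_ar by reflexivity. unfold S2. cbn [ar].
    rewrite frame_ar by reflexivity. reflexivity. }
  assert (X0 : forall a, In a [0;1;2;3;xM;xH;xN1]%nat ->
            ax (asem coins real_n_loop S4) a = ax S1 a).
  { intros a Ha. rewrite F4, F3, F2 by (cbn in *; tauto). reflexivity. }
  split; exec; rewrite ?R4, ?R4m, ?R41, ?R40, ?A4, ?safe_div_eq.
  1-6: rewrite X0 by (cbn; tauto); cbn; lia || assumption.
  - rewrite X0 by (cbn; tauto). cbn. lia.
  - rewrite F4, F3 by (cbn; tauto). exact E1.
  - rewrite F4 by (cbn; tauto). exact E2.
  - reflexivity.
  - reflexivity.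
  - reflexivity.
  - unfold rate, Rdiv. rewrite Rmult_1_l. reflexivity.
  - unfold Rdiv. apply Rmult_1_l.
  - rewrite X0 by (cbn; tauto). cbn [ax updN Nat.eqb S1]. rewrite H0. apply (input_c _ _ _ _ _ _ _ HI).
  - exact HI.
Qed.

(** Discharges the side condition of [for_inv] that the invariant ignores the loop counter. *)
Ltac stable :=
  intros ? ? ?;
  first [ intros [?V ?H]; split; [apply env_set_ax; [assumption | lia] | assumption]
        | intros H; exact H ].

Lemma asem_cons (coins : list bool) (c : acmd) (l : list acmd) (S : ast) :
  asem coins (seqs (c :: l)) S = asem coins (seqs l) (asem coins c S).
Proof. reflexivity. Qed.

Lemma asem_nil (coins : list bool) (S : ast) : asem coins (seqs []) S = S.
Proof. reflexivity. Qed.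

Lemma factor_loop_spec (coins : list bool) (n : nat) (w : nat -> R) (c : R) (p : nat -> nat -> R)
    (B : nat -> R) (s e m i : nat) (S : ast) :
  env n w c p B s e m S -> (e <= s)%nat -> (i < n)%nat ->
  ax S xP = (n + 1 + e * (n + 1) + i)%nat -> sr S rA = 1 ->
  sr (asem coins factor_loop S) rA = item_factor n m p e (s - e) i.
Proof.
  intros V He Hi HP HA.
  enough (G : (fun j S' => env n w c p B s e m S'
      /\ ax S' xP = (n + 1 + (e + j) * (n + 1) + i)%nat
      /\ sr S' rA = item_factor n m p e j i) (ax S xH) (asem coins factor_loop S)).
  { rewrite (env_h _ _ _ _ _ _ _ _ _ V) in G. apply G. }
  unfold factor_loop. apply for_inv; [reflexivity|stable| |].
  - split; [exact V|]. split; [|exact HA].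
    cbn [set_ax ax updN Nat.eqb]. rewrite HP. lia.
  - intros j S' Hj _ (V' & P' & A'). rewrite (env_h _ _ _ _ _ _ _ _ _ V) in *.
    split; [apply env_frame; [exact V' | reflexivity]|].
    split.
    + exec. rewrite P', (env_n1 _ _ _ _ _ _ _ _ _ V'). nia.
    + exec. rewrite P', A', (env_eta _ _ _ _ _ _ _ _ _ V'), (env_one _ _ _ _ _ _ _ _ _ V').
      rewrite (input_p _ _ _ _ _ _ _ (env_input _ _ _ _ _ _ _ _ _ V')) by lia.
      reflexivity.
Qed.

Lemma floor_loop_spec (coins : list bool) (x : R) (m : nat) (S : ast) :
  ax S xM = m -> sr S rOne = 1 -> ax S 3 = 1%nat -> sr S rX = x -> ax S xK = 0%nat ->
  0 <= x <= INR m -> ax (asem coins floor_loop S) xK = nfloor x.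
Proof.
  intros HM H1 HO HX HK Hx.
  (* Integer part plus remainder stays x; either every iteration has subtracted, or the remainder is
     below 1. After m subtractions x <= m leaves a remainder of 0. *)
  enough (G : (fun j S' => sr S' rOne = 1 /\ ax S' 3 = 1%nat /\ INR (ax S' xK) + sr S' rX = x
      /\ 0 <= sr S' rX /\ (ax S' xK = j \/ sr S' rX < 1)) (ax S xM) (asem coins floor_loop S)).
  { destruct G as (_ & _ & E & E0 & E1). symmetry. apply nfloor_unique. rewrite <- E. destruct E1 as [E1|E1]; [|lra].
    rewrite E1, HM in *. lra. }
  unfold floor_loop. apply for_inv; [reflexivity|stable| |].
  - cbn [set_ax ax sr updN Nat.eqb]. rewrite HK, HX. cbn [INR]. repeat split; auto; lra.
  - intros j S' Hj _ (O' & X3 & E & E0 & E1). exec. rewrite O'.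
    destruct (Rlt_dec (sr S' rX) 1) as [L|L]; exec.
    + repeat split; auto.
    + destruct E1 as [E1|E1]; [|contradiction].
      rewrite X3, plus_INR. cbn [INR]. repeat split; auto; try lra. left; lia.
Qed.

Lemma item_spec (coins : list bool) (n : nat) (w : nat -> R) (c : R) (p : nat -> nat -> R)
    (B : nat -> R) (s e m i : nat) (S : ast) :
  gkp_valid n w c p B -> (1 <= m)%nat ->
  env n w c p B s e m S -> (e <= s)%nat -> (i < n)%nat -> ax S xI = i ->
  sr (asem coins item S) rA = item_factor n m p e (s - e) i
  /\ ax (asem coins item S) xK = rounded w c m i.
Proof.
  intros Val Hm V He Hi HI. unfold item. exec.
  match goal with |- context[asem coins factor_loop ?T] => set (S1 := T) end.
  assert (V1 : env n w c p B s e m S1).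
  { change S1 with (asem coins (seqs [ins (RConst rA 1); ins (NAdd xP xHB xI)]) S).
    apply env_frame; [exact V | reflexivity]. }
  assert (A1 : sr (asem coins factor_loop S1) rA = item_factor n m p e (s - e) i).
  { apply (factor_loop_spec coins n w c p B); auto. cbn.
    rewrite (env_hb _ _ _ _ _ _ _ _ _ V), HI. reflexivity. }
  assert (V2 : env n w c p B s e m (asem coins factor_loop S1)).
  { apply env_frame; [exact V1 | reflexivity]. }
  assert (I2 : ax (asem coins factor_loop S1) xI = i).
  { rewrite frame_ax by reflexivity. exact HI. }
  set (S2 := asem coins factor_loop S1) in *.
  match goal with |- context[asem coins floor_loop ?T] => set (S3 := T) end.
  split.
  - rewrite frame_sr by reflexivity. unfold S3. cbn [sr updR Nat.eqb]. exact A1.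
  - pose proof Val as (Hc & Hw & _ & _). destruct (Hw i Hi) as [Hw0 Hw1].
    unfold rounded. apply (floor_loop_spec coins _ m); unfold S3;
      cbn [sr ax updR updN Nat.eqb].
    + apply V2.
    + apply V2.
    + apply V2.
    + rewrite I2, (input_w _ _ _ _ _ _ _ (env_input _ _ _ _ _ _ _ _ _ V2)) by exact Hi.
      rewrite (env_c _ _ _ _ _ _ _ _ _ V2), (env_rm _ _ _ _ _ _ _ _ _ V2). reflexivity.
    + reflexivity.
    + assert (1 <= INR m) by (apply (le_INR 1); exact Hm).
      assert (0 <= c * w i) by (apply Rmult_le_pos; assumption). nra.
Qed.

Lemma penalty_loop_spec (coins : list bool) (n : nat) (w : nat -> R) (c : R)
    (p : nat -> nat -> R) (B : nat -> R) (s e m W : nat) (S : ast) :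
  env n w c p B s e m S -> (e <= s)%nat ->
  ax S xP = (n + 1 + e * (n + 1) + n)%nat -> sr S rP = 1 -> sr S rW = INR W * / INR m ->
  sr (asem coins penalty_loop S) rP = weight_factor n m c B e (s - e) W.
Proof.
  intros V He HP HA HW.
  enough (G : (fun j S' => env n w c p B s e m S' /\ sr S' rW = INR W * / INR m
      /\ ax S' xP = (n + 1 + (e + j) * (n + 1) + n)%nat
      /\ sr S' rP = weight_factor n m c B e j W) (ax S xH) (asem coins penalty_loop S)).
  { rewrite (env_h _ _ _ _ _ _ _ _ _ V) in G. apply G. }
  unfold penalty_loop. apply for_inv; [reflexivity|stable| |].
  - split; [exact V|]. split; [exact HW|]. split; [|exact HA].
    cbn [set_ax ax updN Nat.eqb]. rewrite HP. lia.
  - intros j S' Hj _ (V' & W' & P' & A'). rewrite (env_h _ _ _ _ _ _ _ _ _ V) in *.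
    split; [apply env_frame; [exact V' | reflexivity]|].
    exec. rewrite P', A', W', (env_eta _ _ _ _ _ _ _ _ _ V'), (env_one _ _ _ _ _ _ _ _ _ V'),
      (env_zero _ _ _ _ _ _ _ _ _ V'), (env_c _ _ _ _ _ _ _ _ _ V').
    rewrite (input_B _ _ _ _ _ _ _ (env_input _ _ _ _ _ _ _ _ _ V')) by lia.
    change (weight_factor n m c B e (1 + j) W)
      with (weight_factor n m c B e j W * penalty_factor n m c B e j W).
    unfold penalty_factor.
    destruct (Rlt_dec 0 (INR W * / INR m - B (e + j)%nat * c)); exec;
      rewrite P', ?A', ?W', (env_n1 _ _ _ _ _ _ _ _ _ V'); repeat split; try nia; ring.
Qed.

Lemma base_row_spec (coins : list bool) (n : nat) (w : nat -> R) (c : R)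
    (p : nat -> nat -> R) (B : nat -> R) (s e m : nat) (S : ast) :
  env n w c p B s e m S -> (e <= s)%nat ->
  forall W, (W <= n * m)%nat ->
  ar (asem coins base_row S) 1 W = weight_factor n m c B e (s - e) W.
Proof.
  intros V He. unfold base_row. exec.
  match goal with |- context[asem coins base_row_loop ?T] => set (S1 := T) end.
  assert (V1 : env n w c p B s e m S1).
  { change S1 with (asem coins (seqs [ins (NConst xW 0); ins (RConst rW 0)]) S).
    apply env_frame; [exact V | reflexivity]. }
  enough (G : (fun j S' => env n w c p B s e m S' /\ ax S' xW = j
      /\ sr S' rW = INR j * / INR m
      /\ forall W, (W < j)%nat -> ar S' 1 W = weight_factor n m c B e (s - e) W)
      (ax S1 xStr) (asem coins base_row_loop S1)).
  { rewrite (env_str _ _ _ _ _ _ _ _ _ V1) in G. intros W HW. apply G. lia. }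
  unfold base_row_loop. apply for_inv; [reflexivity|stable| |].
  - split; [exact V1|]. cbn. repeat split; [ring|lia].
  - intros j S' Hj _ (V' & X' & W' & A').
    split; [apply env_frame; [exact V' | reflexivity]|].
    exec.
    match goal with |- context[asem coins penalty_loop ?T] => set (S2 := T) end.
    assert (V2 : env n w c p B s e m S2).
    { change S2 with (asem coins (seqs [ins (RConst rP 1); ins (NAdd xP xHB 0)]) S').
      apply env_frame; [exact V' | reflexivity]. }
    assert (P2 := penalty_loop_spec coins n w c p B s e m j S2 V2 He).
    rewrite P2.
    + rewrite (frame_ax coins xW), (frame_sr coins rW), (frame_sr coins rInvM),
        (frame_ax coins 3), (frame_ar coins 1) by reflexivity.
      unfold S2; cbn [ax sr ar updN updR Nat.eqb].
      rewrite X', W', (env_1 _ _ _ _ _ _ _ _ _ V'), (env_invm _ _ _ _ _ _ _ _ _ V').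
      split; [lia|]. split; [rewrite plus_INR; cbn [INR]; ring|].
      intros W HW. unfold updR; destruct (Nat.eqb_spec W j) as [->|]; [reflexivity | apply A'; lia].
    + unfold S2; cbn [ax sr ar updN updR Nat.eqb].
      rewrite (env_hb _ _ _ _ _ _ _ _ _ V'), (env_n _ _ _ _ _ _ _ _ _ V'). reflexivity.
    + reflexivity.
    + exact W'.
Qed.

Lemma row_loop_spec (coins : list bool) (n : nat) (w : nat -> R) (c : R)
    (p : nat -> nat -> R) (B : nat -> R) (s e m r k : nat) (a : R) (S : ast) :
  env n w c p B s e m S -> ax S xR = r -> ax S xR2 = (r + (n * m + 1))%nat ->
  ax S xW = 0%nat -> ax S xK = k -> sr S rA = a ->
  let S' := asem coins row_loop S in
  (forall j, (j < r + (n * m + 1))%nat -> ar S' 1 j = ar S 1 j) /\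
  (forall W, (W + k <= n * m)%nat ->
     ar S' 1 (r + (n * m + 1) + W)%nat = ar S 1 (r + W)%nat + ar S 1 (r + W + k)%nat * a).
Proof.
  intros V HR HR2 HW HK HA S'.
  enough (G : (fun j S' => env n w c p B s e m S' /\ ax S' xW = j
      /\ ax S' xR = r /\ ax S' xR2 = (r + (n * m + 1))%nat /\ ax S' xK = k /\ sr S' rA = a
      /\ (forall j, (j < r + (n * m + 1))%nat -> ar S' 1 j = ar S 1 j)
      /\ (forall W, (W < j)%nat -> (W + k <= n * m)%nat ->
     ar S' 1 (r + (n * m + 1) + W)%nat = ar S 1 (r + W)%nat + ar S 1 (r + W + k)%nat * a))
      (ax S xStr) S').
  { rewrite (env_str _ _ _ _ _ _ _ _ _ V) in G. destruct G as (_ & _ & _ & _ & _ & _ & G1 & G2).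
    split; [exact G1|]. intros W H. apply G2; [nia | exact H]. }
  unfold S', row_loop. apply for_inv; [reflexivity|stable| |].
  - split; [exact V|]. cbn [set_ax ax sr ar updN updR Nat.eqb].
    repeat split; auto. intros; lia.
  - intros j T Hj _ (V' & W' & R' & R2' & K' & A' & G1 & G2).
    split; [apply env_frame; [exact V' | reflexivity]|].
    exec. rewrite W', R', R2', K', A', (env_1 _ _ _ _ _ _ _ _ _ V').
    split; [lia|]. repeat split.
    + intros i Hi. unfold updR; destruct (Nat.eqb_spec i (r + (n * m + 1) + j)); [lia|]. apply G1, Hi.
    + intros W HW0 Hk. unfold updR; destruct (Nat.eqb_spec (r + (n * m + 1) + W) (r + (n * m + 1) + j)) as [E|E].
      * assert (W = j) by lia. subst W. rewrite !G1 by lia. reflexivity.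
      * apply G2; lia.
Qed.

(** Row d belongs to the last d items, so the table is filled from the last item backwards. *)
Definition table_row (n m : nat) (w : nat -> R) (c : R) (p : nat -> nat -> R) (B : nat -> R)
    (e h d W : nat) : R :=
  dp (item_factor n m p e h) (rounded w c m) (weight_factor n m c B e h) d (n - d) W.

(** Row d is claimed correct only for W <= (n - d) m, the weights reachable by the items before n -
    d. This range shrinks by m per row, so W + k_i with k_i <= m lies in the correct part of the row
    before. *)
Lemma rows_step (coins : list bool) (n : nat) (w : nat -> R) (c : R)
    (p : nat -> nat -> R) (B : nat -> R) (s e m j : nat) (T : ast) :
  gkp_valid n w c p B -> (1 <= m)%nat -> (e <= s)%nat -> (j < n)%nat ->
  ax T c1 = (n - j)%nat -> env n w c p B s e m T -> ax T xR = (j * (n * m + 1))%nat ->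
  (forall d W, (d <= j)%nat -> (W <= (n - d) * m)%nat ->
    ar T 1 (d * (n * m + 1) + W)%nat = table_row n m w c p B e (s - e) d W) ->
  let T' := asem coins rows_body T in
  ax T' xR = ((1 + j) * (n * m + 1))%nat /\
  forall d W, (d <= 1 + j)%nat -> (W <= (n - d) * m)%nat ->
    ar T' 1 (d * (n * m + 1) + W)%nat = table_row n m w c p B e (s - e) d W.
Proof.
  intros Val Hm He Hj Hc V' R' G. cbv zeta. unfold rows_body.
  rewrite !asem_cons, asem_nil.
  set (T1 := asem coins (ins (NSub xI c1 3)) T).
  assert (V1 : env n w c p B s e m T1) by (apply env_frame; [exact V' | reflexivity]).
  assert (I1 : ax T1 xI = (n - Datatypes.S j)%nat).
  { unfold T1. exec. rewrite Hc, (env_1 _ _ _ _ _ _ _ _ _ V'). lia. }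
  assert (R1 : ax T1 xR = (j * (n * m + 1))%nat) by exact R'.
  assert (A1 : ar T1 = ar T) by reflexivity.
  clearbody T1.
  destruct (item_spec coins n w c p B s e m (n - Datatypes.S j) T1 Val Hm V1 He ltac:(lia) I1)
    as [A2 K2].
  assert (V2 : env n w c p B s e m (asem coins item T1))
    by (apply env_frame; [exact V1 | reflexivity]).
  assert (R2 : ax (asem coins item T1) xR = (j * (n * m + 1))%nat)
    by (rewrite frame_ax by reflexivity; exact R1).
  assert (AR2 : ar (asem coins item T1) 1 = ar T 1)
    by (rewrite frame_ar by reflexivity; rewrite A1; reflexivity).
  generalize dependent (asem coins item T1); intros T2; intros. clear T1 V1 I1 R1 A1.
  set (T3 := asem coins (ins (NConst xW 0)) (asem coins (ins (NAdd xR2 xR xStr)) T2)).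
  assert (V3 : env n w c p B s e m T3)
    by (do 2 (apply env_frame; [|reflexivity]); exact V2).
  assert (R3 : ax T3 xR = (j * (n * m + 1))%nat) by (unfold T3; exec; exact R2).
  assert (S3 : ax T3 xR2 = (j * (n * m + 1) + (n * m + 1))%nat).
  { unfold T3. exec. rewrite R2, (env_str _ _ _ _ _ _ _ _ _ V2). reflexivity. }
  assert (W3 : ax T3 xW = 0%nat) by (unfold T3; exec; reflexivity).
  assert (K3 : ax T3 xK = rounded w c m (n - Datatypes.S j)) by (unfold T3; exec; exact K2).
  assert (A3 : sr T3 rA = item_factor n m p e (s - e) (n - Datatypes.S j)) by (unfold T3; exec; exact A2).
  assert (AR3 : ar T3 1 = ar T 1) by (unfold T3; exec; exact AR2).
  clearbody T3. clear T2 V2 R2 AR2 A2 K2.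
  destruct (row_loop_spec coins n w c p B s e m (j * (n * m + 1)) (rounded w c m (n - Datatypes.S j))
    (item_factor n m p e (s - e) (n - Datatypes.S j)) T3 V3 R3 S3 W3 K3 A3) as [P1 P2].
  rewrite AR3 in P1, P2.
  assert (R4 : ax (asem coins row_loop T3) xR2 = (j * (n * m + 1) + (n * m + 1))%nat)
    by (rewrite frame_ax by reflexivity; exact S3).
  assert (Z4 : ax (asem coins row_loop T3) 2 = 0%nat)
    by (rewrite frame_ax by reflexivity; apply V3).
  generalize dependent (asem coins row_loop T3); intros T4; intros.
  exec. rewrite R4, Z4, Nat.add_0_r. split; [symmetry; apply Nat.mul_succ_l|].
  intros d W Hd HW.
  assert (Dd : (d <= j)%nat \/ d = Datatypes.S j) by lia. destruct Dd as [Dd|Dd].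
  + rewrite P1; [apply G; assumption|].
    assert ((n - d) * m <= n * m)%nat by (apply Nat.mul_le_mono_r; lia).
    assert (d * (n * m + 1) <= j * (n * m + 1))%nat by (apply Nat.mul_le_mono_r; lia). lia.
  + subst d.
    destruct (rounded_spec n w c p B m (n - Datatypes.S j) Val Hm ltac:(lia)) as [Hk _].
    set (k := rounded w c m (n - Datatypes.S j)) in *.
    assert (Hs : ((n - j) * m = (n - Datatypes.S j) * m + m)%nat).
    { replace (n - j)%nat with (Datatypes.S (n - Datatypes.S j)) by lia.
      rewrite Nat.mul_succ_l. reflexivity. }
    assert ((n - j) * m <= n * m)%nat by (apply Nat.mul_le_mono_r; lia).
    rewrite Nat.mul_succ_l.
    rewrite P2 by lia. rewrite <- Nat.add_assoc.
    rewrite !G by lia. unfold table_row. cbn [dp].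
    replace (Datatypes.S (n - Datatypes.S j)) with (n - j)%nat by lia. reflexivity.
Qed.

Lemma rows_spec (coins : list bool) (n : nat) (w : nat -> R) (c : R)
    (p : nat -> nat -> R) (B : nat -> R) (s e m : nat) (S : ast) :
  gkp_valid n w c p B -> (1 <= m)%nat ->
  env n w c p B s e m S -> (e <= s)%nat -> ax S xR = 0%nat ->
  (forall W, (W <= n * m)%nat -> ar S 1 W = weight_factor n m c B e (s - e) W) ->
  let S' := asem coins rows_loop S in
  ax S' xR = (n * (n * m + 1))%nat /\
  forall d W, (d <= n)%nat -> (W <= (n - d) * m)%nat ->
    ar S' 1 (d * (n * m + 1) + W)%nat = table_row n m w c p B e (s - e) d W.
Proof.
  intros Val Hm V He HR HB S'.
  enough (G : (fun j S' => env n w c p B s e m S' /\ ax S' xR = (j * (n * m + 1))%nat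
      /\ forall d W, (d <= j)%nat -> (W <= (n - d) * m)%nat ->
        ar S' 1 (d * (n * m + 1) + W)%nat = table_row n m w c p B e (s - e) d W)
      (ax S 0%nat) S').
  { rewrite (env_n _ _ _ _ _ _ _ _ _ V) in G. apply G. }
  unfold S', rows_loop. apply for_inv; [reflexivity|stable| |].
  - split; [exact V|]. cbn [set_ax ax sr ar updN updR Nat.eqb].
    split; [exact HR|]. intros d W Hd HW. replace d with 0%nat in * by lia.
    rewrite HB; [reflexivity|]. rewrite Nat.sub_0_r in HW. exact HW.
  - intros j T Hj Hc (V' & R' & G). rewrite (env_n _ _ _ _ _ _ _ _ _ V) in *.
    split; [apply env_frame; [exact V' | reflexivity]|].
    exact (rows_step coins n w c p B s e m j T Val Hm He Hj Hc V' R' G).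
Qed.

(** Invariant: flipping the initial probability on all its coins equals flipping the current value
    of [rQ] on the coins not yet read. *)
Lemma coin_loop_spec (coins : list bool) (s : nat) (S : ast) :
  ax S 1 = s ->
  let S' := asem coins coin_loop S in
  ac S' = (ac S + s)%nat /\
  flip s (sr S rQ) (skipn (ac S) coins) = (if Rlt_dec 0 (sr S' rQ) then true else false).
Proof.
  intros Hs S'.
  enough (G : (fun j S' => ax S' 1 = s /\ ac S' = (ac S + j)%nat
     /\ flip s (sr S rQ) (skipn (ac S) coins)
        = flip (s - j) (sr S' rQ) (skipn (ac S + j) coins)) (ax S 1) S').
  { rewrite Hs in G. destruct G as (_ & G1 & G2). split; [exact G1|]. rewrite G2, Nat.sub_diag. reflexivity. }
  unfold S', coin_loop. apply for_inv; [reflexivity|stable| |].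
  - rewrite Nat.sub_0_r, Nat.add_0_r. auto.
  - intros j T Hj _ (E1 & E2 & E3). exec. split; [exact E1|]. split; [lia|].
    rewrite E3, E2. replace (s - j)%nat with (Datatypes.S (s - (1 + j))) by lia.
    cbn [flip].
    (* Past the end of the list, the [nth] of the machine and [hd false] both give [false]. *)
    assert (N : forall (l : list bool) k, hd false (skipn k l) = nth k l false
                /\ tl (skipn k l) = skipn (Datatypes.S k) l).
    { clear. induction l as [|x l IH]; intros [|k]; cbn; auto. }
    destruct (N coins (ac S + j)%nat) as [-> ->].
    replace (Datatypes.S (ac S + j)) with (ac S + (1 + j))%nat by lia. reflexivity.
Qed.

(** Invariant: the abstract sample is the list of bits drawn so far, followed by a sample started
    from the current item, weight and coin position. *)
Lemma draw_step (coins : list bool) (n : nat) (w : nat -> R) (c : R)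
    (p : nat -> nat -> R) (B : nat -> R) (s e m j : nat) (T : ast) (arT : nat -> R)
    (smp := sample (item_factor n m p e (s - e)) (rounded w c m) (weight_factor n m c B e (s - e)) s) :
  gkp_valid n w c p B -> (1 <= m)%nat -> (e <= s)%nat -> (j < n)%nat ->
  ax T c1 = (n - j)%nat -> env n w c p B s e m T ->
  ax T xR = ((n - j) * (n * m + 1))%nat -> ac T = (j * s)%nat -> ar T 1 = arT ->
  (forall d W, (d <= n)%nat -> (W <= (n - d) * m)%nat ->
    arT (d * (n * m + 1) + W)%nat = table_row n m w c p B e (s - e) d W) ->
  (ax T xW <= j * m)%nat ->
  (exists l, length l = j
     /\ smp n 0%nat 0%nat coins = l ++ smp (n - j)%nat j (ax T xW) (skipn (j * s) coins)
     /\ forall i, (i < j)%nat -> ar T 2 i = if nth i l false then 1 else 0) ->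
  let T' := asem coins draw_body T in
  ax T' xR = ((n - (1 + j)) * (n * m + 1))%nat /\ ac T' = ((1 + j) * s)%nat /\ ar T' 1 = arT /\
  (ax T' xW <= (1 + j) * m)%nat /\
  exists l, length l = (1 + j)%nat
     /\ smp n 0%nat 0%nat coins
        = l ++ smp (n - (1 + j))%nat (1 + j)%nat (ax T' xW) (skipn ((1 + j) * s) coins)
     /\ forall i, (i < 1 + j)%nat -> ar T' 2 i = if nth i l false then 1 else 0.
Proof.
  intros Val Hm He Hj Hc V' R' C' A' HT W' (l & L1 & L2 & L3). cbv zeta. unfold draw_body.
  rewrite !asem_cons, asem_nil.
  set (T1 := asem coins (ins (NSub xI 0 c1)) T).
  assert (V1 : env n w c p B s e m T1) by (apply env_frame; [exact V' | reflexivity]).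
  assert (I1 : ax T1 xI = j).
  { unfold T1. exec. rewrite Hc, (env_n _ _ _ _ _ _ _ _ _ V'). lia. }
  assert (F1 : ax T1 xR = ax T xR /\ ax T1 xW = ax T xW /\ ar T1 = ar T /\ ac T1 = ac T)
    by (repeat split).
  destruct F1 as (R1 & W1 & AR1 & C1). clearbody T1.
  destruct (item_spec coins n w c p B s e m j T1 Val Hm V1 He ltac:(lia) I1) as [A2 K2].
  assert (V2 : env n w c p B s e m (asem coins item T1))
    by (apply env_frame; [exact V1 | reflexivity]).
  assert (R2 : ax (asem coins item T1) xR = ((n - j) * (n * m + 1))%nat)
    by (rewrite frame_ax by reflexivity; rewrite R1; exact R').
  assert (AR2 : ar (asem coins item T1) 1 = arT)
    by (rewrite frame_ar by reflexivity; rewrite AR1; exact A').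
  assert (AB2 : ar (asem coins item T1) 2 = ar T 2)
    by (rewrite frame_ar by reflexivity; rewrite AR1; reflexivity).
  assert (W2 : ax (asem coins item T1) xW = ax T xW)
    by (rewrite frame_ax by reflexivity; exact W1).
  assert (I2 : ax (asem coins item T1) xI = j) by (rewrite frame_ax by reflexivity; exact I1).
  assert (C2 : ac (asem coins item T1) = (j * s)%nat)
    by (rewrite frame_ac by reflexivity; rewrite C1; exact C').
  generalize dependent (asem coins item T1); intros T2; intros. clear T1 V1 I1 R1 W1 AR1 C1.
  match goal with |- context[asem coins coin_loop ?U] => set (T3 := U) end.
  destruct (rounded_spec n w c p B m j Val Hm Hj) as [Hk _].
  set (k := rounded w c m j) in *. set (W := ax T xW) in *.
  assert (Q3 : sr T3 rQ = dp_ratio (item_factor n m p e (s - e)) (rounded w c m)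
                (weight_factor n m c B e (s - e)) (n - Datatypes.S j) j W).
  { unfold T3. exec.
    rewrite R2, (env_str _ _ _ _ _ _ _ _ _ V2), W2, K2, A2, AR2, safe_div_eq.
    replace ((n - j) * (n * m + 1) - (n * m + 1))%nat
      with ((n - Datatypes.S j) * (n * m + 1))%nat
      by (replace (n - j)%nat with (Datatypes.S (n - Datatypes.S j)) by lia;
          rewrite Nat.mul_succ_l, Nat.add_sub; reflexivity).
    assert (Eb : (n - (n - Datatypes.S j) = Datatypes.S j)%nat) by lia.
    rewrite <- Nat.add_assoc.
    rewrite !HT by (rewrite ?Eb; cbn [Nat.mul]; lia).
    unfold table_row. rewrite Eb. reflexivity. }
  destruct (coin_loop_spec coins s T3) as [C4 F4]; [apply V2|].
  rewrite Q3 in F4.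
  change (ac T3) with (ac T2) in C4, F4.
  rewrite C2 in C4, F4.
  assert (X4 : forall a, In a [2;xI;xW;xK;xR2]%nat -> ax (asem coins coin_loop T3) a = ax T3 a).
  { intros a Ha; cbn in Ha. apply frame_ax.
    repeat destruct Ha as [<-|Ha]; try contradiction; reflexivity. }
  assert (Y4 : forall t, In t [1;2]%nat -> ar (asem coins coin_loop T3) t = ar T2 t).
  { intros t Ht; cbn in Ht.
    repeat destruct Ht as [<-|Ht]; try contradiction; rewrite frame_ar; reflexivity. }
  assert (Z4 : sr (asem coins coin_loop T3) rZero = 0).
  { rewrite frame_sr by reflexivity. unfold T3; exec. apply V2. }
  assert (O4 : sr (asem coins coin_loop T3) rOne = 1).
  { rewrite frame_sr by reflexivity. unfold T3; exec. apply V2. }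
  revert C4 F4 X4 Y4 Z4 O4. generalize (asem coins coin_loop T3). intros T4 C4 F4 X4 Y4 Z4 O4.
  assert (X42 : ax T4 2 = 0%nat) by (rewrite X4 by (cbn; tauto); apply V2).
  assert (X4I : ax T4 xI = j) by (rewrite X4 by (cbn; tauto); exact I2).
  assert (X4W : ax T4 xW = W) by (rewrite X4 by (cbn; tauto); exact W2).
  assert (X4K : ax T4 xK = k) by (rewrite X4 by (cbn; tauto); exact K2).
  assert (X4R : ax T4 xR2 = ((n - (1 + j)) * (n * m + 1))%nat).
  { rewrite X4 by (cbn; tauto). unfold T3; exec.
    rewrite R2, (env_str _ _ _ _ _ _ _ _ _ V2).
    replace (n - j)%nat with (Datatypes.S (n - (1 + j))) by lia.
    rewrite Nat.mul_succ_l, Nat.add_sub; lia. }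
  assert (Y41 : ar T4 1 = arT) by (rewrite Y4 by (cbn; tauto); exact AR2).
  assert (Y42 : ar T4 2 = ar T 2) by (rewrite Y4 by (cbn; tauto); exact AB2).
  clear Y4 Q3.
  assert (L4 : smp (n - j)%nat j W (skipn (j * s) coins)
    = (if Rlt_dec 0 (sr T4 rQ)
      then true :: smp (n - (1 + j))%nat (1 + j)%nat (W + k)%nat (skipn ((1 + j) * s) coins)
      else false :: smp (n - (1 + j))%nat (1 + j)%nat W (skipn ((1 + j) * s) coins))).
  { replace (n - j)%nat with (Datatypes.S (n - Datatypes.S j)) by lia.
    unfold smp. cbn [sample]. rewrite F4, skipn_skipn.
    replace (s + j * s)%nat with ((1 + j) * s)%nat by lia.
    destruct (Rlt_dec 0 (sr T4 rQ)); reflexivity. }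
  rewrite L4 in L2.
  exec. rewrite Z4. destruct (Rlt_dec 0 (sr T4 rQ)) as [Hq|Hq]; exec;
    rewrite ?X42, ?X4I, ?X4W, ?X4K, ?X4R, ?Y41, ?Y42, ?O4, ?Z4.
  + split; [lia|]. split; [rewrite C4; lia|]. split; [reflexivity|]. split; [lia|].
    exists (l ++ [true]). rewrite length_app, <- app_assoc. cbn [length app].
    split; [lia|]. split; [exact L2|].
    intros i Hi. unfold updR; destruct (Nat.eqb_spec i j) as [->|Hn].
    * rewrite app_nth2 by lia. rewrite L1, Nat.sub_diag. reflexivity.
    * rewrite app_nth1 by lia. apply L3; lia.
  + split; [lia|]. split; [rewrite C4; lia|]. split; [reflexivity|]. split; [lia|].
    exists (l ++ [false]). rewrite length_app, <- app_assoc. cbn [length app].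
    split; [lia|]. split; [exact L2|].
    intros i Hi. unfold updR; destruct (Nat.eqb_spec i j) as [->|Hn].
    * rewrite app_nth2 by lia. rewrite L1, Nat.sub_diag. reflexivity.
    * rewrite app_nth1 by lia. apply L3; lia.
Qed.

Lemma draw_spec (coins : list bool) (n : nat) (w : nat -> R) (c : R)
    (p : nat -> nat -> R) (B : nat -> R) (s e m : nat) (S : ast) :
  gkp_valid n w c p B -> (1 <= m)%nat ->
  env n w c p B s e m S -> (e <= s)%nat -> ax S xR = (n * (n * m + 1))%nat ->
  ax S xW = 0%nat -> ac S = 0%nat ->
  (forall d W, (d <= n)%nat -> (W <= (n - d) * m)%nat ->
    ar S 1 (d * (n * m + 1) + W)%nat = table_row n m w c p B e (s - e) d W) ->
  forall i, (i < n)%nat ->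
    ar (asem coins draw_loop S) 2 i
    = if nth i (drawn_set n m w c p B e (s - e) s coins) false then 1 else 0.
Proof.
  intros Val Hm V He HR HW HC HT.
  set (smp := sample (item_factor n m p e (s - e)) (rounded w c m) (weight_factor n m c B e (s - e)) s).
  enough (G : (fun j S' => env n w c p B s e m S' /\ ax S' xR = ((n - j) * (n * m + 1))%nat
      /\ ac S' = (j * s)%nat /\ ar S' 1 = ar S 1
      /\ (ax S' xW <= j * m)%nat
      /\ exists l, length l = j
         /\ smp n 0%nat 0%nat coins = l ++ smp (n - j)%nat j (ax S' xW) (skipn (j * s) coins)
         /\ forall i, (i < j)%nat -> ar S' 2 i = if nth i l false then 1 else 0)
      (ax S 0%nat) (asem coins draw_loop S)).
  { rewrite (env_n _ _ _ _ _ _ _ _ _ V) in G.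
    destruct G as (_ & _ & _ & _ & _ & l & L1 & L2 & L3). intros i Hi.
    unfold drawn_set. fold smp. rewrite L2, Nat.sub_diag. cbn [sample smp].
    rewrite app_nil_r. apply L3, Hi. }
  unfold draw_loop. apply for_inv; [reflexivity|stable| |].
  - split; [exact V|]. cbn [set_ax ax sr ar ac updN updR Nat.eqb].
    rewrite Nat.sub_0_r, HW. repeat split; auto. exists []. repeat split; auto. intros; lia.
  - intros j T Hj Hc (V' & R' & C' & A' & W' & L).
    rewrite (env_n _ _ _ _ _ _ _ _ _ V) in *.
    split; [apply env_frame; [exact V' | reflexivity]|].
    exact (draw_step coins n w c p B s e m j T _ Val Hm He Hj Hc V' R' C' A' HT W' L).
Qed.

Lemma main_phase_spec (coins : list bool) (n : nat) (w : nat -> R) (c : R)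
    (p : nat -> nat -> R) (B : nat -> R) (s e m : nat) (S : ast) :
  gkp_valid n w c p B -> (1 <= m)%nat ->
  env n w c p B s e m S -> (e <= s)%nat -> ac S = 0%nat ->
  forall i, (i < n)%nat ->
    ar (asem coins main_phase S) 2 i
    = if nth i (drawn_set n m w c p B e (s - e) s coins) false then 1 else 0.
Proof.
  intros Val Hm V He HC. unfold main_phase. exec.
  pose proof (base_row_spec coins n w c p B s e m S V He) as H1.
  assert (V1 : env n w c p B s e m (asem coins base_row S))
    by (apply env_frame; [exact V | reflexivity]).
  assert (C1 : ac (asem coins base_row S) = 0%nat) by (rewrite frame_ac by reflexivity; exact HC).
  set (S1 := asem coins base_row S) in *. clearbody S1.
  match goal with |- context[asem coins rows_loop ?T] => set (S2 := T) end.
  assert (V2 : env n w c p B s e m S2).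
  { change S2 with (asem coins (seqs [ins (NConst xR 0)]) S1).
    apply env_frame; [exact V1 | reflexivity]. }
  destruct (rows_spec coins n w c p B s e m S2 Val Hm V2 He eq_refl H1) as [R3 H3].
  assert (V3 : env n w c p B s e m (asem coins rows_loop S2))
    by (apply env_frame; [exact V2 | reflexivity]).
  assert (C3 : ac (asem coins rows_loop S2) = 0%nat) by (rewrite frame_ac by reflexivity; exact C1).
  set (S3 := asem coins rows_loop S2) in *. clearbody S3.
  match goal with |- context[asem coins draw_loop ?T] => set (S4 := T) end.
  apply draw_spec; auto.
  change S4 with (asem coins (seqs [ins (NConst xW 0)]) S3).
  apply env_frame; [exact V3 | reflexivity].
Qed.

(** * Input, output and running time *)

(** Counterpart of [for_inv] below the array layer, for the code that moves raw memory before and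
    after the main phase. *)
Lemma sem_for_inv (coins : list bool) (a b : nat) (c : cmd) (m : mem) (I : nat -> mem -> Prop) :
  wf (For a b c) = true -> mx m 2 = 0%nat -> mx m 3 = 1%nat ->
  (forall j v T, I j T -> I j (Mem (mr T) (updN (mx T) a v) (mc T))) ->
  I 0%nat m ->
  (forall j T, (j < mx m b)%nat -> mx T a = (mx m b - j)%nat -> mx T 2 = 0%nat ->
     mx T 3 = 1%nat -> I j T -> I (1 + j)%nat (sem coins c T)) ->
  I (mx m b) (sem coins (For a b c) m).
Proof.
  intros W H2 H3 Hst H0 HS. cbn [wf] in W.
  apply andb_prop in W as [W Wa3]; apply andb_prop in W as [W Wa2];
    apply andb_prop in W as [W Wa].
  apply negb_true_iff in Wa, Wa2, Wa3.
  destruct (wf_writes _ W) as [N2 N3].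
  apply Nat.eqb_neq in Wa2, Wa3.
  cbn [sem].
  apply (iter_inv _ (fun j T => mx T a = (mx m b - j)%nat /\ mx T 2 = 0%nat
            /\ mx T 3 = 1%nat /\ I j T)).
  - cbn [prim step at_pc nth_error mr mx mc rr xr ncoins pc].
    rewrite updN_same, !updN_other by lia. repeat split; try lia. apply Hst, H0.
  - intros j T Hj (E & E2 & E3 & HT).
    assert (G := HS j T Hj E E2 E3 HT).
    assert (F2 := sem_nowrite coins c 2 T N2). assert (F3 := sem_nowrite coins c 3 T N3).
    assert (Fa := sem_nowrite coins c a T Wa).
    revert G F2 F3 Fa. generalize (sem coins c T). intros T' G F2 F3 Fa.
    cbn [prim step at_pc nth_error mr mx mc rr xr ncoins pc].
    rewrite updN_same, !updN_other by lia. repeat split; try lia; try congruence. apply Hst, G.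
Qed.

Fixpoint cseq (l : list cmd) : cmd :=
  match l with [] => Skip | c :: l => Seq c (cseq l) end.

Lemma sem_cseq_cons (coins : list bool) (c : cmd) (l : list cmd) (m : mem) :
  sem coins (cseq (c :: l)) m = sem coins (cseq l) (sem coins c m).
Proof. reflexivity. Qed.

Lemma sem_cseq_nil (coins : list bool) (m : mem) : sem coins (cseq []) m = m.
Proof. reflexivity. Qed.

Lemma cost_cseq_cons (coins : list bool) (c : cmd) (l : list cmd) (m : mem) :
  cost coins (cseq (c :: l)) m = (cost coins c m + cost coins (cseq l) (sem coins c m))%nat.
Proof. reflexivity. Qed.

Lemma cost_cseq_nil (coins : list bool) (m : mem) : cost coins (cseq []) m = 0%nat.
Proof. reflexivity. Qed.

(* Array 0 receives the input; [r[0]], needed as a buffer, is saved at its end. *)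
Definition input_size_init : cmd :=
  cseq [Prim (NAdd 7 0 3); Prim (NAdd 8 1 3); Prim (NConst 6 0)].
Definition input_size_loop : cmd := For 20 8 (Prim (NAdd 6 6 7)).
Definition relocate_init : cmd :=
  cseq [addr 0 6; Prim (RStoreI 4 0); Prim (NSub 9 6 3)].
(** The counter descends and 16 + 4 j > j, so a store never hits an entry that is still to be
    read. *)
Definition relocate_loop : cmd :=
  For 20 9 (cseq [Prim (RLoadI 0 20); addr 0 20; Prim (RStoreI 4 0)]).
Definition relocate_end : cmd :=
  cseq [addr 0 6; Prim (RLoadI 0 4); Prim (NConst 4 16); Prim (RStoreI 4 0)].

(** Register 0 is the buffer here too, so output 0 is written last. Its source at address 18 could
    by then be overwritten by output 18 and is therefore saved behind the last entry. The loop
    ascends, so the sources still unread lie above every target. *)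
Definition output_init : cmd :=
  cseq [Prim (NConst 4 18); Prim (RLoadI 0 4); addr 2 0; Prim (RStoreI 4 0);
        Prim (NSub 9 0 3); Prim (NConst 8 0)].
Definition output_loop : cmd :=
  For 20 9 (cseq [Prim (NAdd 8 8 3); addr 2 8; Prim (RLoadI 0 4); Prim (RStoreI 8 0)]).
Definition output_end : cmd := cseq [addr 2 0; Prim (RLoadI 0 4)].

Definition algorithm : cmd :=
  cseq [input_size_init; input_size_loop; relocate_init; relocate_loop; relocate_end;
        tr find_epoch; tr constants; tr main_phase; output_init; output_loop; output_end].

(** The leading instruction supplies the constant 1; x[2] = 0 holds in the initial state. *)
Definition gkp_program : program := NConst 3 1 :: compile 1 algorithm.

Ltac rexec :=
  cbn [cseq addr sem prim step at_pc nth_error mr mx mc rr xr ncoins pc updN Nat.eqb].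

Lemma input_size_spec (coins : list bool) (n s : nat) (m : mem) :
  mx m 0 = n -> mx m 1 = s -> mx m 2 = 0%nat -> mx m 3 = 1%nat ->
  let m' := sem coins input_size_loop (sem coins input_size_init m) in
  mr m' = mr m /\ mc m' = mc m /\ mx m' 6 = ((n + 1) * (s + 1))%nat.
Proof.
  intros H0 H1 H2 H3 m'.
  set (m0 := sem coins input_size_init m) in *.
  enough (G : (fun j T => mr T = mr m /\ mc T = mc m /\ mx T 7 = (n + 1)%nat
     /\ mx T 6 = ((n + 1) * j)%nat) (mx m0 8%nat) m').
  { unfold m0 in G; unfold input_size_init in G; revert G; rexec. rewrite H1, H3. tauto. }
  unfold m', input_size_loop. apply sem_for_inv; try reflexivity.
  - unfold m0, input_size_init; rexec. exact H2.
  - unfold m0, input_size_init; rexec. exact H3.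
  - intros j v T H. exact H.
  - unfold m0, input_size_init; rexec. rewrite H0, H3. repeat split; lia.
  - intros j T _ _ _ _ (E1 & E2 & E3 & E4). rexec.
    repeat split; try assumption. rewrite E3, E4. lia.
Qed.

Lemma relocate_spec (coins : list bool) (N : nat) (m : mem) :
  mx m 6 = N -> (1 <= N)%nat -> mx m 2 = 0%nat -> mx m 3 = 1%nat ->
  let m' := sem coins relocate_end (sem coins relocate_loop (sem coins relocate_init m)) in
  mc m' = mc m /\ forall j, (j < N)%nat -> mr m' (16 + 4 * j)%nat = mr m j.
Proof.
  intros H6 HN H2 H3.
  set (m0 := sem coins relocate_init m).
  assert (X0 : mx m0 2 = 0%nat /\ mx m0 3 = 1%nat /\ mx m0 6 = N /\ mx m0 9 = (N - 1)%nat
     /\ mc m0 = mc m /\ mr m0 (16 + 4 * N)%nat = mr m 0%nat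
     /\ (forall i, (i < N)%nat -> mr m0 i = mr m i)).
  { unfold m0, relocate_init; rexec. rewrite H6, H3.
    replace (N + N + (N + N) + (16 + 0))%nat with (16 + 4 * N)%nat by lia.
    repeat split; auto; [apply updR_same|]. intros i Hi. apply updR_other. lia. }
  clearbody m0. destruct X0 as (Y2 & Y3 & Y6 & Y9 & Yc & Y0 & Yi).
  assert (G : (fun j T => mc T = mc m /\ mx T 6 = N /\ mr T (16 + 4 * N)%nat = mr m 0%nat
     /\ (forall i, (1 <= i)%nat -> (i + j < N)%nat -> mr T i = mr m i)
     /\ (forall i, (N <= i + j)%nat -> (i < N)%nat -> mr T (16 + 4 * i)%nat = mr m i))
     (mx m0 9%nat) (sem coins relocate_loop m0)).
  { unfold relocate_loop. apply sem_for_inv; try reflexivity; try assumption.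
    - intros j v T H. exact H.
    - repeat split; try assumption; intros; [apply Yi; lia | lia].
    - rewrite Y9. intros j T Hj Hc T2 T3 (E1 & E2 & E3 & E4 & E5). rexec. rewrite Hc.
      set (q := (N - 1 - j)%nat).
      replace (q + q + (q + q) + (16 + 0))%nat with (16 + 4 * q)%nat by lia.
      rewrite updR_same. split; [exact E1|]. split; [exact E2|]. split; [|split].
      + rewrite !updR_other by lia. exact E3.
      + intros i Hi1 Hi2. rewrite !updR_other by lia. apply E4; lia.
      + intros i Hi1 Hi2. destruct (Nat.eq_dec i q) as [->|Hn].
        * rewrite updR_same. apply E4; lia.
        * rewrite !updR_other by lia. apply E5; lia. }
  rewrite Y9 in G. cbv zeta. revert G. generalize (sem coins relocate_loop m0).
  intros T (E1 & E2 & E3 & E4 & E5). unfold relocate_end; rexec. rewrite E2.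
  replace (N + N + (N + N) + (16 + 0))%nat with (16 + 4 * N)%nat by lia.
  rewrite updR_same. split; [exact E1|].
  intros j Hj. destruct j as [|j].
  - rewrite updR_same. exact E3.
  - rewrite !updR_other by lia. apply E5; lia.
Qed.

Lemma output_spec (coins : list bool) (n : nat) (m : mem) :
  mx m 0 = n -> mx m 2 = 0%nat -> mx m 3 = 1%nat ->
  let m' := sem coins output_end (sem coins output_loop (sem coins output_init m)) in
  forall i, (i < n)%nat -> mr m' i = mr m (16 + 4 * i + 2)%nat.
Proof.
  intros H0 H2 H3.
  set (m0 := sem coins output_init m).
  assert (X0 : mx m0 2 = 0%nat /\ mx m0 3 = 1%nat /\ mx m0 0 = n /\ mx m0 9 = (n - 1)%nat
     /\ mx m0 8 = 0%nat /\ mr m0 (16 + 4 * n + 2)%nat = mr m 18%nat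
     /\ (forall i, (1 <= i < n)%nat -> mr m0 (16 + 4 * i + 2)%nat = mr m (16 + 4 * i + 2)%nat)).
  { unfold m0, output_init; rexec. rewrite H0, H3.
    replace (n + n + (n + n) + (16 + 2))%nat with (16 + 4 * n + 2)%nat by lia.
    rewrite !updR_same. repeat split; auto. intros i Hi. rewrite !updR_other by lia. reflexivity. }
  clearbody m0. destruct X0 as (Y2 & Y3 & Yn & Y9 & Y8 & Y0 & Yi).
  assert (G : (fun j T => mx T 0 = n /\ mx T 8 = j /\ mr T (16 + 4 * n + 2)%nat = mr m 18%nat
     /\ (forall i, (1 <= i <= j)%nat -> mr T i = mr m (16 + 4 * i + 2)%nat)
     /\ (forall i, (j < i < n)%nat -> mr T (16 + 4 * i + 2)%nat = mr m (16 + 4 * i + 2)%nat))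
     (mx m0 9%nat) (sem coins output_loop m0)).
  { unfold output_loop. apply sem_for_inv; try reflexivity; try assumption.
    - intros j v T H. exact H.
    - repeat split; try assumption; intros; lia.
    - rewrite Y9. intros j T Hj Hc T2 T3 (E1 & E2 & E3 & E4 & E5). rexec. rewrite E2, T3.
      replace (j + 1 + (j + 1) + (j + 1 + (j + 1)) + (16 + 2))%nat
        with (16 + 4 * (j + 1) + 2)%nat by lia.
      rewrite updR_same. split; [exact E1|]. split; [lia|]. split; [|split].
      + rewrite !updR_other by lia. exact E3.
      + intros i Hi. destruct (Nat.eq_dec i (j + 1)) as [->|Hn].
        * rewrite updR_same. apply E5; lia.
        * rewrite !updR_other by lia. apply E4; lia.
      + intros i Hi. rewrite !updR_other by lia. apply E5; lia. }
  rewrite Y9 in G. cbv zeta. revert G. generalize (sem coins output_loop m0).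
  intros T (E1 & E2 & E3 & E4 & E5). unfold output_end; rexec. rewrite E1.
  replace (n + n + (n + n) + (16 + 2))%nat with (16 + 4 * n + 2)%nat by lia.
  intros i Hi. destruct i as [|i].
  - rewrite updR_same. exact E3.
  - rewrite updR_other by lia. apply E4; lia.
Qed.

Definition abs (m : mem) : ast :=
  Ast (mr m) (fun t j => mr m (16 + 4 * j + t)%nat) (mx m) (mc m).

Lemma view_abs (m : mem) : mx m 2 = 0%nat -> mx m 3 = 1%nat -> view m (abs m).
Proof. intros H2 H3; split; try reflexivity; assumption. Qed.

Lemma init_input (n : nat) (w : nat -> R) (c : R) (p : nat -> nat -> R) (B : nat -> R) (s : nat)
    (a : nat -> R) :
  (forall j, (j < (n + 1) * (s + 1))%nat -> a j = rr (init_state n w c p B s) j) ->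
  input n w c p B s a.
Proof.
  intros H. unfold init_state in H; cbn [rr] in H.
  assert (Hd : forall q i, (i <= n)%nat ->
     ((n + 1 + q * (n + 1) + i - Datatypes.S n) / Datatypes.S n = q
      /\ (n + 1 + q * (n + 1) + i - Datatypes.S n) mod Datatypes.S n = i)%nat).
  { intros q i Hi. replace (n + 1 + q * (n + 1) + i - Datatypes.S n)%nat
      with (i + q * Datatypes.S n)%nat by lia.
    rewrite Nat.div_add, Nat.div_small, Nat.Div0.mod_add, Nat.mod_small by lia. lia. }
  split.
  - intros i Hi. rewrite H by nia. apply Nat.ltb_lt in Hi; rewrite Hi. reflexivity.
  - rewrite H by nia. rewrite Nat.ltb_irrefl, Nat.eqb_refl. reflexivity.
  - intros q i Hq Hi. rewrite H by nia.
    destruct (Hd q i ltac:(lia)) as [-> ->].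
    destruct (Nat.ltb_spec (n + 1 + q * (n + 1) + i) n); [lia|].
    destruct (Nat.eqb_spec (n + 1 + q * (n + 1) + i) n); [lia|].
    apply Nat.ltb_lt in Hq, Hi. rewrite Hq, Hi. reflexivity.
  - intros q Hq. rewrite H by nia.
    destruct (Hd q n ltac:(lia)) as [-> ->].
    destruct (Nat.ltb_spec (n + 1 + q * (n + 1) + n) n); [lia|].
    destruct (Nat.eqb_spec (n + 1 + q * (n + 1) + n) n); [lia|].
    apply Nat.ltb_lt in Hq. rewrite Hq, Nat.ltb_irrefl. reflexivity.
Qed.

(** * The complete run and its length *)

Lemma algorithm_wf : wf algorithm = true.
Proof. vm_compute. reflexivity. Qed.

Lemma gkp_program_halts (coins : list bool) (s0 : mstate) (m0 : mem) (fuel : nat) :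
  step gkp_program coins s0 = Some (at_pc 1 m0) -> mx m0 2 = 0%nat -> mx m0 3 = 1%nat ->
  (1 + cost coins algorithm m0 < fuel)%nat ->
  run gkp_program coins fuel s0 = Some (at_pc (1 + csize algorithm) (sem coins algorithm m0)).
Proof.
  intros Step0 X2 X3 Hf. eapply reach_run; [|  | exact Hf].
  - eapply reachS; [exact Step0|].
    apply compile_correct; [exact algorithm_wf | | exact X2 | exact X3].
    intros i Hi. reflexivity.
  - assert (H : nth_error gkp_program (1 + csize algorithm) = None).
    { apply nth_error_None. unfold gkp_program. cbn [length]. rewrite csize_compile. lia. }
    unfold step, at_pc; cbn [pc]. rewrite H. reflexivity.
Qed.

Definition unwritten_sources (c : cmd) : bool :=
  forallb (fun b => negb (writes b c)) (sources c).

(** Applied phase by phase: a phase may compute the loop bounds of later phases, but not its own. *)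
Lemma phase_cost (coins : list bool) (N : nat) (c : cmd) (m : mem) :
  unwritten_sources c = true ->
  (forall b, In b (sources c) -> (mx m b <= N)%nat) ->
  (cost coins c m <= cost_bound N c)%nat.
Proof.
  intros H Hb. apply cost_le_bound. intros b Hin. split; [|apply Hb, Hin].
  unfold unwritten_sources in H. rewrite forallb_forall in H.
  apply negb_true_iff, H, Hin.
Qed.

Ltac in_cases H := cbn in H; repeat destruct H as [<-|H]; try contradiction.

Lemma gkp_program_run (n : nat) (w : nat -> R) (c : R) (p : nat -> nat -> R) (B : nat -> R)
    (s : nat) (coins : list bool) :
  exists j st,
    (epoch_start j <= s < epoch_start (1 + j))%nat /\
    run gkp_program coins (time_bound 20 n s) (init_state n w c p B s) = Some st /\
    (gkp_valid n w c p B -> forall i, (i < n)%nat ->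
       rr st i = if nth i (drawn_set n (2 ^ j) w c p B (epoch_start j) (s - epoch_start j) s coins)
                        false then 1 else 0).
Proof.
  set (s0 := init_state n w c p B s).
  (* Bounds every iteration count: n, s + 1, (n+1)(s+1), m <= s + 1 and the row length n m + 1. *)
  set (N := ((n + s + 2) * (n + s + 2))%nat).
  set (m0 := prim coins (NConst 3 1) (Mem (rr s0) (xr s0) (ncoins s0))).
  assert (X0 : mx m0 0 = n /\ mx m0 1 = s /\ mx m0 2 = 0%nat /\ mx m0 3 = 1%nat)
    by (repeat split).
  assert (R0 : mr m0 = rr s0) by reflexivity. assert (C0 : mc m0 = 0%nat) by reflexivity.
  assert (Step0 : step gkp_program coins s0 = Some (at_pc 1 m0)) by reflexivity.
  clearbody m0. destruct X0 as (Xn & Xs & X2 & X3).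
  set (m1 := sem coins input_size_init m0).
  set (m2 := sem coins input_size_loop m1).
  set (m3 := sem coins relocate_init m2).
  set (m4 := sem coins relocate_loop m3).
  set (m5 := sem coins relocate_end m4).
  set (m6 := sem coins (tr find_epoch) m5).
  set (m7 := sem coins (tr constants) m6).
  set (m8 := sem coins (tr main_phase) m7).
  set (m9 := sem coins output_init m8).
  set (m10 := sem coins output_loop m9).
  set (m11 := sem coins output_end m10).
  destruct (input_size_spec coins n s m0 Xn Xs X2 X3) as (R2 & C2 & E2).
  fold m1 in R2, C2, E2. fold m2 in R2, C2, E2.
  assert (F2 : forall a, In a [0;1;2;3]%nat -> mx m2 a = mx m0 a).
  { intros a Ha. unfold m2, m1. in_cases Ha; rewrite !sem_nowrite; reflexivity. }
  destruct (relocate_spec coins ((n + 1) * (s + 1)) m2 E2 ltac:(nia)) as (C5 & E5);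
    [rewrite F2; [exact X2 | cbn; tauto] | rewrite F2; [exact X3 | cbn; tauto] |].
  fold m3 in C5, E5. fold m4 in C5, E5. fold m5 in C5, E5.
  assert (F5 : forall a, In a [0;1;2;3]%nat -> mx m5 a = mx m0 a).
  { intros a Ha. rewrite <- F2 by exact Ha. unfold m5, m4, m3.
    in_cases Ha; rewrite !sem_nowrite; reflexivity. }
  assert (V5 : view m5 (abs m5)).
  { apply view_abs; rewrite F5; auto; cbn; tauto. }
  destruct (find_epoch_spec coins (abs m5)) as (j & Hj & Ee & Em);
    [exact (eq_trans (F5 2%nat ltac:(cbn; tauto)) X2) |
     exact (eq_trans (F5 3%nat ltac:(cbn; tauto)) X3) |].
  change (ax (abs m5) 1) with (mx m5 1) in Hj.
  rewrite F5, Xs in Hj by (cbn; tauto).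
  assert (V6 : view m6 (asem coins find_epoch (abs m5)))
    by (apply tr_spec; [vm_compute; reflexivity | exact V5]).
  assert (Hm1 : (1 <= 2 ^ j)%nat) by (clear; induction j; cbn; lia).
  assert (Hm2 : (2 ^ j <= s + 1)%nat) by (pose proof (epoch_start_ge j); lia).
  set (m := (2 ^ j)%nat) in *. set (e := epoch_start j) in *.
  assert (V7 : env n w c p B s e m (asem coins constants (asem coins find_epoch (abs m5)))).
  { apply constants_spec; try assumption.
    - rewrite frame_ax by (vm_compute; reflexivity). cbn [abs ax].
      rewrite F5 by (cbn; tauto). exact Xn.
    - rewrite frame_ax by (vm_compute; reflexivity). cbn [abs ax].
      rewrite F5 by (cbn; tauto). exact Xs.
    - rewrite frame_ax by (vm_compute; reflexivity). cbn [abs ax].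
      rewrite F5 by (cbn; tauto). exact X2.
    - rewrite frame_ax by (vm_compute; reflexivity). cbn [abs ax].
      rewrite F5 by (cbn; tauto). exact X3.
    - rewrite frame_ar by (vm_compute; reflexivity). cbn [abs ar].
      apply init_input. intros i Hi. rewrite Nat.add_0_r, E5 by exact Hi.
      rewrite R2, R0. reflexivity. }
  assert (V7' : view m7 (asem coins constants (asem coins find_epoch (abs m5))))
    by (apply tr_spec; [vm_compute; reflexivity | exact V6]).
  assert (C7 : ac (asem coins constants (asem coins find_epoch (abs m5))) = 0%nat).
  { rewrite !frame_ac by (vm_compute; reflexivity). cbn [abs ac]. rewrite C5, C2. exact C0. }
  assert (E6 : mx m6 xE = e /\ mx m6 xM = m /\ mx m6 0 = n).
  { rewrite !(view_ax _ _ V6) by reflexivity. rewrite Ee, Em. repeat split.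
    rewrite frame_ax by (vm_compute; reflexivity). cbn [abs ax].
    rewrite F5 by (cbn; tauto). exact Xn. }
  revert V7 V7' C7. generalize (asem coins constants (asem coins find_epoch (abs m5))).
  intros S7 V7 V7' C7.
  assert (V8 : view m8 (asem coins main_phase S7))
    by (apply tr_spec; [vm_compute; reflexivity | exact V7']).
  assert (X8 : mx m8 0 = n /\ mx m8 2 = 0%nat /\ mx m8 3 = 1%nat).
  { rewrite (view_0 _ _ V8), (view_1 _ _ V8), (view_ax _ _ V8) by reflexivity.
    rewrite frame_ax by (vm_compute; reflexivity). repeat split. apply V7. }
  destruct X8 as (X8n & X82 & X83).
  assert (Out := output_spec coins n m8 X8n X82 X83).
  fold m9 in Out. fold m10 in Out. fold m11 in Out.
  assert (Em11 : sem coins algorithm m0 = m11)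
    by (unfold algorithm; rewrite !sem_cseq_cons, sem_cseq_nil; reflexivity).
  assert (Ecost : cost coins algorithm m0
    = (cost coins input_size_init m0 + (cost coins input_size_loop m1
       + (cost coins relocate_init m2 + (cost coins relocate_loop m3
       + (cost coins relocate_end m4 + (cost coins (tr find_epoch) m5
       + (cost coins (tr constants) m6 + (cost coins (tr main_phase) m7
       + (cost coins output_init m8 + (cost coins output_loop m9
       + (cost coins output_end m10 + 0)))))))))))%nat)
    by (unfold algorithm; rewrite !cost_cseq_cons, cost_cseq_nil; reflexivity).
  exists j, (at_pc (1 + csize algorithm) m11).
  split; [exact Hj|]. split.
  - rewrite <- Em11. apply gkp_program_halts; try assumption. rewrite Ecost.
    {
      assert (B1 : (cost coins input_size_init m0 <= cost_bound N input_size_init)%nat).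
      { apply phase_cost; [vm_compute; reflexivity|]. intros b Hb. in_cases Hb. }
      assert (B2 : (cost coins input_size_loop m1 <= cost_bound N input_size_loop)%nat).
      { apply phase_cost; [vm_compute; reflexivity|]. intros b Hb. in_cases Hb.
        unfold m1, input_size_init; rexec. rewrite Xs, X3. unfold N; nia. }
      assert (B3 : (cost coins relocate_init m2 <= cost_bound N relocate_init)%nat).
      { apply phase_cost; [vm_compute; reflexivity|]. intros b Hb. in_cases Hb. }
      assert (B4 : (cost coins relocate_loop m3 <= cost_bound N relocate_loop)%nat).
      { apply phase_cost; [vm_compute; reflexivity|]. intros b Hb. in_cases Hb.
        unfold m3, relocate_init; rexec. rewrite E2. unfold N; nia. }
      assert (B5 : (cost coins relocate_end m4 <= cost_bound N relocate_end)%nat).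
      { apply phase_cost; [vm_compute; reflexivity|]. intros b Hb. in_cases Hb. }
      assert (B6 : (cost coins (tr find_epoch) m5 <= cost_bound N (tr find_epoch))%nat).
      { apply phase_cost; [vm_compute; reflexivity|]. intros b Hb. in_cases Hb.
        rewrite F5, Xs by (cbn; tauto). unfold N; nia. }
      assert (B7 : (cost coins (tr constants) m6 <= cost_bound N (tr constants))%nat).
      { apply phase_cost; [vm_compute; reflexivity|]. destruct E6 as (E6e & E6m & E6n).
        intros b Hb. in_cases Hb; rewrite ?E6e, ?E6m, ?E6n; unfold N; nia. }
      assert (B8 : (cost coins (tr main_phase) m7 <= cost_bound N (tr main_phase))%nat).
      { apply phase_cost; [vm_compute; reflexivity|].
        intros b Hb. in_cases Hb; rewrite (view_ax _ _ V7') by reflexivity;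
          rewrite ?(env_str _ _ _ _ _ _ _ _ _ V7), ?(env_h _ _ _ _ _ _ _ _ _ V7),
            ?(env_m _ _ _ _ _ _ _ _ _ V7), ?(env_n _ _ _ _ _ _ _ _ _ V7),
            ?(env_s _ _ _ _ _ _ _ _ _ V7); unfold N; nia. }
      assert (B9 : (cost coins output_init m8 <= cost_bound N output_init)%nat).
      { apply phase_cost; [vm_compute; reflexivity|]. intros b Hb. in_cases Hb. }
      assert (B10 : (cost coins output_loop m9 <= cost_bound N output_loop)%nat).
      { apply phase_cost; [vm_compute; reflexivity|]. intros b Hb. in_cases Hb.
        unfold m9, output_init; rexec. rewrite X8n. unfold N; nia. }
      assert (B11 : (cost coins output_end m10 <= cost_bound N output_end)%nat).
      { apply phase_cost; [vm_compute; reflexivity|]. intros b Hb. in_cases Hb. }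
      (* Loops nest at most two deep, so the bound is quadratic in [N], that is of degree 4 in n + s
         + 2. *)
      assert (T : (cost_bound N algorithm + 2 <= 2000 * (N * N))%nat).
      { assert (4 <= N)%nat by (unfold N; nia). clearbody N. clear - H.
        cbv [algorithm cseq input_size_init input_size_loop relocate_init relocate_loop
          relocate_end output_init output_loop output_end addr tr tr_prim find_epoch constants
          main_phase base_row base_row_loop penalty_loop rows_loop rows_body draw_loop draw_body
          item factor_loop floor_loop row_loop coin_loop epoch_loop stride_loop history_loop
          real_m_loop real_n_loop seqs fold_right ins ld st].
        cbn [cost_bound]. nia. }
      unfold algorithm in T. cbn [cseq cost_bound] in T.
      apply Nat.lt_le_trans with (2000 * (N * N))%nat; [lia|].
      (* Four of the twenty factors n + s + 2 >= 2 cover N^2; the other sixteen absorb 2000 <=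
         2^11. *)
      unfold time_bound. change 20%nat with (16 + 4)%nat. rewrite Nat.pow_add_r.
      apply Nat.mul_le_mono.
      * apply Nat.le_trans with (2 ^ 11)%nat; [apply Nat.leb_le; vm_compute; reflexivity|].
        apply Nat.le_trans with (2 ^ 16)%nat; [apply Nat.pow_le_mono_r; lia|].
        apply Nat.pow_le_mono_l; lia.
      * unfold N. cbn [Nat.pow]. nia. }
  - intros Val i Hi. cbn [at_pc rr]. rewrite Out by exact Hi.
    rewrite (view_ar _ _ V8) by lia.
    apply main_phase_spec; try assumption. lia.
Qed.

(** * Regret over all epochs *)

Lemma epoch_start_mono (i j : nat) : (i <= j)%nat -> (epoch_start i <= epoch_start j)%nat.
Proof. induction 1; cbn [epoch_start]; lia. Qed.

Lemma epoch_unique (i j s : nat) :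
  (epoch_start i <= s < epoch_start (1 + i))%nat ->
  (epoch_start j <= s < epoch_start (1 + j))%nat -> i = j.
Proof.
  intros Hi Hj. destruct (Nat.lt_trichotomy i j) as [H|[H|H]]; [|exact H|].
  - pose proof (epoch_start_mono (1 + i) j ltac:(lia)). lia.
  - pose proof (epoch_start_mono (1 + j) i ltac:(lia)). lia.
Qed.

Lemma epoch_exists (s : nat) : exists j, (epoch_start j <= s < epoch_start (1 + j))%nat.
Proof.
  induction s as [|s [j IH]]; [exists 0%nat; cbn; lia|].
  destruct (Nat.lt_ge_cases (S s) (epoch_start (1 + j))) as [H|H]; [exists j; lia|].
  exists (S j). assert (1 <= 4 ^ (S j))%nat by (clear; induction (S j); cbn; lia).
  change (1 + S j)%nat with (S (S j)). cbn [epoch_start Nat.add] in *. lia.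
Qed.

Lemma epoch_start_eq (j : nat) : (3 * epoch_start j + 1 = 4 ^ j)%nat.
Proof. induction j as [|j IH]; cbn [epoch_start]; [reflexivity|]. rewrite Nat.pow_succ_r'. lia. Qed.

Lemma gkp_profit_ext (n : nat) (w : nat -> R) (c : R) (p : nat -> R) (B : R) (A A' : nat -> bool) :
  (forall i, (i < n)%nat -> A i = A' i) -> gkp_profit n w c p B A = gkp_profit n w c p B A'.
Proof.
  intros H. unfold gkp_profit.
  assert (E : forall h : nat -> R,
    rsum n (fun i => if A i then h i else 0) = rsum n (fun i => if A' i then h i else 0))
    by (intros h; apply rsum_ext; intros i Hi; rewrite H by exact Hi; reflexivity).
  rewrite (E p), (E w). reflexivity.
Qed.

Lemma alg_exp_profit_eq (n : nat) (w : nat -> R) (c : R) (p : nat -> nat -> R) (B : nat -> R)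
    (j s : nat) :
  gkp_valid n w c p B -> (epoch_start j <= s < epoch_start (1 + j))%nat ->
  alg_exp_profit gkp_program 20 n w c p B s
  = avg (time_bound 20 n s) (fun cs => list_profit n w c (p s) (B s)
      (drawn_set n (2 ^ j) w c p B (epoch_start j) (s - epoch_start j) s cs)).
Proof.
  intros V Hj. unfold alg_exp_profit, avg. cbv zeta. f_equal. apply sumL_ext. intros cs _.
  apply gkp_profit_ext. intros i Hi.
  destruct (gkp_program_run n w c p B s cs) as (j' & st & Hj' & Hrun & Hst).
  rewrite (epoch_unique j' j s Hj' Hj) in Hst.
  unfold alg_set. rewrite Hrun. unfold output_set. rewrite (Hst V i Hi).
  destruct (nth i _ false), (Req_EM_T _ 0); lra || reflexivity.
Qed.

(** The coin supply in [alg_exp_profit] has the length of the time bound; n draws of s coins must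
    fit into it. *)
Lemma time_bound_coins (n s : nat) : (n * s <= time_bound 20 n s)%nat.
Proof.
  unfold time_bound. change 20%nat with (18 + 2)%nat. rewrite Nat.pow_add_r.
  assert (1 <= (n + s + 2) ^ 18)%nat.
  { rewrite <- (Nat.pow_1_l 18). apply Nat.pow_le_mono_l. lia. }
  assert (n * s <= (n + s + 2) ^ 2)%nat by (cbn [Nat.pow]; nia).
  revert H H0. generalize ((n + s + 2) ^ 18)%nat, ((n + s + 2) ^ 2)%nat. intros. nia.
Qed.

(** Summing 11 n^2 2^i over the epochs up to the last one, j, gives at most 22 n^2 2^j <= 44 n^2
    sqrt T; the geometric sampling error adds 4 n^2 <= 4 n^2 sqrt T. *)
Lemma regret_bound (n : nat) (w : nat -> R) (c : R) (p : nat -> nat -> R) (B : nat -> R)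
    (T : nat) (A : nat -> bool) :
  gkp_valid n w c p B -> (1 <= n)%nat -> (1 <= T)%nat ->
  regret_vs gkp_program 20 n w c p B T A <= 48 * INR n ^ 2 * sqrt (INR T).
Proof.
  intros V Hn HT.
  set (l0 := map A (seq 0 n)).
  assert (Hl0 : length l0 = n) by (unfold l0; rewrite length_map, length_seq; reflexivity).
  set (r s := gkp_profit n w c (p s) (B s) A - alg_exp_profit gkp_program 20 n w c p B s).
  assert (HA : forall s, gkp_profit n w c (p s) (B s) A = list_profit n w c (p s) (B s) l0).
  { intros s. apply gkp_profit_ext. intros i Hi. unfold l0.
    rewrite (nth_indep _ false (A 0%nat)) by (rewrite length_map, length_seq; exact Hi).
    rewrite map_nth, seq_nth by exact Hi. reflexivity. }
  assert (Hep : forall j t, (t <= 4 ^ j)%nat ->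
    rsum t (fun q => r (epoch_start j + q)%nat)
    <= 11 * INR n ^ 2 * 2 ^ j + 2 * INR n ^ 2 * rsum t (fun q => / 2 ^ (epoch_start j + q))).
  { intros j t Ht.
    assert (Hm : (1 <= 2 ^ j)%nat) by (clear; induction j; cbn; lia).
    assert (Ht' : (t <= 2 ^ j * 2 ^ j)%nat) by (rewrite <- Nat.pow_mul_l; exact Ht).
    assert (E := epoch_regret n w c p B (2 ^ j) (epoch_start j) t (time_bound 20 n) l0
      V Hn Hm Ht' (time_bound_coins n) Hl0).
    rewrite pow_INR in E. change (INR 2) with 2 in E.
    eapply Rle_trans; [|exact E]. right. apply rsum_ext. intros q Hq. unfold r.
    rewrite HA, (alg_exp_profit_eq n w c p B j) by (try exact V; cbn [epoch_start Nat.add]; lia).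
    replace (epoch_start j + q - epoch_start j)%nat with q by lia. reflexivity. }
  assert (Hcum : forall j, rsum (epoch_start j) r
    <= 11 * INR n ^ 2 * (2 ^ j - 1) + 2 * INR n ^ 2 * rsum (epoch_start j) (fun s => / 2 ^ s)).
  { induction j as [|j IH]; [unfold rsum; cbn; lra|].
    cbn [epoch_start pow]. rewrite !rsum_add. specialize (Hep j (4 ^ j)%nat (le_n _)). lra. }
  destruct (epoch_exists (T - 1)) as [j Hj].
  assert (ET : T = (epoch_start j + (T - epoch_start j))%nat) by lia.
  assert (Htot : rsum T r <= 11 * INR n ^ 2 * (2 * 2 ^ j - 1)
                   + 2 * INR n ^ 2 * rsum T (fun s => / 2 ^ s)).
  { rewrite ET, !rsum_add. specialize (Hcum j).
    specialize (Hep j (T - epoch_start j)%nat ltac:(cbn [epoch_start Nat.add] in Hj; lia)). lra. }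
  unfold regret_vs.
  replace (rsum T (fun s => gkp_profit n w c (p s) (B s) A)
           - rsum T (fun s => alg_exp_profit gkp_program 20 n w c p B s)) with (rsum T r).
  2: { transitivity (1 * rsum T (fun s => gkp_profit n w c (p s) (B s) A)
         + (-1) * rsum T (fun s => alg_exp_profit gkp_program 20 n w c p B s)); [|ring].
       rewrite <- rsum_lin. apply rsum_ext. intros; unfold r; ring. }
  assert (Hgeom := rsum_geom T).
  (* The last epoch starts at or before round T - 1 and 4^j = 3 epoch_start j + 1, hence 4^j <= 4
     T. *)
  assert (H2j : 2 ^ j <= 2 * sqrt (INR T)).
  { assert (4 ^ j <= 4 * T)%nat by (pose proof (epoch_start_eq j); lia).
    apply le_INR in H. rewrite mult_INR, pow_INR in H.
    replace (INR 4) with (2 * 2) in H by (cbn; ring). rewrite Rpow_mult_distr in H.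
    pose proof (pos_INR T).
    rewrite <- (sqrt_square (2 ^ j)) by (apply pow_le; lra).
    replace (2 * sqrt (INR T)) with (sqrt (2 * 2 * INR T)).
    - apply sqrt_le_1_alt, H.
    - rewrite sqrt_mult by lra. rewrite sqrt_square by lra. reflexivity. }
  assert (HsT : 1 <= sqrt (INR T)).
  { rewrite <- sqrt_1. apply sqrt_le_1_alt. apply (le_INR 1), HT. }
  assert (0 <= INR n ^ 2) by apply pow2_ge_0.
  assert (K1 : INR n ^ 2 * 2 ^ j <= INR n ^ 2 * (2 * sqrt (INR T)))
    by (apply Rmult_le_compat_l; assumption).
  assert (K2 : INR n ^ 2 * rsum T (fun s => / 2 ^ s) <= INR n ^ 2 * (2 * sqrt (INR T)))
    by (apply Rmult_le_compat_l; [assumption | lra]).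
  lra.
Qed.

(* There is a polynomial-time vanishing-regret algorithm for online GKP:
   a program P, a degree k (time bound (n+t+2)^k per decision and regret
   polynomial (n+1)^k) and an exponent 0 <= g < 1 such that, for every
   instance and every (oblivious) sequence of profits/capacities, the
   expected regret against every fixed set A after T >= 1 rounds is at
   most (n+1)^k * T^g. *)
Theorem theorem4 :
  exists (P : program) (k : nat) (g : R),
    0 <= g < 1 /\
    poly_time P k /\
    forall (n : nat) (w : nat -> R) (c : R)
           (p : nat -> nat -> R) (B : nat -> R) (T : nat),
      gkp_valid n w c p B ->
      (1 <= T)%nat ->
      forall A : nat -> bool,
        regret_vs P k n w c p B T A <= INR ((n + 1) ^ k) * Rpower (INR T) g.
Proof.
  (* The degree 20 comes from the running time; the exponent 1/2 is the square root in
     [regret_bound]. *)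
  exists gkp_program, 20%nat, (/ 2). split; [lra|]. split.
  - intros n w c p B s coins _.
    destruct (gkp_program_run n w c p B s coins) as (j & st & _ & -> & _). discriminate.
  - intros n w c p B T V HT A.
    assert (HT' : 0 < INR T) by (apply lt_0_INR; lia).
    rewrite Rpower_sqrt by exact HT'.
    assert (Hs : 0 <= sqrt (INR T)) by apply sqrt_pos.
    (* Without items every profit is 0; [regret_bound] assumes n >= 1. *)
    destruct n as [|n].
    + replace (regret_vs gkp_program 20 0 w c p B T A) with 0.
      * apply Rmult_le_pos; [apply pos_INR | exact Hs].
      * destruct V as (_ & _ & _ & HB).
        assert (G : forall s A', gkp_profit 0 w c (p s) (B s) A' = 0).
        { intros s A'. unfold gkp_profit, rsum; cbn. specialize (HB s).
          rewrite Rmax_left by lra. ring. }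
        unfold regret_vs.
        rewrite (rsum_ext T _ (fun _ => 0)) by (intros; apply G).
        rewrite (rsum_ext T (fun s => alg_exp_profit _ _ _ _ _ _ _ _) (fun _ => 0)).
        -- rewrite rsum_const. ring.
        -- intros s _. unfold alg_exp_profit. cbv zeta.
           change (fold_right Rplus 0 (map ?f ?l)) with (sumL f l).
           rewrite (sumL_ext _ (fun _ => 0)) by (intros; apply G).
           rewrite sumL_const. unfold Rdiv. ring.
    + eapply Rle_trans; [apply regret_bound; [exact V | lia | exact HT]|].
      apply Rmult_le_compat_r; [exact Hs|].
      rewrite pow_INR. change 20%nat with (2 + 18)%nat. rewrite pow_add.
      rewrite plus_INR. change (INR 1) with 1.
      assert (H1 : 1 <= INR (S n)) by (apply (le_INR 1); lia).
      set (x := INR (S n)) in *.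
      (* Two of the twenty factors x + 1 >= 2 dominate x^2, and the other eighteen dominate 48 <=
         2^6. *)
      assert (H2 : 2 ^ 6 <= (x + 1) ^ 18).
      { apply Rle_trans with (2 ^ 18); [apply Rle_pow; [lra | lia]|].
        apply pow_incr; lra. }
      assert (H3 : x ^ 2 <= (x + 1) ^ 2) by (apply pow_incr; lra).
      assert (0 <= x ^ 2) by apply pow2_ge_0.
      replace (48 * x ^ 2) with (x ^ 2 * 48) by ring.
      apply Rmult_le_compat; lra.
Qed.
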